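(* Let $k$ be an algebraically closed field, let $H$ be a finitely presented Hopf algebra over $k$ (i.e. finitely presented as an algebra), let $X$ be a finite dimensional left $H$-comodule which tensor-generates $H\text{-}\mathrm{comod}$, and let $R$, $\xi_0,\dots,\xi_m$ be the data attached to $H$ and $X$ in the context. Let $\mathcal{E}$ be a tensor category over $k$. Then a tensor functor $F:H\text{-}\mathrm{comod}\to\mathcal{E}$ is determined up to an isomorphism by $F(X)$, $F(R)$, and the morphisms $F(\xi_j):F(R)\to F(X)^{\otimes j}\otimes X_{\mathrm{space}}^{*\otimes j}$, $j=0,\dots,m$. That is, the tensor category $H\text{-}\mathrm{comod}$ is finitely dominated (by $X$, $R$ and $\{\xi_j\}$).
   Context: A tensor category over $k$ is a locally finite $k$-linear abelian rigid monoidal category with bilinear tensor product and $\mathrm{End}(\mathbf{1})=k$; tensor functors are exact, faithful, $k$-linear monoidal functors. $H\text{-}\mathrm{comod}$ is the tensor category of finite dimensional left $H$-comodules. A tensor category $\mathcal{C}$ is tensor-generated by $X$ if every object of $\mathcal{C}$ is a subquotient of a direct sum of tensor powers of $X$; for $\mathcal{C}=H\text{-}\mathrm{comod}$ this means that the matrix elements of $X$ generate $H$ as an algebra. Data: the subscript ''space'' means that an object is regarded just as a vector space. Given $X$ there is a natural surjective homomorphism of $H$-bicomodule algebras $\theta:T(X\otimes{}^*X)\to H$ from the tensor algebra, sending $X\otimes{}^*X$ to the matrix elements of $X$. Since $H$ is finitely presented, the ideal $\mathrm{Ker}\,\theta$ is generated by a finite dimensional sub-bicomodule $R\subset\bigoplus_{j=0}^m(X\otimes{}^*X)^{\otimes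 j}$; fix such $R$ and $m$. Let $\xi_j:R\to(X\otimes{}^*X)^{\otimes j}$, $j=0,\dots,m$, be the corresponding projections; regarded as morphisms of left $H$-comodules they are maps $\xi_j:R\to X^{\otimes j}\otimes X_{\mathrm{space}}^{*\otimes j}$. Domination: let $\mathcal{C}$ be a tensor category, $\{V_i\}$ a collection of objects, and $\{f_j\}$ a collection of morphisms between tensor products of the $V_i$ (possibly, as for the $\xi_j$, tensored with finite dimensional vector spaces). $\mathcal{C}$ is dominated by $\{V_i\}$ and $\{f_j\}$ if any tensor functor $F$ from $\mathcal{C}$ to any tensor category $\mathcal{E}$ is determined by $\{F(V_i)\}$ and $\{F(f_j)\}$ up to an isomorphism; here $F(f_j)$ means the morphism between tensor products of the $F(V_i)$ corresponding to $f_j$ via the tensor structure of $F$. $\mathcal{C}$ is finitely dominated if it is dominated by a finite collection of objects and morphisms. *)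

(* Defs.v *)
From HB Require Import structures.
From mathcomp Require Import all_boot all_algebra.
From mathcomp Require Import boolp.

Set Implicit Arguments.
Unset Strict Implicit.
Unset Printing Implicit Defensive.

Import GRing.Theory.
Local Open Scope ring_scope.

Reserved Notation "u ⊗ v" (at level 40, left associativity).
Reserved Notation "g ∘ f" (at level 40, left associativity).
Reserved Notation "A ⊠ B" (at level 38, left associativity).

Definition bilin (k : fieldType) (U V W : lmodType k) (b : U -> V -> W) : Prop :=
  (forall v, linear (b^~ v)) /\ (forall u, linear (b u)).

(* The tensor product U ⊗ V over k, as formal sums of pairs (u, v) modulo the
   relations satisfied by every bilinear map out of U x V; the universal
   property is tlift below. *)
Section Tensor.
Local Open Scope quotient_scope.
Variables (k : fieldType) (U V : lmodType k).

Definition teval (W : lmodType k) (b : U -> V -> W) (s : seq (U * V)) : W :=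
  \sum_(p <- s) b p.1 p.2.

Definition tens_rel : rel (seq (U * V)) := fun s t =>
  `[< forall (W : lmodType k) (b : U -> V -> W), bilin b ->
        teval b s = teval b t >].

Lemma tens_rel_refl : reflexive tens_rel.
Proof. by move=> s; apply/asboolP. Qed.
Lemma tens_rel_sym : symmetric tens_rel.
Proof. by move=> s t; apply/asboolP/asboolP => h W b hb; rewrite h. Qed.
Lemma tens_rel_trans : transitive tens_rel.
Proof.
by move=> s t r /asboolP h1 /asboolP h2; apply/asboolP => W b hb; rewrite h1 ?h2.
Qed.

Canonical tens_equiv := EquivRel tens_rel tens_rel_refl tens_rel_sym tens_rel_trans.

Definition tens := {eq_quot tens_equiv}.
HB.instance Definition _ := Choice.on tens.
HB.instance Definition _ := EqQuotient.on tens.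

Lemma tensP (x y : tens) :
  (forall (W : lmodType k) (b : U -> V -> W), bilin b ->
     teval b (repr x) = teval b (repr y)) -> x = y.
Proof.
move=> h; rewrite -[x]reprK -[y]reprK; apply/eqmodP; exact/asboolP.
Qed.

Lemma teval_pi (W : lmodType k) (b : U -> V -> W) s :
  bilin b -> teval b (repr (\pi_tens s)) = teval b s.
Proof.
by move=> hb; have /eqmodP/asboolP -> := reprK (\pi_tens s).
Qed.

Definition tens_zero : tens := \pi_tens [::].
Definition tens_opp (x : tens) : tens :=
  \pi_tens [seq (- p.1, p.2) | p <- repr x].
Definition tens_add (x y : tens) : tens := \pi_tens (repr x ++ repr y).
Definition tens_scale (a : k) (x : tens) : tens :=
  \pi_tens [seq (a *: p.1, p.2) | p <- repr x].

Section Eval.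
Variables (W : lmodType k) (b : U -> V -> W) (hb : bilin b).
Let bl v : {linear U -> W} :=
  HB.pack (b^~ v) (GRing.isLinear.Build _ _ _ _ _ (hb.1 v)).
Lemma teval0 : teval b (repr tens_zero) = 0.
Proof. by rewrite teval_pi // /teval big_nil. Qed.
Lemma tevalD x y :
  teval b (repr (tens_add x y)) = teval b (repr x) + teval b (repr y).
Proof. by rewrite teval_pi // /teval big_cat. Qed.
Lemma tevalN x : teval b (repr (tens_opp x)) = - teval b (repr x).
Proof.
rewrite teval_pi // /teval big_map -sumrN; apply: eq_bigr => p _ /=.
exact: (linearN (bl p.2)).
Qed.
Lemma tevalZ a x : teval b (repr (tens_scale a x)) = a *: teval b (repr x).
Proof.
rewrite teval_pi // /teval big_map scaler_sumr; apply: eq_bigr => p _ /=.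
exact: (linearZ_LR (bl p.2)).
Qed.
End Eval.

Fact tens_addA : associative tens_add.
Proof. by move=> x y z; apply: tensP => W b hb; rewrite !tevalD // addrA. Qed.
Fact tens_addC : commutative tens_add.
Proof. by move=> x y; apply: tensP => W b hb; rewrite !tevalD // addrC. Qed.
Fact tens_add0 : left_id tens_zero tens_add.
Proof. by move=> x; apply: tensP => W b hb; rewrite tevalD // teval0 // add0r. Qed.
Fact tens_addN : left_inverse tens_zero tens_opp tens_add.
Proof.
by move=> x; apply: tensP => W b hb; rewrite tevalD // tevalN // teval0 // addNr.
Qed.
HB.instance Definition _ :=
  GRing.isZmodule.Build tens tens_addA tens_addC tens_add0 tens_addN.

Fact tens_scaleA a c x : tens_scale a (tens_scale c x) = tens_scale (a * c) x.
Proof. by apply: tensP => W b hb; rewrite !tevalZ // scalerA. Qed.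
Fact tens_scale1 : left_id 1 tens_scale.
Proof. by move=> x; apply: tensP => W b hb; rewrite tevalZ // scale1r. Qed.
Fact tens_scaleDr : right_distributive tens_scale +%R.
Proof.
by move=> a x y; apply: tensP => W b hb; rewrite !(tevalZ, tevalD) // scalerDr.
Qed.
Fact tens_scaleDl x : {morph tens_scale^~ x : a c / a + c}.
Proof.
by move=> a c; apply: tensP => W b hb; rewrite !(tevalZ, tevalD) // scalerDl.
Qed.
HB.instance Definition _ := GRing.Zmodule_isLmodule.Build k tens
  tens_scaleA tens_scale1 tens_scaleDr tens_scaleDl.

Definition tpure (u : U) (v : V) : tens := \pi_tens [:: (u, v)].

Definition tlift (W : lmodType k) (b : U -> V -> W) (hb : bilin b) (x : tens) : W :=
  teval b (repr x).

Fact tlift_linear W b hb : linear (@tlift W b hb).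
Proof.
move=> a x y; rewrite /tlift.
by rewrite (tevalD hb (tens_scale a x) y) (tevalZ hb).
Qed.
HB.instance Definition _ (W : lmodType k) (b : U -> V -> W) (hb : bilin b) :=
  GRing.isLinear.Build k tens W _ (@tlift W b hb) (@tlift_linear W b hb).

Lemma tliftE W b hb u v : @tlift W b hb (tpure u v) = b u v.
Proof. by rewrite /tlift teval_pi // /teval big_seq1. Qed.

Lemma tpure_bilin : bilin tpure.
Proof.
split=> [v|u] a x y; apply: tensP => W b hb.
  rewrite (tevalD hb (tens_scale a (tpure x v))) (tevalZ hb) !teval_pi //.
  by rewrite /teval !big_seq1 /= hb.1.
rewrite (tevalD hb (tens_scale a (tpure u x))) (tevalZ hb) !teval_pi //.
by rewrite /teval !big_seq1 /= hb.2.
Qed.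

Lemma tens_sum (x : tens) : x = \sum_(p <- repr x) tpure p.1 p.2.
Proof.
apply: tensP => W b hb; rewrite -!/(tlift hb _) linear_sum /=.
by rewrite /tlift {1}/teval; apply: eq_bigr => p _; rewrite -/(tlift hb _) tliftE.
Qed.

Lemma tens_ind (P : tens -> Prop) :
  (forall u v, P (tpure u v)) -> (forall x y, P x -> P y -> P (x + y)) ->
  forall x, P x.
Proof.
move=> hp hD x; rewrite (tens_sum x).
elim: (repr x) => [|p s IHs]; rewrite ?big_nil ?big_cons; last exact: hD.
suff -> : 0 = tpure 0 0 by [].
have h := tpure_bilin.2 0 (-1) 0 0.
by move: h; rewrite scaler0 addr0 scaleN1r addNr.
Qed.

End Tensor.

Notation "u ⊗ v" := (tpure u v) : ring_scope.

Section TensorOps.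
Variable k : fieldType.
Implicit Types U V W : lmodType k.

Lemma tpureDl U V (u u' : U) (v : V) : (u + u') ⊗ v = u ⊗ v + u' ⊗ v.
Proof. by have := (tpure_bilin U V).1 v 1 u u'; rewrite !scale1r. Qed.
Lemma tpureDr U V (u : U) (v v' : V) : u ⊗ (v + v') = u ⊗ v + u ⊗ v'.
Proof. by have := (tpure_bilin U V).2 u 1 v v'; rewrite !scale1r. Qed.
Lemma tpure0l U V (v : V) : (0 : U) ⊗ v = 0.
Proof. by apply: (addrI (0 ⊗ v)); rewrite -tpureDl !addr0. Qed.
Lemma tpure0r U V (u : U) : u ⊗ (0 : V) = 0.
Proof. by apply: (addrI (u ⊗ 0)); rewrite -tpureDr !addr0. Qed.
Lemma tpureZl U V a (u : U) (v : V) : (a *: u) ⊗ v = a *: (u ⊗ v).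
Proof. by have := (tpure_bilin U V).1 v a u 0; rewrite !addr0 tpure0l addr0. Qed.
Lemma tpureZr U V a (u : U) (v : V) : u ⊗ (a *: v) = a *: (u ⊗ v).
Proof. by have := (tpure_bilin U V).2 u a v 0; rewrite !addr0 tpure0r addr0. Qed.

Lemma tens_ext U V W (f g : {linear tens U V -> W}) :
  (forall u v, f (u ⊗ v) = g (u ⊗ v)) -> forall x, f x = g x.
Proof.
move=> h; elim/tens_ind => [//|x y IHx IHy].
by rewrite !linearD IHx IHy.
Qed.

Lemma tens_ext2 U V U' V' W (f g : {linear tens (tens U V) (tens U' V') -> W}) :
  (forall u v u' v', f (u ⊗ v ⊗ (u' ⊗ v')) = g (u ⊗ v ⊗ (u' ⊗ v'))) ->
  forall x, f x = g x.
Proof.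
move=> h; apply: tens_ext => x y; elim/tens_ind: x => [u v|x x' hx hx']; last first.
  by rewrite tpureDl !linearD hx hx'.
elim/tens_ind: y => [//|y y' hy hy'].
by rewrite tpureDr !linearD hy hy'.
Qed.

Lemma tens_ext3l U V V' W (f g : {linear tens (tens U V) V' -> W}) :
  (forall u v v', f (u ⊗ v ⊗ v') = g (u ⊗ v ⊗ v')) -> forall x, f x = g x.
Proof.
move=> h; apply: tens_ext => x y; elim/tens_ind: x => [//|x x' hx hx'].
by rewrite tpureDl !linearD hx hx'.
Qed.

Section Map.
Variables (U U' V V' : lmodType k) (f : {linear U -> U'}) (g : {linear V -> V'}).
Fact tmap_bilin : bilin (fun u v => f u ⊗ g v).
Proof.
by split=> [v|u] a x y; rewrite linearP (tpureDl, tpureDr) (tpureZl, tpureZr).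
Qed.
Definition tmap : tens U V -> tens U' V' := tlift tmap_bilin.
HB.instance Definition _ := GRing.Linear.on tmap.
Lemma tmapE u v : tmap (u ⊗ v) = f u ⊗ g v. Proof. exact: tliftE. Qed.
End Map.

Section Swap.
Variables U V : lmodType k.
Fact tswap_bilin : bilin (fun (u : U) (v : V) => v ⊗ u).
Proof.
by split=> [v|u] a x y; rewrite (tpureDl, tpureDr) (tpureZl, tpureZr).
Qed.
Definition tswap : tens U V -> tens V U := tlift tswap_bilin.
HB.instance Definition _ := GRing.Linear.on tswap.
Lemma tswapE u v : tswap (u ⊗ v) = v ⊗ u. Proof. exact: tliftE. Qed.
End Swap.

Section Const.
Variables U V : lmodType k.
Fact tpurer_linear (v : V) : linear (fun u : U => u ⊗ v).
Proof. by move=> a x y; rewrite tpureDl tpureZl. Qed.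
Definition tpurer (v : V) : U -> tens U V := fun u => u ⊗ v.
Lemma tpurerE v u : tpurer v u = u ⊗ v. Proof. by []. Qed.
HB.instance Definition _ v :=
  GRing.isLinear.Build k U (tens U V) _ (tpurer v) (tpurer_linear v).
Fact tpurel_linear (u : U) : linear (fun v : V => u ⊗ v).
Proof. by move=> a x y; rewrite tpureDr tpureZr. Qed.
Definition tpurel (u : U) : V -> tens U V := fun v => u ⊗ v.
Lemma tpurelE u v : tpurel u v = u ⊗ v. Proof. by []. Qed.
HB.instance Definition _ u :=
  GRing.isLinear.Build k V (tens U V) _ (tpurel u) (tpurel_linear u).
End Const.

Lemma tpure_suml U V I (r : seq I) (P : pred I) (F : I -> U) (v : V) :
  (\sum_(i <- r | P i) F i) ⊗ v = \sum_(i <- r | P i) F i ⊗ v.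
Proof. exact: (@linear_sum _ _ _ _ (tpurer v)). Qed.
Lemma tpure_sumr U V I (r : seq I) (P : pred I) (u : U) (F : I -> V) :
  u ⊗ (\sum_(i <- r | P i) F i) = \sum_(i <- r | P i) u ⊗ F i.
Proof. exact: (@linear_sum _ _ _ _ (tpurel u)). Qed.

Section Assoc.
Variables U V W : lmodType k.
Fact tassoc_bilin : bilin (fun (x : tens U V) (w : W) =>
  tmap idfun (tpurer w) x : tens U (tens V W)).
Proof.
split=> [w|x] a y z; first by rewrite linearP.
elim/tens_ind: x => [u v|x x' IHx IHx'].
  by rewrite !tmapE /= !tpurerE tpureDr tpureZr tpureDr tpureZr.
by rewrite !linearD /= IHx IHx' addrACA.
Qed.
Definition tassoc : tens (tens U V) W -> tens U (tens V W) := tlift tassoc_bilin.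
HB.instance Definition _ := GRing.Linear.on tassoc.
Lemma tassocE u v w : tassoc (u ⊗ v ⊗ w) = u ⊗ (v ⊗ w).
Proof. by rewrite /tassoc tliftE tmapE. Qed.

Fact tassocV_bilin : bilin (fun (u : U) (y : tens V W) =>
  tmap (tpurel u) idfun y : tens (tens U V) W).
Proof.
split=> [y|u] a x z; last by rewrite linearP.
elim/tens_ind: y => [v w|y y' IHy IHy'].
  by rewrite !tmapE /= !tpurelE tpureDl tpureZl tpureDl tpureZl.
by rewrite !linearD /= IHy IHy' addrACA.
Qed.
Definition tassocV : tens U (tens V W) -> tens (tens U V) W := tlift tassocV_bilin.
HB.instance Definition _ := GRing.Linear.on tassocV.
Lemma tassocVE u v w : tassocV (u ⊗ (v ⊗ w)) = u ⊗ v ⊗ w.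
Proof. by rewrite /tassocV tliftE tmapE. Qed.
End Assoc.

Lemma tassocK U V W : cancel (@tassoc U V W) (@tassocV U V W).
Proof.
elim/tens_ind => [x w|x y hx hy]; last by rewrite !linearD /= hx hy.
elim/tens_ind: x => [u v|x y hx hy]; first by rewrite tassocE tassocVE.
by rewrite tpureDl !linearD /= hx hy.
Qed.
Lemma tassocVK U V W : cancel (@tassocV U V W) (@tassoc U V W).
Proof.
elim/tens_ind => [u x|x y hx hy]; last by rewrite !linearD /= hx hy.
elim/tens_ind: x => [v w|x y hx hy]; first by rewrite tassocVE tassocE.
by rewrite tpureDr !linearD /= hx hy.
Qed.

Section Scal.
Variable V : lmodType k.
Fact tscall_bilin : bilin (fun (c : k^o) (v : V) => (c : k) *: v).
Proof.
split=> [v|u] a x y; first by rewrite scalerDl scalerA.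
by rewrite scalerDr !scalerA mulrC.
Qed.
Definition tscall : tens k^o V -> V := tlift tscall_bilin.
HB.instance Definition _ := GRing.Linear.on tscall.
Lemma tscallE (c : k) v : tscall ((c : k^o) ⊗ v) = c *: v.
Proof. exact: tliftE. Qed.
Fact tscalr_bilin : bilin (fun (v : V) (c : k^o) => (c : k) *: v).
Proof. by case: tscall_bilin => h1 h2; split. Qed.
Definition tscalr : tens V k^o -> V := tlift tscalr_bilin.
HB.instance Definition _ := GRing.Linear.on tscalr.
Lemma tscalrE (c : k) v : tscalr (v ⊗ (c : k^o)) = c *: v.
Proof. exact: tliftE. Qed.
End Scal.

Section Mid.
Variables U V U' V' : lmodType k.
Definition tmid : tens (tens U V) (tens U' V') -> tens (tens U U') (tens V V') :=
  @tassocV U U' (tens V V')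
    \o tmap idfun (@tassoc U' V V' \o (tmap (@tswap V U') idfun \o @tassocV V U' V'))
    \o @tassoc U V (tens U' V').
HB.instance Definition _ := GRing.Linear.on tmid.
Lemma tmidE u v u' v' : tmid (u ⊗ v ⊗ (u' ⊗ v')) = u ⊗ u' ⊗ (v ⊗ v').
Proof.
by rewrite /tmid /= tassocE tmapE /= tassocVE tmapE /= tswapE tassocE tassocVE.
Qed.
End Mid.

Section Alg.
Variable A : algType k.
Fact tmu_bilin : bilin (fun x y : A => x * y).
Proof.
split=> [v|u] a x y; first by rewrite mulrDl scalerAl.
by rewrite mulrDr scalerAr.
Qed.
Definition tmu : tens A A -> A := tlift tmu_bilin.
HB.instance Definition _ := GRing.Linear.on tmu.
Lemma tmuE x y : tmu (x ⊗ y) = x * y. Proof. exact: tliftE. Qed.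

Definition tpairl (V W : lmodType k) :
    tens (tens A V) (tens A W) -> tens A (tens V W) :=
  tmap tmu idfun \o @tmid A V A W.
HB.instance Definition _ V W := GRing.Linear.on (@tpairl V W).
Lemma tpairlE (V W : lmodType k) a (v : V) b (w : W) :
  tpairl (a ⊗ v ⊗ (b ⊗ w)) = (a * b) ⊗ (v ⊗ w).
Proof. by rewrite /tpairl /= tmidE tmapE /= tmuE. Qed.

Definition tpairr (V W : lmodType k) :
    tens (tens V A) (tens W A) -> tens (tens V W) A :=
  tmap idfun tmu \o @tmid V A W A.
HB.instance Definition _ V W := GRing.Linear.on (@tpairr V W).
Lemma tpairrE (V W : lmodType k) a (v : V) b (w : W) :
  tpairr (v ⊗ a ⊗ (w ⊗ b)) = (v ⊗ w) ⊗ (a * b).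
Proof. by rewrite /tpairr /= tmidE tmapE /= tmuE. Qed.

Definition tmul : tens (tens A A) (tens A A) -> tens A A :=
  tmap tmu tmu \o @tmid A A A A.
HB.instance Definition _ := GRing.Linear.on tmul.
Lemma tmulE a b c d : tmul (a ⊗ b ⊗ (c ⊗ d)) = (a * c) ⊗ (b * d).
Proof. by rewrite /tmul /= tmidE tmapE /= !tmuE. Qed.
End Alg.

End TensorOps.

Section TensorVect.
Import VectorInternalTheory.
Variables (k : fieldType) (U V : vectType k).
Let m := dim U. Let n := dim V.
Fact tv2r_bilin : bilin (fun (u : U) (v : V) => mxvec ((v2r u)^T *m v2r v)).
Proof.
split=> [v|u] a x y; rewrite -linearP /=; congr mxvec.
  by rewrite !linearP /= mulmxDl scalemxAl.
by rewrite !linearP.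
Qed.
Let r2t (r : 'rV[k]_(m * n)) : tens U V :=
  \sum_i \sum_j vec_mx r i j *: (@r2v k U (delta_mx 0 i) ⊗ @r2v k V (delta_mx 0 j)).
Fact r2t_linear : linear r2t.
Proof.
move=> a x y; rewrite /r2t scaler_sumr -big_split; apply: eq_bigr => i _ /=.
rewrite scaler_sumr -big_split; apply: eq_bigr => j _ /=.
by rewrite linearP /= mxE mxE scalerDl scalerA.
Qed.
Fact tv2r_bij : bijective (tlift tv2r_bilin).
Proof.
pose g : {linear _ -> _} := HB.pack r2t (GRing.isLinear.Build _ _ _ _ _ r2t_linear).
exists g => [|r].
  apply: (@tens_ext _ _ _ _ (g \o tlift tv2r_bilin) idfun) => u v /=.
  rewrite tliftE /r2t mxvecK.
  rewrite -{2}[u]v2rK -{2}[v]v2rK [v2r u in RHS]row_sum_delta [v2r v in RHS]row_sum_delta.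
  rewrite !linear_sum /=.
  rewrite tpure_suml; apply: eq_bigr => i _.
  rewrite tpure_sumr; apply: eq_bigr => j _.
  rewrite !linearZ /= tpureZl tpureZr scalerA; congr (_ *: _).
  by rewrite mxE big_ord1 mxE.
rewrite /= /r2t linear_sum /=.
rewrite -[RHS]vec_mxK [vec_mx r in RHS]matrix_sum_delta linear_sum.
apply: eq_bigr => i _; rewrite !linear_sum; apply: eq_bigr => j _ /=.
rewrite !linearZ /= tliftE !r2vK; congr (_ *: mxvec _).
by rewrite trmx_delta mul_delta_mx.
Qed.
HB.instance Definition _ := Lmodule_hasFinDim.Build k (tens U V)
  (exist2 _ _ (tlift tv2r_bilin) (tlift_linear tv2r_bilin) tv2r_bij).
End TensorVect.

(* The tensor algebra T(W), as formal combinations of words in W modulo the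
   relations satisfied in every k-algebra receiving a linear map from W; the
   universal property is talg_lift below. *)
Section TensorAlgebra.
Local Open Scope quotient_scope.
Variables (k : fieldType) (W : lmodType k).

Definition aeval (A : algType k) (f : {linear W -> A}) (s : seq (k * seq W)) : A :=
  \sum_(p <- s) p.1 *: \prod_(w <- p.2) f w.

Definition talg_rel : rel (seq (k * seq W)) := fun s t =>
  `[< forall (A : algType k) (f : {linear W -> A}), aeval f s = aeval f t >].

Lemma talg_rel_refl : reflexive talg_rel.
Proof. by move=> s; apply/asboolP. Qed.
Lemma talg_rel_sym : symmetric talg_rel.
Proof. by move=> s t; apply/asboolP/asboolP => h A f; rewrite h. Qed.
Lemma talg_rel_trans : transitive talg_rel.
Proof.
by move=> s t r /asboolP h1 /asboolP h2; apply/asboolP => A f; rewrite h1.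
Qed.
Canonical talg_equiv := EquivRel talg_rel talg_rel_refl talg_rel_sym talg_rel_trans.

Definition talg := {eq_quot talg_equiv}.
HB.instance Definition _ := Choice.on talg.
HB.instance Definition _ := EqQuotient.on talg.

Lemma talgP (x y : talg) :
  (forall (A : algType k) (f : {linear W -> A}), aeval f (repr x) = aeval f (repr y))
  -> x = y.
Proof.
by move=> h; rewrite -[x]reprK -[y]reprK; apply/eqmodP; exact/asboolP.
Qed.

Lemma aeval_pi (A : algType k) (f : {linear W -> A}) s :
  aeval f (repr (\pi_talg s)) = aeval f s.
Proof. by have /eqmodP/asboolP -> := reprK (\pi_talg s). Qed.

Definition talg_zero : talg := \pi_talg [::].
Definition talg_opp (x : talg) : talg := \pi_talg [seq (- p.1, p.2) | p <- repr x].
Definition talg_add (x y : talg) : talg := \pi_talg (repr x ++ repr y).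
Definition talg_scale (a : k) (x : talg) : talg :=
  \pi_talg [seq (a * p.1, p.2) | p <- repr x].
Definition talg_one : talg := \pi_talg [:: (1, [::])].
Definition talg_mul (x y : talg) : talg :=
  \pi_talg [seq (p.1 * q.1, p.2 ++ q.2) | p <- repr x, q <- repr y].

Section Eval.
Variables (A : algType k) (f : {linear W -> A}).
Lemma aeval0 : aeval f (repr talg_zero) = 0.
Proof. by rewrite aeval_pi /aeval big_nil. Qed.
Lemma aevalD x y :
  aeval f (repr (talg_add x y)) = aeval f (repr x) + aeval f (repr y).
Proof. by rewrite aeval_pi /aeval big_cat. Qed.
Lemma aevalN x : aeval f (repr (talg_opp x)) = - aeval f (repr x).
Proof.
rewrite aeval_pi /aeval big_map -sumrN.
by apply: eq_bigr => p _ /=; rewrite scaleNr.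
Qed.
Lemma aevalZ a x : aeval f (repr (talg_scale a x)) = a *: aeval f (repr x).
Proof.
rewrite aeval_pi /aeval big_map scaler_sumr.
by apply: eq_bigr => p _ /=; rewrite scalerA.
Qed.
Lemma aeval1 : aeval f (repr talg_one) = 1.
Proof. by rewrite aeval_pi /aeval big_seq1 big_nil scale1r. Qed.
Lemma aevalM x y :
  aeval f (repr (talg_mul x y)) = aeval f (repr x) * aeval f (repr y).
Proof.
rewrite aeval_pi /aeval big_allpairs_dep mulr_suml.
apply: eq_bigr => p _; rewrite mulr_sumr; apply: eq_bigr => q _ /=.
by rewrite big_cat /= -scalerAl -scalerAr scalerA.
Qed.
End Eval.
Let aevalE := (aeval0, aevalD, aevalN, aevalZ, aeval1, aevalM).

Fact talg_addA : associative talg_add.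
Proof. by move=> x y z; apply: talgP => A f; rewrite !aevalE addrA. Qed.
Fact talg_addC : commutative talg_add.
Proof. by move=> x y; apply: talgP => A f; rewrite !aevalE addrC. Qed.
Fact talg_add0 : left_id talg_zero talg_add.
Proof. by move=> x; apply: talgP => A f; rewrite !aevalE add0r. Qed.
Fact talg_addN : left_inverse talg_zero talg_opp talg_add.
Proof. by move=> x; apply: talgP => A f; rewrite !aevalE addNr. Qed.
HB.instance Definition _ :=
  GRing.isZmodule.Build talg talg_addA talg_addC talg_add0 talg_addN.

Fact talg_mulA : associative talg_mul.
Proof. by move=> x y z; apply: talgP => A f; rewrite !aevalE mulrA. Qed.
Fact talg_mul1 : left_id talg_one talg_mul.
Proof. by move=> x; apply: talgP => A f; rewrite !aevalE mul1r. Qed.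
Fact talg_mulr1 : right_id talg_one talg_mul.
Proof. by move=> x; apply: talgP => A f; rewrite !aevalE mulr1. Qed.
Fact talg_mulDl : left_distributive talg_mul talg_add.
Proof. by move=> x y z; apply: talgP => A f; rewrite !aevalE mulrDl. Qed.
Fact talg_mulDr : right_distributive talg_mul talg_add.
Proof. by move=> x y z; apply: talgP => A f; rewrite !aevalE mulrDr. Qed.
Fact talg_one_neq0 : talg_one != 0.
Proof.
apply/eqP => h.
have := aeval1 (\0 : {linear W -> k^o}); rewrite h.
rewrite (aeval0 (\0 : {linear W -> k^o})) => /esym/eqP.
by rewrite oner_eq0.
Qed.
HB.instance Definition _ := GRing.Zmodule_isNzRing.Build talg
  talg_mulA talg_mul1 talg_mulr1 talg_mulDl talg_mulDr talg_one_neq0.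

Fact talg_scaleA a c x : talg_scale a (talg_scale c x) = talg_scale (a * c) x.
Proof. by apply: talgP => A f; rewrite !aevalE scalerA. Qed.
Fact talg_scale1 : left_id 1 talg_scale.
Proof. by move=> x; apply: talgP => A f; rewrite !aevalE scale1r. Qed.
Fact talg_scaleDr : right_distributive talg_scale +%R.
Proof. by move=> a x y; apply: talgP => A f; rewrite !aevalE scalerDr. Qed.
Fact talg_scaleDl x : {morph talg_scale^~ x : a c / a + c}.
Proof. by move=> a c; apply: talgP => A f; rewrite !aevalE scalerDl. Qed.
HB.instance Definition _ := GRing.Zmodule_isLmodule.Build k talg
  talg_scaleA talg_scale1 talg_scaleDr talg_scaleDl.

Fact talg_scaleAl (a : k) (x y : talg) : a *: (x * y) = (a *: x) * y.
Proof.
apply: talgP => A f.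
rewrite (aevalZ f a (talg_mul x y)) (aevalM f (talg_scale a x) y) !aevalE.
exact: scalerAl.
Qed.
HB.instance Definition _ := GRing.Lmodule_isLalgebra.Build k talg talg_scaleAl.
Fact talg_scaleAr (a : k) (x y : talg) : a *: (x * y) = x * (a *: y).
Proof.
apply: talgP => A f.
rewrite (aevalZ f a (talg_mul x y)) (aevalM f x (talg_scale a y)) !aevalE.
exact: scalerAr.
Qed.
HB.instance Definition _ := GRing.Lalgebra_isAlgebra.Build k talg talg_scaleAr.

Definition talg_in (w : W) : talg := \pi_talg [:: (1, [:: w])].
Fact talg_in_linear : linear talg_in.
Proof.
move=> a x y; apply: talgP => A f.
rewrite (aevalD f (talg_scale a (talg_in x)) (talg_in y)) aevalZ !aeval_pi.
by rewrite /aeval !big_seq1 !scale1r linearP.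
Qed.
HB.instance Definition _ :=
  GRing.isLinear.Build k W talg _ talg_in talg_in_linear.

Definition talg_const (c : k^o) : talg := (c : k) *: 1.
Fact talg_const_linear : linear talg_const.
Proof. by move=> a x y; rewrite /talg_const scalerDl scalerA. Qed.
HB.instance Definition _ :=
  GRing.isLinear.Build k k^o talg _ talg_const talg_const_linear.

Definition talg_lift (A : algType k) (f : {linear W -> A}) (x : talg) : A :=
  aeval f (repr x).
Fact talg_lift_linear (A : algType k) (f : {linear W -> A}) : linear (talg_lift f).
Proof.
move=> a x y; rewrite /talg_lift.
by rewrite (aevalD f (talg_scale a x) y) aevalZ.
Qed.
Fact talg_lift_monoid (A : algType k) (f : {linear W -> A}) :
  monoid_morphism (talg_lift f).
Proof. by split=> [|x y]; [exact: aeval1 | exact: aevalM]. Qed.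
HB.instance Definition _ (A : algType k) (f : {linear W -> A}) :=
  GRing.isLinear.Build k talg A _ (talg_lift f) (talg_lift_linear f).
HB.instance Definition _ (A : algType k) (f : {linear W -> A}) :=
  GRing.isMonoidMorphism.Build talg A (talg_lift f) (talg_lift_monoid f).

Lemma talg_liftE (A : algType k) (f : {linear W -> A}) w :
  talg_lift f (talg_in w) = f w.
Proof. by rewrite /talg_lift aeval_pi /aeval big_seq1 big_seq1 scale1r. Qed.

Lemma talg_sum (x : talg) :
  x = \sum_(p <- repr x) p.1 *: \prod_(w <- p.2) talg_in w.
Proof.
apply: talgP => A f; rewrite -!/(talg_lift f _) linear_sum /=.
rewrite {1}/talg_lift /aeval; apply: eq_bigr => p _.
rewrite linearZ /= rmorph_prod; congr (_ *: _).
by apply: eq_bigr => w _; rewrite /= talg_liftE.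
Qed.

End TensorAlgebra.

Section Ideals.
Variables (k : fieldType) (A : algType k).

Definition is_ideal (I : A -> Prop) : Prop :=
  [/\ I 0, forall x y, I x -> I y -> I (x + y)
    & forall a x, I x -> I (a * x) /\ I (x * a)].

Definition gen_ideal (S : A -> Prop) (x : A) : Prop :=
  forall I : A -> Prop, is_ideal I -> (forall s, S s -> I s) -> I x.

End Ideals.

(* 'rV[k]_n has dimension n, so talg 'rV[k]_n is the free algebra on n letters. *)
Definition finitely_presented (k : fieldType) (A : algType k) : Prop :=
  exists n (f : {linear 'rV[k]_n -> A}),
    (forall a, exists x, talg_lift f x = a) /\
    exists s : seq (talg 'rV[k]_n),
      forall x, talg_lift f x = 0 <-> gen_ideal (fun y => y \in s) x.

Structure linCat (k : fieldType) := LinCat {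
  obj :> Type;
  hom : obj -> obj -> lmodType k;
  id1 : forall A, hom A A;
  comp : forall A B D, hom B D -> hom A B -> hom A D;
  comp1l : forall A B (f : hom A B), comp (id1 B) f = f;
  comp1r : forall A B (f : hom A B), comp f (id1 A) = f;
  compA : forall A B D E (h : hom D E) (g : hom B D) (f : hom A B),
    comp h (comp g f) = comp (comp h g) f;
  comp_bilin : forall A B D, bilin (@comp A B D)
}.
Arguments hom {k l} A B.
Arguments id1 {k l} A.
Arguments comp {k l A B D} g f.
Notation "g ∘ f" := (comp g f) : ring_scope.

Section LinCatTheory.
Variables (k : fieldType) (C : linCat k).
Implicit Types A B D E X Y S : C.

Definition is_iso A B (f : hom A B) : Prop :=
  exists g : hom B A, g ∘ f = id1 A /\ f ∘ g = id1 B.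

Definition monic A B (f : hom A B) : Prop :=
  forall E (g h : hom E A), f ∘ g = f ∘ h -> g = h.

Definition epic A B (f : hom A B) : Prop :=
  forall E (g h : hom B E), g ∘ f = h ∘ f -> g = h.

Definition is_kernel A B D (f : hom A B) (g : hom B D) : Prop :=
  g ∘ f = 0 /\
  forall E (h : hom E B), g ∘ h = 0 -> exists! u : hom E A, f ∘ u = h.

Definition is_cokernel A B D (g : hom B D) (f : hom A B) : Prop :=
  g ∘ f = 0 /\
  forall E (h : hom B E), h ∘ f = 0 -> exists! u : hom D E, u ∘ g = h.

Definition short_exact A B D (f : hom A B) (g : hom B D) : Prop :=
  is_kernel f g /\ is_cokernel g f.

Definition is_zero A : Prop :=
  forall B, (forall f : hom A B, f = 0) /\ (forall f : hom B A, f = 0).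

Definition is_dsum r (A : 'I_r -> C) S : Prop :=
  exists (inj : forall i, hom (A i) S) (prj : forall i, hom S (A i)),
    [/\ forall i, prj i ∘ inj i = id1 (A i),
        forall i j, i != j -> prj i ∘ inj j = 0
      & \sum_i inj i ∘ prj i = id1 S].

Definition abelian_cat : Prop :=
  [/\ forall r (A : 'I_r -> C), exists S, is_dsum A S,
      forall B D (g : hom B D), exists A (f : hom A B), is_kernel f g,
      forall A B (f : hom A B), exists D (g : hom B D), is_cokernel g f,
      forall A B (f : hom A B), monic f -> exists D (g : hom B D), is_kernel f g
    & forall B D (g : hom B D), epic g -> exists A (f : hom A B), is_cokernel g f].

Definition simple_obj S : Prop :=
  ~ is_zero S /\ forall A (f : hom A S), monic f -> is_zero A \/ is_iso f.

Inductive finite_length : C -> Prop :=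
| FinLength0 A of is_zero A : finite_length A
| FinLengthS A B S (f : hom A B) (g : hom B S) of
    finite_length A & simple_obj S & short_exact f g : finite_length B.

Definition fin_dim (V : lmodType k) : Prop :=
  exists s : seq V, forall v, exists c : nat -> k,
    v = \sum_(i < size s) c i *: s`_i.

Definition locally_finite : Prop :=
  (forall A B, fin_dim (hom A B)) /\ (forall A, finite_length A).

Definition subquotient X Y : Prop :=
  exists S (i : hom S Y) (p : hom S X), monic i /\ epic p.

(* An object B ⊗ T, for T a finite dimensional vector space: it is characterized
   by Hom(B ⊗ T, Y) = Hom_k(T, Hom(B, Y)), the map st_in t being b |-> b ⊗ t. *)
Structure space_tensor B (T : vectType k) := SpaceTensor {
  st_obj :> C;
  st_in : T -> hom B st_obj;
  st_linear : linear st_in;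
  st_univ : forall Y (g : T -> hom B Y), linear g ->
    exists! h : hom st_obj Y, forall t, h ∘ st_in t = g t
}.

Lemma st_triv_univ B Y (g : k^o -> hom B Y) : linear g ->
  exists! h : hom B Y, forall t : k^o, h ∘ ((t : k) *: id1 B) = g t.
Proof.
move=> gl; have [_ cr] := @comp_bilin k C B B Y.
have cz (h : hom B Y) a : h ∘ (a *: id1 B) = a *: h.
  pose c : {linear hom B B -> hom B Y} :=
    HB.pack (comp h) (GRing.isLinear.Build _ _ _ _ _ (cr h)).
  by rewrite -[LHS]/(c (a *: id1 B)) linearZ /= comp1r.
exists (g 1); split => [t|h hg].
  rewrite cz.
  pose g' : {linear k^o -> hom B Y} :=
    HB.pack g (GRing.isLinear.Build _ _ _ _ _ gl).
  by rewrite -[g]/(g' : _ -> _) -linearZ /= /GRing.scale /= mulr1.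
by rewrite -hg cz scale1r.
Qed.

Fact st_triv_linear B : linear (fun t : k^o => (t : k) *: id1 B).
Proof. by move=> a x y; rewrite scalerDl scalerA. Qed.

Definition space_tensor_triv B : space_tensor B k^o :=
  SpaceTensor (st_triv_linear B) (@st_triv_univ B).

End LinCatTheory.

Structure monCat (k : fieldType) := MonCat {
  mcat :> linCat k;
  tobj : mcat -> mcat -> mcat;
  unit1 : mcat;
  tmor : forall A A' B B' : mcat,
    hom A A' -> hom B B' -> hom (tobj A B) (tobj A' B');
  tmor_bilin : forall A A' B B', bilin (@tmor A A' B B');
  tmor_id : forall A B, tmor (id1 A) (id1 B) = id1 (tobj A B);
  tmor_comp : forall A A' A'' B B' B'' (f' : hom A' A'') (f : hom A A')
    (g' : hom B' B'') (g : hom B B'), tmor (f' ∘ f) (g' ∘ g) = tmor f' g' ∘ tmor f g;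
  assoc : forall A B D, hom (tobj (tobj A B) D) (tobj A (tobj B D));
  assocV : forall A B D, hom (tobj A (tobj B D)) (tobj (tobj A B) D);
  assocK : forall A B D, assocV A B D ∘ assoc A B D = id1 _;
  assocVK : forall A B D, assoc A B D ∘ assocV A B D = id1 _;
  assoc_nat : forall A A' B B' D D' (f : hom A A') (g : hom B B') (h : hom D D'),
    assoc A' B' D' ∘ tmor (tmor f g) h = tmor f (tmor g h) ∘ assoc A B D;
  lunit : forall A, hom (tobj unit1 A) A;
  lunitV : forall A, hom A (tobj unit1 A);
  lunitK : forall A, lunitV A ∘ lunit A = id1 _;
  lunitVK : forall A, lunit A ∘ lunitV A = id1 _;
  lunit_nat : forall A A' (f : hom A A'), lunit A' ∘ tmor (id1 unit1) f = f ∘ lunit A;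
  runit : forall A, hom (tobj A unit1) A;
  runitV : forall A, hom A (tobj A unit1);
  runitK : forall A, runitV A ∘ runit A = id1 _;
  runitVK : forall A, runit A ∘ runitV A = id1 _;
  runit_nat : forall A A' (f : hom A A'), runit A' ∘ tmor f (id1 unit1) = f ∘ runit A;
  pentagon : forall A B D E,
    assoc A B (tobj D E) ∘ assoc (tobj A B) D E
    = tmor (id1 A) (assoc B D E) ∘ assoc A (tobj B D) E ∘ tmor (assoc A B D) (id1 E);
  triangle : forall A B,
    tmor (id1 A) (lunit B) ∘ assoc A unit1 B = tmor (runit A) (id1 B)
}.
Arguments tobj {k m} A B.
Arguments unit1 {k m}.
Arguments tmor {k m A A' B B'} f g.
Arguments assoc {k m} A B D.
Arguments assocV {k m} A B D.
Arguments lunit {k m} A.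
Arguments lunitV {k m} A.
Arguments runit {k m} A.
Arguments runitV {k m} A.
Notation "A ⊠ B" := (tobj A B) : ring_scope.

Section MonCatTheory.
Variables (k : fieldType) (C : monCat k).
Implicit Types A B X Y : C.

(* A' is a left dual of A, equivalently A is a right dual of A' *)
Definition is_left_dual A A' : Prop :=
  exists (ev : hom (A' ⊠ A) unit1) (coev : hom unit1 (A ⊠ A')),
    runit A ∘ tmor (id1 A) ev ∘ assoc A A' A ∘ tmor coev (id1 A) ∘ lunitV A = id1 A
    /\
    lunit A' ∘ tmor ev (id1 A') ∘ assocV A' A A' ∘ tmor (id1 A') coev ∘ runitV A'
      = id1 A'.

Definition rigid : Prop :=
  forall A, (exists A', is_left_dual A A') /\ (exists A', is_left_dual A' A).

Definition unit_scalar : Prop :=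
  forall f : hom (unit1 : C) unit1, exists! a : k, f = a *: id1 unit1.

Fixpoint tpow X n : C := if n is n'.+1 then X ⊠ tpow X n' else unit1.

Definition tensor_generates X : Prop :=
  forall Y, exists r (n : 'I_r -> nat) S,
    is_dsum (fun i => tpow X (n i)) S /\ subquotient Y S.

End MonCatTheory.

Structure tensorCat (k : fieldType) := TensorCat {
  tcat :> monCat k;
  tcat_abelian : abelian_cat tcat;
  tcat_locally_finite : locally_finite tcat;
  tcat_rigid : rigid tcat;
  tcat_unit : unit_scalar tcat
}.

Structure tensorFunctor (k : fieldType) (C D : monCat k) := TensorFunctor {
  fobj :> C -> D;
  fmor : forall A B : C, hom A B -> hom (fobj A) (fobj B);
  fmor_linear : forall A B, linear (@fmor A B);
  fmor_id : forall A, fmor (id1 A) = id1 (fobj A);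
  fmor_comp : forall A B E (g : hom B E) (f : hom A B),
    fmor (g ∘ f) = fmor g ∘ fmor f;
  fJ : forall A B, hom (fobj A ⊠ fobj B) (fobj (A ⊠ B));
  fJ_iso : forall A B, is_iso (fJ A B);
  fJ_nat : forall A A' B B' (f : hom A A') (g : hom B B'),
    fJ A' B' ∘ tmor (fmor f) (fmor g) = fmor (tmor f g) ∘ fJ A B;
  fJ0 : hom unit1 (fobj unit1);
  fJ0_iso : is_iso fJ0;
  fJ_assoc : forall A B E,
    fmor (assoc A B E) ∘ fJ (A ⊠ B) E ∘ tmor (fJ A B) (id1 (fobj E))
    = fJ A (B ⊠ E) ∘ tmor (id1 (fobj A)) (fJ B E) ∘ assoc (fobj A) (fobj B) (fobj E);
  fJ_lunit : forall A,
    fmor (lunit A) ∘ fJ unit1 A ∘ tmor fJ0 (id1 (fobj A)) = lunit (fobj A);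
  fJ_runit : forall A,
    fmor (runit A) ∘ fJ A unit1 ∘ tmor (id1 (fobj A)) fJ0 = runit (fobj A);
  fexact : forall A B E (f : hom A B) (g : hom B E),
    short_exact f g -> short_exact (fmor f) (fmor g);
  ffaithful : forall A B, injective (@fmor A B)
}.
Arguments fmor {k C D} t {A B} f.
Arguments fJ {k C D} t A B.
Arguments fJ0 {k C D} t.

Definition functor_iso (k : fieldType) (C D : monCat k) (F G : tensorFunctor C D) :
  Prop :=
  exists eta : forall A, hom (F A) (G A),
    [/\ forall A, is_iso (eta A),
        forall A B (f : hom A B), eta B ∘ fmor F f = fmor G f ∘ eta A,
        forall A B, eta (A ⊠ B) ∘ fJ F A B = fJ G A B ∘ tmor (eta A) (eta B)
      & eta unit1 ∘ fJ0 F = fJ0 G].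

Inductive tword (I : Type) := TWone | TWvar of I | TWmul of tword I & tword I.
Arguments TWone {I}.

Fixpoint tw_pow (I : Type) (i : I) (n : nat) : tword I :=
  if n is n'.+1 then TWmul (TWvar i) (tw_pow i n') else TWone.

Section Words.
Variables (k : fieldType) (I : Type).

Fixpoint tw_obj (C : monCat k) (V : I -> C) (w : tword I) : C :=
  match w with
  | TWone => unit1
  | TWvar i => V i
  | TWmul a b => tw_obj V a ⊠ tw_obj V b
  end.

Fixpoint tw_mor (C : monCat k) (V V' : I -> C) (phi : forall i, hom (V i) (V' i))
    (w : tword I) : hom (tw_obj V w) (tw_obj V' w) :=
  match w with
  | TWone => id1 unit1
  | TWvar i => phi i
  | TWmul a b => tmor (tw_mor phi a) (tw_mor phi b)
  end.

Fixpoint tw_fun (C D : monCat k) (F : tensorFunctor C D) (V : I -> C)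
    (w : tword I) : hom (tw_obj (fun i => F (V i)) w) (F (tw_obj V w)) :=
  match w with
  | TWone => fJ0 F
  | TWvar i => id1 (F (V i))
  | TWmul a b => fJ F _ _ ∘ tmor (tw_fun F V a) (tw_fun F V b)
  end.

End Words.

(* A morphism between tensor products of the V i, each tensored with a finite
   dimensional vector space; the space k gives back the plain tensor product
   (space_tensor_triv). *)
Structure tmorphism (k : fieldType) (C : monCat k) (I : Type) (V : I -> C) :=
  TMorphism {
    tm_src : tword I;
    tm_ssp : vectType k;
    tm_dom : space_tensor (tw_obj V tm_src) tm_ssp;
    tm_tgt : tword I;
    tm_tsp : vectType k;
    tm_cod : space_tensor (tw_obj V tm_tgt) tm_tsp;
    tm_mor : hom tm_dom tm_cod
  }.

Section Domination.
Variables (k : fieldType) (C : monCat k) (I : Type) (V : I -> C).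

Section Compare.
Variables (D : monCat k) (F G : tensorFunctor C D).
Variable phi : forall i, hom (F (V i)) (G (V i)).

(* Write V^w for tw_obj V w. Since F is k-linear and F (V^w) is identified with
   F(V)^w by tw_fun, F Z is F(V)^w ⊗ S; under these identifications psi is the
   morphism phi^w ⊗ id from F(V)^w ⊗ S to G(V)^w ⊗ S. *)
Definition induced (w : tword I) (S : vectType k) (Z : space_tensor (tw_obj V w) S)
    (psi : hom (F Z) (G Z)) : Prop :=
  forall s, psi ∘ (fmor F (st_in Z s) ∘ tw_fun F V w)
          = fmor G (st_in Z s) ∘ tw_fun G V w ∘ tw_mor phi w.

Definition intertwines (f : tmorphism V) : Prop :=
  exists (psi : hom (F (tm_dom f)) (G (tm_dom f)))
         (psi' : hom (F (tm_cod f)) (G (tm_cod f))),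
    [/\ induced psi, induced psi'
      & psi' ∘ fmor F (tm_mor f) = fmor G (tm_mor f) ∘ psi].

End Compare.

Definition same_data (D : monCat k) (F G : tensorFunctor C D) (J : Type)
    (f : J -> tmorphism V) : Prop :=
  exists phi : forall i, hom (F (V i)) (G (V i)),
    (forall i, is_iso (phi i)) /\ (forall j, intertwines phi (f j)).

Definition dominated (J : Type) (f : J -> tmorphism V) : Prop :=
  forall (E : tensorCat k) (F G : tensorFunctor C E),
    same_data F G f -> functor_iso F G.

End Domination.

Definition finitely_dominated (k : fieldType) (C : monCat k) : Prop :=
  exists (I J : finType) (V : I -> C) (f : J -> tmorphism V), dominated f.

(* The antipode is not required to be bijective. *)
Structure hopfAlg (k : fieldType) := HopfAlg {
  hopf_alg :> algType k;
  comul : {linear hopf_alg -> tens hopf_alg hopf_alg};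
  counit : {linear hopf_alg -> k^o};
  antipode : {linear hopf_alg -> hopf_alg};
  comulA : forall h,
    tassoc (tmap comul idfun (comul h)) = tmap idfun comul (comul h);
  counitl : forall h, tscall (tmap counit idfun (comul h)) = h;
  counitr : forall h, tscalr (tmap idfun counit (comul h)) = h;
  comul1 : comul 1 = 1 ⊗ 1;
  comulM : forall g h, comul (g * h) = tmul (comul g ⊗ comul h);
  counit1 : counit 1 = 1;
  counitM : forall g h, counit (g * h) = (counit g : k) * counit h;
  antipodel : forall h, tmu (tmap antipode idfun (comul h)) = (counit h : k) *: 1;
  antipoder : forall h, tmu (tmap idfun antipode (comul h)) = (counit h : k) *: 1
}.
Arguments comul {k _}.
Arguments counit {k _}.
Arguments antipode {k _}.

Structure comod (k : fieldType) (H : hopfAlg k) := Comod {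
  cosp :> vectType k;
  rho : {linear cosp -> tens H cosp};
  rhoA : forall v, tassoc (tmap comul idfun (rho v)) = tmap idfun rho (rho v);
  rho1 : forall v, tscall (tmap counit idfun (rho v)) = v
}.
Arguments rho {k H} c.

Section ComodHom.
Variables (k : fieldType) (H : hopfAlg k).

Section Hom.
Variables X Y : comod H.

Definition colinear (f : 'Hom(X, Y)) : bool :=
  `[< forall x, rho Y (f x) = tmap idfun f (rho X x) >].

Fact colinear_submod : submod_closed colinear.
Proof.
split=> [|a f g /asboolP hf /asboolP hg]; apply/asboolP => x.
  rewrite lfunE /= linear0.
  elim/tens_ind: (rho X x) => [u v|y z hy hz]; first by rewrite tmapE /= lfunE tpure0r.
  by rewrite linearD /= -hy -hz addr0.
rewrite !lfunE /= !lfunE linearP /= hf hg.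
elim/tens_ind: (rho X x) => [u v|y z hy hz].
  by rewrite !tmapE /= !lfunE /= lfunE tpureDr tpureZr.
by rewrite !linearD /= -hy -hz addrACA.
Qed.
HB.instance Definition _ := GRing.isSubmodClosed.Build k 'Hom(X, Y) colinear
  colinear_submod.

Record comod_hom := ComodHom { chom :> 'Hom(X, Y); chom_colinear : colinear chom }.
HB.instance Definition _ := [isSub for chom].
HB.instance Definition _ := [Choice of comod_hom by <:].
HB.instance Definition _ := [SubChoice_isSubLmodule of comod_hom by <:].

Lemma comod_homP (f g : comod_hom) : (forall x, chom f x = chom g x) -> f = g.
Proof. by move=> h; apply: val_inj; apply/lfunP. Qed.

Lemma rho_chom (f : comod_hom) x : rho Y (chom f x) = tmap idfun (chom f) (rho X x).
Proof. by case: f => f /= /asboolP. Qed.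

Definition mk_chom (f : {linear X -> Y})
  (hf : forall x, rho Y (f x) = tmap idfun f (rho X x)) : comod_hom.
Proof.
exists (linfun f); apply/asboolP => x; rewrite lfunE /= hf.
elim/tens_ind: (rho X x) => [u v|y z hy hz]; first by rewrite !tmapE /= lfunE.
by rewrite !linearD /= hy hz.
Defined.
Lemma mk_chomE f hf x : chom (@mk_chom f hf) x = f x.
Proof. by rewrite lfunE. Qed.

End Hom.
End ComodHom.

Section ComodCat.
Variables (k : fieldType) (H : hopfAlg k).
Implicit Types X Y Z : comod H.

Fact chom_id_colinear X x : rho X (idfun x) = tmap idfun idfun (rho X x).
Proof.
by rewrite /=; elim/tens_ind: (rho X x) => [u v|y z {1}-> {1}->];
  rewrite ?tmapE ?linearD.
Qed.
Definition chom_id X : comod_hom X X := mk_chom (@chom_id_colinear X).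
Lemma chom_idE X x : chom (chom_id X) x = x.
Proof. exact: mk_chomE. Qed.

Fact chom_comp_colinear X Y Z (g : comod_hom Y Z) (f : comod_hom X Y) x :
  rho Z ((chom g \o chom f) x) = tmap idfun (chom g \o chom f) (rho X x).
Proof.
rewrite /= !rho_chom; elim/tens_ind: (rho X x) => [u v|y z hy hz].
  by rewrite !tmapE.
by rewrite !linearD /= hy hz.
Qed.
Definition chom_comp X Y Z (g : comod_hom Y Z) (f : comod_hom X Y) : comod_hom X Z :=
  mk_chom (chom_comp_colinear g f).
Lemma chom_compE X Y Z (g : comod_hom Y Z) (f : comod_hom X Y) x :
  chom (chom_comp g f) x = chom g (chom f x).
Proof. exact: mk_chomE. Qed.

Lemma chomD X Y (f g : comod_hom X Y) x : chom (f + g) x = chom f x + chom g x.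
Proof. by rewrite -add_lfunE. Qed.
Lemma chomZ X Y a (f : comod_hom X Y) x : chom (a *: f) x = a *: chom f x.
Proof. by rewrite -scale_lfunE. Qed.
Fact chom_comp1l X Y (f : comod_hom X Y) : chom_comp (chom_id Y) f = f.
Proof. by apply: comod_homP => x; rewrite chom_compE mk_chomE. Qed.
Fact chom_comp1r X Y (f : comod_hom X Y) : chom_comp f (chom_id X) = f.
Proof. by apply: comod_homP => x; rewrite chom_compE mk_chomE. Qed.
Fact chom_compA X Y Z T (h : comod_hom Z T) (g : comod_hom Y Z) (f : comod_hom X Y) :
  chom_comp h (chom_comp g f) = chom_comp (chom_comp h g) f.
Proof. by apply: comod_homP => x; rewrite !chom_compE. Qed.
Fact chom_comp_bilin X Y Z : bilin (@chom_comp X Y Z).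
Proof.
split=> [f|g] a u v; apply: comod_homP => x;
  by rewrite !(chomD, chomZ, chom_compE) // linearP.
Qed.

Definition comodLin : linCat k :=
  LinCat chom_comp1l chom_comp1r chom_compA chom_comp_bilin.

Section TensorComod.
Variables V W : comod H.
Definition tens_rho : tens V W -> tens H (tens V W) :=
  @tpairl _ H V W \o tmap (rho V) (rho W).
HB.instance Definition _ := GRing.Linear.on tens_rho.
Lemma tens_rhoE v w : tens_rho (v ⊗ w) = tpairl (rho V v ⊗ rho W w).
Proof. by rewrite /tens_rho /= tmapE. Qed.

Fact tens_rhoA x :
  tassoc (tmap comul idfun (tens_rho x)) = tmap idfun tens_rho (tens_rho x).
Proof.
move: x; apply: (@tens_ext _ _ _ _ (@tassoc _ H H _ \o tmap comul idfun \o tens_rho)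
  (tmap idfun tens_rho \o tens_rho)) => v w /=; rewrite tens_rhoE.
have h1 p q : tassoc (tmap comul idfun (@tpairl _ H V W (p ⊗ q))) =
    tmap idfun (@tpairl _ H V W) (tpairl (tassoc (tmap comul idfun p)
       ⊗ tassoc (tmap comul idfun q))).
  rewrite -!(tmapE (@tassoc _ H H _ \o tmap comul idfun)
                   (@tassoc _ H H _ \o tmap comul idfun)).
  move: (p ⊗ q) => {p q}.
  apply: (@tens_ext2 _ _ _ _ _ _ (@tassoc _ H H _ \o tmap comul idfun \o @tpairl _ H V W)
    (tmap idfun (@tpairl _ H V W) \o @tpairl _ H _ _ \o
      tmap (@tassoc _ H H V \o tmap comul idfun)
           (@tassoc _ H H W \o tmap comul idfun))) => a u b z /=.
  rewrite tpairlE !tmapE /= !tmapE /= comulM.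
  move: (comul a) (comul b) => x y.
  elim/tens_ind: x => [c d|x x' hx hx'].
    elim/tens_ind: y => [e f|y y' hy hy'].
      by rewrite tmulE !tassocE tpairlE tmapE /= tpairlE.
    by rewrite !(tpureDl, tpureDr, linearD) /= hy hy'.
  by rewrite !(tpureDl, tpureDr, linearD) /= hx hx'.
rewrite h1 !rhoA.
rewrite -(tmapE (tmap idfun (rho V)) (tmap idfun (rho W))).
move: (rho V v ⊗ rho W w); apply: (@tens_ext2 _ _ _ _ _ _
  (tmap idfun (@tpairl _ H V W) \o @tpairl _ H _ _ \o
    tmap (tmap idfun (rho V)) (tmap idfun (rho W)))
  (tmap idfun tens_rho \o @tpairl _ H V W)) => a u b z /=.
by rewrite !tmapE /= !tmapE /= !tpairlE !tmapE /= tens_rhoE.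
Qed.

Fact tens_rho1 x : tscall (tmap counit idfun (tens_rho x)) = x.
Proof.
move: x; apply: (@tens_ext _ _ _ _ (@tscall _ _ \o tmap counit idfun \o tens_rho)
  idfun) => v w /=; rewrite tens_rhoE.
rewrite -[in RHS](rho1 v) -[in RHS](rho1 w).
rewrite -(tmapE (@tscall _ V \o tmap counit idfun) (@tscall _ W \o tmap counit idfun)).
move: (rho V v ⊗ rho W w).
apply: (@tens_ext2 _ _ _ _ _ _ (@tscall _ _ \o tmap counit idfun \o @tpairl _ H V W)
 (tmap (@tscall _ V \o tmap counit idfun) (@tscall _ W \o tmap counit idfun)))
 => a u b z /=.
rewrite tpairlE !tmapE /= !tmapE /= counitM !tscallE.
by rewrite tpureZl tpureZr scalerA.
Qed.

Definition comod_tens : comod H := Comod tens_rhoA tens_rho1.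
Lemma rho_tensE (v : V) (w : W) :
  rho comod_tens (v ⊗ w) = tpairl (rho V v ⊗ rho W w).
Proof. exact: tens_rhoE. Qed.
End TensorComod.
Arguments tens_rho V W x : clear implicits.

Fact unit_rhoA (v : k^o) :
  tassoc (tmap comul idfun (tpurel (1 : H) v)) =
  tmap idfun (tpurel (1 : H)) (tpurel (1 : H) v).
Proof. by rewrite tmapE /= comul1 tassocE tmapE. Qed.
Fact unit_rho1 (v : k^o) : tscall (tmap counit idfun (tpurel (1 : H) v)) = v.
Proof. by rewrite tmapE /= counit1 tscallE scale1r. Qed.
Definition comod_unit : comod H := Comod unit_rhoA unit_rho1.

Section TensorHom.
Variables (X X' Y Y' : comod H) (f : comod_hom X X') (g : comod_hom Y Y').
Fact tens_chom_colinear x :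
  rho (comod_tens X' Y') (tmap (chom f) (chom g) x)
  = tmap idfun (tmap (chom f) (chom g)) (rho (comod_tens X Y) x).
Proof.
move: x; apply: (@tens_ext _ _ _ _ (tens_rho X' Y' \o tmap (chom f) (chom g))
  (tmap idfun (tmap (chom f) (chom g)) \o tens_rho X Y)) => x y /=.
rewrite tmapE !tens_rhoE !rho_chom -(tmapE (tmap idfun (chom f)) (tmap idfun (chom g))).
move: (rho X x ⊗ rho Y y).
apply: (@tens_ext2 _ _ _ _ _ _
  (@tpairl _ H X' Y' \o tmap (tmap idfun (chom f)) (tmap idfun (chom g)))
  (tmap idfun (tmap (chom f) (chom g)) \o @tpairl _ H X Y)) => a u b z /=.
by rewrite !tmapE /= !tmapE /= !tpairlE tmapE /= tmapE.
Qed.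
Definition comod_tmor : comod_hom (comod_tens X Y) (comod_tens X' Y') :=
  @mk_chom _ _ (comod_tens X Y) (comod_tens X' Y') (tmap (chom f) (chom g))
    tens_chom_colinear.
Lemma comod_tmorE x : chom comod_tmor x = tmap (chom f) (chom g) x.
Proof. by rewrite mk_chomE. Qed.
End TensorHom.

Section AssocHom.
Variables X Y Z : comod H.
Fact assoc_colinear x :
  rho (comod_tens X (comod_tens Y Z)) (@tassoc _ X Y Z x)
  = tmap idfun (@tassoc _ X Y Z) (rho (comod_tens (comod_tens X Y) Z) x).
Proof.
move: x; apply: (@tens_ext3l _ _ _ _ _
  (tens_rho X (comod_tens Y Z) \o @tassoc _ X Y Z)
  (tmap idfun (@tassoc _ X Y Z) \o tens_rho (comod_tens X Y) Z)) => x y z.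
rewrite [LHS]/= tassocE (@tens_rhoE X (comod_tens Y Z)) (rho_tensE y z).
rewrite -[RHS]/(tmap idfun (@tassoc _ X Y Z) (tens_rho (comod_tens X Y) Z _)).
rewrite (@tens_rhoE (comod_tens X Y) Z) (rho_tensE x y).
elim/tens_ind: (rho X x) => [a u|p q hp hq]; last first.
  by rewrite !(tpureDl, linearD) /= hp hq.
elim/tens_ind: (rho Y y) => [b v|p q hp hq]; last first.
  by rewrite !(tpureDl, tpureDr, linearD) /= hp hq.
elim/tens_ind: (rho Z z) => [c w|p q hp hq]; last first.
  by rewrite !(tpureDl, tpureDr, linearD) /= hp hq.
by rewrite !tpairlE tmapE /= tassocE mulrA.
Qed.
Definition comod_assoc := @mk_chom _ _ (comod_tens (comod_tens X Y) Z)
  (comod_tens X (comod_tens Y Z)) (@tassoc _ X Y Z) assoc_colinear.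
Lemma comod_assocE x : chom comod_assoc x = tassoc x.
Proof. by rewrite mk_chomE. Qed.

Fact assocV_colinear x :
  rho (comod_tens (comod_tens X Y) Z) (@tassocV _ X Y Z x)
  = tmap idfun (@tassocV _ X Y Z) (rho (comod_tens X (comod_tens Y Z)) x).
Proof.
rewrite -{2}[x]tassocVK assoc_colinear.
elim/tens_ind: (rho _ _) => [a u|p q {1}-> {1}->]; last by rewrite !linearD.
by rewrite !tmapE /= tassocK.
Qed.
Definition comod_assocV := @mk_chom _ _ (comod_tens X (comod_tens Y Z))
  (comod_tens (comod_tens X Y) Z) (@tassocV _ X Y Z) assocV_colinear.
Lemma comod_assocVE x : chom comod_assocV x = tassocV x.
Proof. by rewrite mk_chomE. Qed.
End AssocHom.

Section UnitHom.
Variable X : comod H.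
Fact lunit_colinear x :
  rho X (@tscall _ X x) = tmap idfun (@tscall _ X) (rho (comod_tens comod_unit X) x).
Proof.
move: x; apply: (@tens_ext _ _ _ _ (rho X \o @tscall _ X)
  (tmap idfun (@tscall _ X) \o tens_rho comod_unit X)) => c x /=.
rewrite tscallE tmapE /= ?tpurelE linearZ /=.
elim/tens_ind: (rho X x) => [a u|p q hp hq]; last first.
  by rewrite !(tpureDr, linearD) /= hp hq.
by rewrite tpairlE tmapE /= tscallE mul1r tpureZr.
Qed.
Definition comod_lunit := @mk_chom _ _ (comod_tens comod_unit X) X
  (@tscall _ X) lunit_colinear.
Lemma comod_lunitE x : chom comod_lunit x = tscall x.
Proof. by rewrite mk_chomE. Qed.

Fact lunitV_colinear x :
  rho (comod_tens comod_unit X) (tpurel (1 : k^o) x)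
  = tmap idfun (tpurel (1 : k^o)) (rho X x).
Proof.
rewrite tpurelE rho_tensE /=.
elim/tens_ind: (rho X x) => [a u|p q hp hq]; last first.
  by rewrite !(tpureDr, linearD) /= hp hq.
by rewrite tpairlE tmapE /= mul1r.
Qed.
Definition comod_lunitV := @mk_chom _ _ X (comod_tens comod_unit X)
  (tpurel (1 : k^o)) lunitV_colinear.
Lemma comod_lunitVE x : chom comod_lunitV x = (1 : k^o) ⊗ x.
Proof. by rewrite mk_chomE. Qed.

Fact runit_colinear x :
  rho X (@tscalr _ X x) = tmap idfun (@tscalr _ X) (rho (comod_tens X comod_unit) x).
Proof.
move: x; apply: (@tens_ext _ _ _ _ (rho X \o @tscalr _ X)
  (tmap idfun (@tscalr _ X) \o tens_rho X comod_unit)) => x c /=.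
rewrite tscalrE tmapE /= ?tpurelE linearZ /=.
elim/tens_ind: (rho X x) => [a u|p q hp hq]; last first.
  by rewrite !(tpureDl, tpureDr, linearD) /= hp hq.
by rewrite tpairlE tmapE /= tscalrE mulr1 tpureZr.
Qed.
Definition comod_runit := @mk_chom _ _ (comod_tens X comod_unit) X
  (@tscalr _ X) runit_colinear.
Lemma comod_runitE x : chom comod_runit x = tscalr x.
Proof. by rewrite mk_chomE. Qed.

Fact runitV_colinear x :
  rho (comod_tens X comod_unit) (tpurer (1 : k^o) x)
  = tmap idfun (tpurer (1 : k^o)) (rho X x).
Proof.
rewrite tpurerE rho_tensE /=.
elim/tens_ind: (rho X x) => [a u|p q hp hq]; last first.
  by rewrite !(tpureDl, linearD) /= hp hq.
by rewrite tpairlE tmapE /= mulr1.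
Qed.
Definition comod_runitV := @mk_chom _ _ X (comod_tens X comod_unit)
  (tpurer (1 : k^o)) runitV_colinear.
Lemma comod_runitVE x : chom comod_runitV x = x ⊗ (1 : k^o).
Proof. by rewrite mk_chomE. Qed.
End UnitHom.

Let chomE := (chom_compE, comod_tmorE, comod_assocE, comod_assocVE, comod_lunitE,
  comod_lunitVE, comod_runitE, comod_runitVE, chom_idE).

Lemma chomP X Y a (u v : comod_hom X Y) x :
  chom (a *: u + v) x = a *: chom u x + chom v x.
Proof. by rewrite chomD chomZ. Qed.

Fact comod_tmor_bilin X X' Y Y' : bilin (@comod_tmor X X' Y Y').
Proof.
split=> [g|f] a u v; apply: comod_homP => x;
  rewrite chomP !comod_tmorE; elim/tens_ind: x => [y z|y z hy hz].
- by rewrite !tmapE -tpureZl -tpureDl; congr (_ ⊗ _); exact: chomP.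
- by rewrite !linearD /= hy hz addrACA.
- by rewrite !tmapE -tpureZr -tpureDr; congr (_ ⊗ _); exact: chomP.
- by rewrite !linearD /= hy hz addrACA.
Qed.

Fact comod_tmor_id X Y : comod_tmor (chom_id X) (chom_id Y) = chom_id (comod_tens X Y).
Proof.
apply: comod_homP => x; rewrite !chomE /=; elim/tens_ind: x => [y z|y z hy hz].
  by rewrite tmapE /= !chomE.
by rewrite linearD /= hy hz.
Qed.

Fact comod_tmor_comp X X' X'' Y Y' Y'' (f' : comod_hom X' X'') (f : comod_hom X X')
  (g' : comod_hom Y' Y'') (g : comod_hom Y Y') :
  comod_tmor (chom_comp f' f) (chom_comp g' g)
  = chom_comp (comod_tmor f' g') (comod_tmor f g).
Proof.
apply: comod_homP => x; rewrite !chomE /=; elim/tens_ind: x => [y z|y z hy hz].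
  by rewrite !tmapE /= !chomE.
by rewrite !linearD /= hy hz.
Qed.

Fact comod_assocK X Y Z :
  chom_comp (comod_assocV X Y Z) (comod_assoc X Y Z) = chom_id _.
Proof. by apply: comod_homP => x; rewrite !chomE tassocK. Qed.
Fact comod_assocVK X Y Z :
  chom_comp (comod_assoc X Y Z) (comod_assocV X Y Z) = chom_id _.
Proof. by apply: comod_homP => x; rewrite !chomE tassocVK. Qed.

Fact comod_assoc_nat X X' Y Y' Z Z' (f : comod_hom X X') (g : comod_hom Y Y')
  (h : comod_hom Z Z') :
  chom_comp (comod_assoc X' Y' Z') (comod_tmor (comod_tmor f g) h)
  = chom_comp (comod_tmor f (comod_tmor g h)) (comod_assoc X Y Z).
Proof.
apply: comod_homP => x; rewrite !chomE; move: x.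
apply: (@tens_ext3l _ _ _ _ _ (@tassoc _ X' Y' Z' \o tmap (chom (comod_tmor f g)) (chom h))
  (tmap (chom f) (chom (comod_tmor g h)) \o @tassoc _ X Y Z)) => x y z /=.
by rewrite tassocE !tmapE /= !chomE !tmapE tassocE.
Qed.

Fact comod_lunitK X : chom_comp (comod_lunitV X) (comod_lunit X) = chom_id _.
Proof.
apply: comod_homP => x; rewrite !chomE; move: x.
apply: (@tens_ext _ _ _ _ (tpurel (1 : k^o) \o @tscall _ X) idfun) => c x /=.
by rewrite tscallE tpurelE tpureZr -tpureZl /GRing.scale /= mulr1.
Qed.
Fact comod_lunitVK X : chom_comp (comod_lunit X) (comod_lunitV X) = chom_id _.
Proof. by apply: comod_homP => x; rewrite !chomE tscallE scale1r. Qed.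
Fact comod_lunit_nat X X' (f : comod_hom X X') :
  chom_comp (comod_lunit X') (comod_tmor (chom_id comod_unit) f)
  = chom_comp f (comod_lunit X).
Proof.
apply: comod_homP => x; rewrite !chomE; move: x.
apply: (@tens_ext _ _ _ _ (@tscall _ X' \o tmap (chom (chom_id comod_unit)) (chom f))
  (chom f \o @tscall _ X)) => c x /=.
by rewrite tmapE /= !tscallE linearZ; rewrite lfunE.
Qed.
Fact comod_runitK X : chom_comp (comod_runitV X) (comod_runit X) = chom_id _.
Proof.
apply: comod_homP => x; rewrite !chomE; move: x.
apply: (@tens_ext _ _ _ _ (tpurer (1 : k^o) \o @tscalr _ X) idfun) => x c /=.
by rewrite tscalrE tpurerE tpureZl -tpureZr /GRing.scale /= mulr1.
Qed.
Fact comod_runitVK X : chom_comp (comod_runit X) (comod_runitV X) = chom_id _.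
Proof. by apply: comod_homP => x; rewrite !chomE tscalrE scale1r. Qed.
Fact comod_runit_nat X X' (f : comod_hom X X') :
  chom_comp (comod_runit X') (comod_tmor f (chom_id comod_unit))
  = chom_comp f (comod_runit X).
Proof.
apply: comod_homP => x; rewrite !chomE; move: x.
apply: (@tens_ext _ _ _ _ (@tscalr _ X' \o tmap (chom f) (chom (chom_id comod_unit)))
  (chom f \o @tscalr _ X)) => x c /=.
by rewrite tmapE /= !tscalrE linearZ; rewrite lfunE.
Qed.

Fact comod_pentagon X Y Z T :
  chom_comp (comod_assoc X Y (comod_tens Z T)) (comod_assoc (comod_tens X Y) Z T)
  = chom_comp (chom_comp (comod_tmor (chom_id X) (comod_assoc Y Z T))
      (comod_assoc X (comod_tens Y Z) T)) (comod_tmor (comod_assoc X Y Z) (chom_id T)).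
Proof.
apply: comod_homP => x; rewrite !chomE; move: x.
apply: (@tens_ext3l _ _ _ _ _
  (@tassoc _ X Y (tens Z T) \o @tassoc _ (tens X Y) Z T)
  (tmap (chom (chom_id X)) (chom (comod_assoc Y Z T)) \o
   (@tassoc _ X (tens Y Z) T \o tmap (chom (comod_assoc X Y Z)) (chom (chom_id T)))))
  => p z t /=.
rewrite tmapE /= chomE /=.
elim/tens_ind: p => [x y|p q hp hq]; last by rewrite !(tpureDl, linearD) /= hp hq.
by rewrite !chomE !tassocE tmapE /= !chomE tassocE.
Qed.

Fact comod_triangle X Y :
  chom_comp (comod_tmor (chom_id X) (comod_lunit Y)) (comod_assoc X comod_unit Y)
  = comod_tmor (comod_runit X) (chom_id Y).
Proof.
apply: comod_homP => x; rewrite !chomE; move: x.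
apply: (@tens_ext3l _ _ _ _ _
  (tmap (chom (chom_id X)) (chom (comod_lunit Y)) \o @tassoc _ X k^o Y)
  (tmap (chom (comod_runit X)) (chom (chom_id Y)))) => x c y /=.
by rewrite tassocE !tmapE /= !chomE /= tscallE tscalrE tpureZl tpureZr.
Qed.

Definition comodCat : monCat k := @MonCat k comodLin comod_tens comod_unit comod_tmor
  comod_tmor_bilin comod_tmor_id comod_tmor_comp
  comod_assoc comod_assocV comod_assocK comod_assocVK comod_assoc_nat
  comod_lunit comod_lunitV comod_lunitK comod_lunitVK comod_lunit_nat
  comod_runit comod_runitV comod_runitK comod_runitVK comod_runit_nat
  comod_pentagon comod_triangle.

End ComodCat.
Arguments tens_rho {k H} V W x.

Section SpaceTensor.
Variables (k : fieldType) (H : hopfAlg k) (X : comod H) (S : vectType k).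

Definition sp_rho : tens X S -> tens H (tens X S) :=
  @tassoc _ H X S \o tmap (rho X) idfun.
HB.instance Definition _ := GRing.Linear.on sp_rho.
Lemma sp_rhoE x s : sp_rho (x ⊗ s) = tassoc (rho X x ⊗ s).
Proof. by rewrite /sp_rho /= tmapE. Qed.

Fact sp_rhoA x :
  tassoc (tmap comul idfun (sp_rho x)) = tmap idfun sp_rho (sp_rho x).
Proof.
move: x; apply: (@tens_ext _ _ _ _ (@tassoc _ H H _ \o tmap comul idfun \o sp_rho)
  (tmap idfun sp_rho \o sp_rho)) => x s /=; rewrite sp_rhoE.
have h1 p : tassoc (tmap comul idfun (@tassoc _ H X S (p ⊗ s))) =
    tmap idfun (@tassoc _ H X S) (tassoc (tassoc (tmap comul idfun p) ⊗ s)).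
  elim/tens_ind: p => [a u|p q hp hq]; last first.
    by rewrite !(tpureDl, linearD) /= hp hq.
  rewrite tassocE !tmapE /=; elim/tens_ind: (comul a) => [b c|p q hp hq].
    by rewrite !tassocE tmapE /= tassocE.
  by rewrite !(tpureDl, linearD) /= hp hq.
rewrite h1 rhoA; elim/tens_ind: (rho X x) => [a u|p q hp hq].
  by rewrite !tmapE /= !tassocE !tmapE /= sp_rhoE.
by rewrite !(tpureDl, linearD) /= hp hq.
Qed.

Fact sp_rho1 x : tscall (tmap counit idfun (sp_rho x)) = x.
Proof.
move: x; apply: (@tens_ext _ _ _ _ (@tscall _ _ \o tmap counit idfun \o sp_rho)
  idfun) => x s /=; rewrite sp_rhoE -[in RHS](rho1 x).
elim/tens_ind: (rho X x) => [a u|p q hp hq].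
  by rewrite tassocE !tmapE /= !tscallE tpureZl.
by rewrite !(tpureDl, linearD) /= hp hq.
Qed.

Definition sp_comod : comod H := Comod sp_rhoA sp_rho1.
Lemma rho_spE x s : rho sp_comod (x ⊗ s) = tassoc (rho X x ⊗ s).
Proof. exact: sp_rhoE. Qed.

Fact sp_in_colinear (s : S) x :
  rho sp_comod (tpurer s x) = tmap idfun (tpurer s) (rho X x).
Proof.
rewrite /= tpurerE sp_rhoE; elim/tens_ind: (rho X x) => [a u|p q hp hq].
  by rewrite tassocE tmapE.
by rewrite !(tpureDl, linearD) /= hp hq.
Qed.
Definition sp_in (s : S) : comod_hom X sp_comod :=
  @mk_chom _ _ X sp_comod (tpurer s) (sp_in_colinear s).
Lemma sp_inE s x : chom (sp_in s) x = x ⊗ s.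
Proof. by rewrite mk_chomE. Qed.

Fact sp_in_linear : linear sp_in.
Proof.
move=> a s t; apply: comod_homP => x.
by rewrite chomP !sp_inE tpureDr tpureZr.
Qed.

Fact sp_univ (Y : comodCat H) (g : S -> @hom _ (comodCat H) X Y) : linear g ->
  exists! h : @hom _ (comodCat H) sp_comod Y, forall s, h ∘ sp_in s = g s.
Proof.
move=> gl.
have hb : bilin (fun (x : X) (s : S) => chom (g s : comod_hom X Y) x).
  split=> [s|x] a u v; first by rewrite linearP.
  by rewrite gl; exact: (@chomP _ _ X Y a (g u) (g v) x).
have hc x : rho Y (tlift hb x) = tmap idfun (tlift hb) (rho sp_comod x).
  move: x; apply: (@tens_ext _ _ _ _ (rho Y \o tlift hb)
    (tmap idfun (tlift hb) \o sp_rho)) => x s /=.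
  rewrite tliftE sp_rhoE rho_chom; elim/tens_ind: (rho X x) => [a u|p q hp hq].
    by rewrite tassocE !tmapE /= tliftE.
  by rewrite !(tpureDl, linearD) /= hp hq.
exists (@mk_chom _ _ sp_comod Y (tlift hb) hc); split=> [s|h hg].
  apply: comod_homP => x; rewrite chom_compE sp_inE mk_chomE; exact: tliftE.
apply: comod_homP => x; rewrite mk_chomE; move: x.
apply: (@tens_ext _ _ _ _ (tlift hb) (chom (h : comod_hom sp_comod Y))) => x s /=.
by rewrite tliftE -hg chom_compE sp_inE.
Qed.

Definition sp_tensor : @space_tensor k (comodCat H) X S :=
  @SpaceTensor k (comodCat H) X S sp_comod sp_in sp_in_linear sp_univ.

End SpaceTensor.

Section MidHom.
Variables (k : fieldType) (H : hopfAlg k) (A B : comod H) (S T : vectType k).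
Fact mid_colinear x :
  rho (sp_comod (comod_tens A B) (tens S T)) (@tmid _ A S B T x)
  = tmap idfun (@tmid _ A S B T) (rho (comod_tens (sp_comod A S) (sp_comod B T)) x).
Proof.
move: x; change (forall x, (@sp_rho _ H (comod_tens A B) (tens S T) \o @tmid _ A S B T) x
  = (tmap idfun (@tmid _ A S B T) \o tens_rho (sp_comod A S) (sp_comod B T)) x).
apply: (@tens_ext2 _ _ _ _ _ _
  (@sp_rho _ H (comod_tens A B) (tens S T) \o @tmid _ A S B T)
  (tmap idfun (@tmid _ A S B T) \o tens_rho (sp_comod A S) (sp_comod B T)))
  => a s b t.
rewrite [LHS]/= tmidE (@sp_rhoE _ _ (comod_tens A B)) (rho_tensE a b).
rewrite -[RHS]/(tmap idfun (@tmid _ A S B T) (tens_rho (sp_comod A S) (sp_comod B T) _)).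
rewrite (@tens_rhoE _ _ (sp_comod A S) (sp_comod B T)).
rewrite (rho_spE a s) (rho_spE b t).
elim/tens_ind: (rho A a) => [h u|p q hp hq]; last first.
  by rewrite !(tpureDl, linearD) /= hp hq.
elim/tens_ind: (rho B b) => [g v|p q hp hq]; last first.
  by rewrite !(tpureDl, tpureDr, linearD) /= hp hq.
by rewrite !tassocE !tpairlE tassocE tmapE /= tmidE.
Qed.
Definition mid_hom : comod_hom (comod_tens (sp_comod A S) (sp_comod B T))
    (sp_comod (comod_tens A B) (tens S T)) :=
  @mk_chom _ _ (comod_tens (sp_comod A S) (sp_comod B T))
    (sp_comod (comod_tens A B) (tens S T)) (@tmid _ A S B T) mid_colinear.
End MidHom.

Fixpoint vtpow (k : fieldType) (S : vectType k) (n : nat) : vectType k :=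
  if n is n'.+1 then tens S (vtpow S n') else k^o.

(* The isomorphism (V_i ⊗ S)^{⊗ n} -> V_i^{⊗ n} ⊗ S^{⊗ n} moving the factors S,
   which carry the trivial coaction, to the right. *)
Fixpoint shuffle (k : fieldType) (H : hopfAlg k) (I : Type) (V : I -> comodCat H)
    (i : I) (S : vectType k) (n : nat) :
    @hom _ (comodCat H) (tpow (sp_comod (V i) S : comodCat H) n)
      (sp_comod (tw_obj V (tw_pow i n)) (vtpow S n)) :=
  match n with
  | 0 => sp_in (comod_unit H) (1 : k^o)
  | n'.+1 =>
    @comp _ (comodCat H) _ _ _
      (mid_hom (V i) (tw_obj V (tw_pow i n')) S (vtpow S n'))
      (@tmor _ (comodCat H) _ _ _ _
         (id1 (sp_comod (V i) S : comodCat H)) (shuffle V i S n'))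
  end.

Structure bicomod (k : fieldType) (H : hopfAlg k) := Bicomod {
  bileft :> comod H;
  birho : {linear bileft -> tens bileft H};
  birhoA : forall v, tassoc (tmap birho idfun (birho v)) = tmap idfun comul (birho v);
  birho1 : forall v, tscalr (tmap idfun counit (birho v)) = v;
  birho_comm : forall v,
    tassoc (tmap (rho bileft) idfun (birho v)) = tmap idfun birho (rho bileft v)
}.

Section Relations.
Variables (k : fieldType) (H : hopfAlg k) (X : comod H).

Definition dualsp : vectType k := 'Hom(X, k^o).

Fact contract_bilin : bilin (fun (p : tens H X) (f : dualsp) =>
  tscalr (tmap idfun (f : 'Hom(X, k^o)) p)).
Proof.
split=> [f|p] a x y; first by rewrite !linearP.
elim/tens_ind: p => [h v|p q hp hq].
  by rewrite !tmapE !tscalrE /= !lfunE /= lfunE scalerDl scalerA.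
by rewrite !linearD /= hp hq addrACA.
Qed.
Definition contract : tens (tens H X) dualsp -> H := tlift contract_bilin.
HB.instance Definition _ := GRing.Linear.on contract.

(* As a left comodule, X ⊗ *X is X tensored with a vector space: the coaction of
   *X below is on the right. *)
Definition matX : comod H := sp_comod X dualsp.

(* x ⊗ f |-> x_(-1) f(x_(0)); for x ⊗ f = e_i ⊗ e_j^* these are the matrix elements
   t_ij of X, where x |-> x_(-1) ⊗ x_(0) maps e_i to \sum_j t_ij ⊗ e_j. *)
Definition mat_elt : matX -> H := contract \o tmap (rho X) idfun.
HB.instance Definition _ := GRing.Linear.on mat_elt.

Definition theta : talg matX -> H := talg_lift mat_elt.

(* The right coaction f |-> f_(0) ⊗ f_(1) on *X is the one such that
   f_(0)(x) f_(1) = x_(-1) f(x_(0)) for all x; here it is written in a basis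
   of X and the dual basis of *X. *)
Definition dual_rho (f : dualsp) : tens dualsp H :=
  \sum_(i < \dim {:X}) (linfun (coord (vbasis {:X}) i : X -> k^o) : dualsp)
                         ⊗ contract (rho X (vbasis {:X})`_i ⊗ f).
Fact dual_rho_linear : linear dual_rho.
Proof.
move=> a f g; rewrite /dual_rho scaler_sumr -big_split; apply: eq_bigr => i _ /=.
by rewrite tpureDr tpureZr linearD linearZ tpureDr tpureZr.
Qed.
HB.instance Definition _ :=
  GRing.isLinear.Build k dualsp (tens dualsp H) _ dual_rho dual_rho_linear.

Definition matX_rrho : matX -> tens matX H :=
  @tassocV _ X dualsp H \o tmap idfun dual_rho.
HB.instance Definition _ := GRing.Linear.on matX_rrho.

Definition matXpow (n : nat) : comod H := @tpow k (comodCat H) matX n.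

Fixpoint matXpow_rrho (n : nat) : {linear matXpow n -> tens (matXpow n) H} :=
  match n with
  | 0 => tpurer (1 : H) : {linear k^o -> tens k^o H}
  | n'.+1 => (@tpairr _ H matX (matXpow n') \o tmap matX_rrho (matXpow_rrho n'))
      : {linear tens matX (matXpow n') -> tens (tens matX (matXpow n')) H}
  end.

Fixpoint matXpow_in (n : nat) : {linear matXpow n -> talg matX} :=
  match n with
  | 0 => @talg_const k matX : {linear k^o -> talg matX}
  | n'.+1 => (@tmu _ (talg matX) \o tmap (@talg_in _ matX) (matXpow_in n'))
      : {linear tens matX (matXpow n') -> talg matX}
  end.

(* R is a sub-bicomodule of the direct sum of the (X ⊗ *X)^{⊗ j}, j = 0..m, with
   projections xi j, and it generates the ideal Ker theta. *)
Definition generates_relations (R : bicomod H) (m : nat)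
    (xi : forall j : 'I_m.+1, comod_hom R (matXpow j)) : Prop :=
  [/\ forall (j : 'I_m.+1) r, matXpow_rrho j (chom (xi j) r) = tmap (chom (xi j)) idfun (birho R r),
      forall r, (forall j, chom (xi j) r = 0) -> r = 0
    & forall x, theta x = 0 <->
        gen_ideal (fun y => exists r, y = \sum_(j < m.+1) matXpow_in j (chom (xi j) r)) x].

Variables (R : bicomod H) (m : nat) (xi : forall j : 'I_m.+1, comod_hom R (matXpow j)).

Definition gen_objs (b : bool) : comodCat H := if b then X else R.

(* xi j as a morphism R -> X^{⊗ j} ⊗ (X^* )_space^{⊗ j} *)
Definition gen_mors (j : 'I_m.+1) : tmorphism gen_objs :=
  @TMorphism k (comodCat H) bool gen_objs
    (TWvar false) k^o (space_tensor_triv (C := comodCat H) R)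
    (tw_pow true j) (vtpow dualsp j)
    (sp_tensor (tw_obj gen_objs (tw_pow true j)) (vtpow dualsp j))
    (@comp _ (comodCat H) _ _ _ (shuffle gen_objs true dualsp j) (xi j)).

End Relations.

(* Main.v *)
From HB Require Import structures.
Require Import Defs.
From mathcomp Require Import all_boot all_algebra.
From mathcomp Require Import boolp classical_sets.
(* Imported last, so that hom denotes the morphisms of a category. *)
Import Defs.

Set Implicit Arguments.
Unset Strict Implicit.
Unset Printing Implicit Defensive.

Import GRing.Theory.
Local Open Scope ring_scope.

(** Why a tensor functor on H-comod is determined by its values on X, R and the xi_j.

    Let F and G be two tensor functors with phi_X : F X -> G X and phi_R : F R -> G R
    carrying the F(xi_j) to the G(xi_j). Call a comodule Y glued when a morphism
    F Y -> G Y is chosen (gobj), and call a colinear map between glued comodules glued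
    when the two chosen morphisms intertwine its images (gmor). Since F and G are exact
    and monoidal, kernels, quotients, sums and tensor products of glued objects and
    morphisms are glued. So W = X ⊗ *X and its tensor powers are glued, and the
    assumption on the xi_j says exactly that they are glued morphisms. The goal is to
    glue every comodule so that all colinear maps become glued.

    The regular comodule H is the quotient of the tensor algebra T(W) by Ker theta, and
    it cogenerates the comodules; so gluing H would be enough. H is infinite dimensional,
    and the functors are only defined on finite dimensional comodules, so H is replaced
    by its finite dimensional subcomodules. Elements of T(W) are reached by maps from
    glued objects, sums of glued morphisms into the powers of W (gmap). The elements in
    the image of such a map that theta annihilates identically form a two-sided ideal,
    because glued objects can be tensored with each other; it contains the relations xi(R),
    hence all of Ker theta (relation_lift). Consequently Ker theta is cut out by glued
    subobjects, and the image in H of a glued object inherits a gluing (glue_quotient).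

    This gluing of a subcomodule C of H does not depend on choices: a colinear map to H
    is determined by a functional, its composite with the counit, and every functional on
    a tensor power of X comes from T(W). Hence all colinear maps from tensor powers of X
    to C are glued (gmor_to_test), and so are all colinear maps between such C.

    A comodule Y embeds in C ⊗ Y_space by its coaction, as soon as C contains its matrix
    elements, and it is the kernel of a map C ⊗ Y_space -> C' ⊗ Z_space, which is glued
    because its components are maps between subcomodules of H. This glues Y
    (test_compatible_exists). Maps from Y to subcomodules of H separate points, so the
    gluing is unique and natural (gmor_test_compatible), and it is monoidal because a
    functional on A ⊗ B is a sum of products of functionals (test_compatible_tens).

    This gives a monoidal transformation F -> G extending phi_X (glue_transformation).
    Starting from the inverses of phi_X and phi_R one gets G -> F; the composites are the
    identity on X, hence everywhere since X generates (monoidal_endo_id). *)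

(** * Linear algebra over a field *)
Section Factor.
Variables (k : fieldType) (D V U : lmodType k).

(** The target V may be infinite dimensional (it will be H), so a complement of the image of
    v has to come from Zorn's lemma: a subspace S of V maximal among those meeting the image
    only in v(ker q) satisfies V = S + v(D), and q extends by zero on S. *)
Lemma linear_factor (v : {linear D -> V}) (q : {linear D -> U}) :
  (forall d, v d = 0 -> q d = 0) -> exists r : {linear V -> U}, forall d, r (v d) = q d.
Proof.
move=> vq.
pose P (S : set V) := (forall a x y, S x -> S y -> S (a *: x + y)) /\
  (forall d, S (v d) -> q d = 0).
(* The empty set satisfies P, so that the union of the empty chain does too. *)
have [|S [[Slin Sv] Smax]] := @Zorn_bigcup V P.
  move=> F FP Ftot; split=> [a x y [A FA Ax] [B FB By]|d [A FA Ad]]; last exact: (FP A FA).2 Ad.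
  have [AB|BA] := Ftot A B FA FB.
    by exists B => //; apply: (FP B FB).1 => //; exact: AB.
  by exists A => //; apply: (FP A FA).1 => //; exact: BA.
have Smax' (B : set V) : classical_sets.subset S B -> P B -> forall x, B x -> S x.
  move=> SB PB x Bx; apply: contrapT => Sx; apply: (Smax B) => //.
  by split=> // BS; apply: Sx; exact: BS.
have S0 : S 0.
  apply: (Smax' (fun x => S x \/ x = 0)) => [x|{Smax'}|]; [by left| |by right].
  split=> [a x y [Sx|->] [Sy|->]|d [/Sv//|/vq//]].
  - by left; exact: Slin.
  - left; rewrite addr0; have -> : a *: x = (a - 1) *: x + x; last exact: Slin.
    by rewrite scalerBl scale1r subrK.
  - by left; rewrite scaler0 add0r.
  - by right; rewrite scaler0 add0r.
have SZ a x : S x -> S (a *: x) by move=> Sx; rewrite -[a *: x]addr0; exact: Slin.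
have SD x y : S x -> S y -> S (x + y) by move=> Sx Sy; rewrite -[x]scale1r; exact: Slin.
have ex x : exists d, S (x - v d).
  apply: contrapT => nx.
  have Sx : S x; last by apply: nx; exists 0; rewrite linear0 subr0.
  apply: (Smax' (fun z => exists a s, S s /\ z = a *: x + s)) => [z Sz||].
  - by exists 0, z; rewrite scale0r add0r.
  - split=> [a _ _ [b [s [Ss ->]]] [c [t [St ->]]]|d [a [s [Ss e]]]].
      exists (a * b + c), (a *: s + t); split; first exact: Slin.
      by rewrite scalerDr scalerA addrACA -scalerDl.
    have [a0|a0] := eqVneq a 0; first by apply: Sv; rewrite e a0 scale0r add0r.
    exfalso; apply: nx; exists (a^-1 *: d); rewrite linearZ /= e scalerDr scalerA.
    by rewrite mulVf // scale1r opprD addrA subrr add0r -scaleNr; exact: SZ.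
  - by exists 1, 0; rewrite scale1r addr0.
pose f x := q (projT1 (cid (ex x))).
have fE x d : S (x - v d) -> f x = q d.
  rewrite /f; case: cid => /= d' Sd' Sd.
  apply/eqP; rewrite -subr_eq0 -linearB; apply/eqP; apply: Sv.
  rewrite linearB /=; have := Slin (-1) _ _ Sd' Sd.
  by rewrite scaleN1r opprB addrA subrK.
have fl : linear f.
  move=> a x y; have [d Sd] := ex x; have [d' Sd'] := ex y.
  rewrite (fE _ _ Sd) (fE _ _ Sd') -linearP; apply: fE.
  by rewrite linearP opprD addrACA -scalerBr; exact: Slin.
pose r : {linear V -> U} := HB.pack f (GRing.isLinear.Build _ _ _ _ _ fl).
by exists r => d; apply: fE; rewrite subrr.
Qed.

End Factor.

Lemma linear_retract (k : fieldType) (D V : lmodType k) (v : {linear D -> V}) :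
  (forall d, v d = 0 -> d = 0) -> exists r : {linear V -> D}, cancel v r.
Proof. by move=> vi; have [r rE] := @linear_factor _ _ _ _ v idfun vi; exists r. Qed.

Section TensorLemmas.
Variable k : fieldType.

Lemma tmap_comp (U U' U'' V V' V'' : lmodType k) (f' : {linear U' -> U''})
  (f : {linear U -> U'}) (g' : {linear V' -> V''}) (g : {linear V -> V'}) x :
  tmap f' g' (tmap f g x) = tmap (f' \o f) (g' \o g) x.
Proof.
by elim/tens_ind: x => [u v|x y hx hy]; rewrite ?tmapE // !linearD /= hx hy.
Qed.

Lemma eq_tmap (U U' V V' : lmodType k) (f f' : {linear U -> U'})
  (g g' : {linear V -> V'}) x : f =1 f' -> g =1 g' -> tmap f g x = tmap f' g' x.
Proof.
move=> hf hg.
by elim/tens_ind: x => [u v|x y hx hy]; rewrite ?tmapE ?hf ?hg // !linearD /= hx hy.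
Qed.

Lemma tmap_id (U V : lmodType k) (f : {linear U -> U}) (g : {linear V -> V}) x :
  f =1 id -> g =1 id -> tmap f g x = x.
Proof.
move=> hf hg; elim/tens_ind: x => [u v|x y hx hy]; first by rewrite tmapE hf hg.
by rewrite linearD /= hx hy.
Qed.

Lemma tmap_inj (U U' V V' : lmodType k) (f : {linear U -> U'}) (g : {linear V -> V'}) :
  (forall u, f u = 0 -> u = 0) -> (forall v, g v = 0 -> v = 0) ->
  injective (tmap f g).
Proof.
move=> /linear_retract[f' fK] /linear_retract[g' gK].
by apply: (can_inj (g := tmap f' g')) => x; rewrite tmap_comp tmap_id.
Qed.

(** Locked, so that rewriting rules for linear functions given by linfun do not see
    through it. *)
Definition dcoord (V : vectType k) (i : 'I_(\dim {:V})) : 'Hom(V, k^o) :=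
  locked (linfun (coord (vbasis {:V}) i : V -> k^o)).

Lemma dcoord_sum (V : vectType k) (v : V) :
  v = \sum_i (dcoord i v : k) *: (vbasis {:V})`_i.
Proof.
rewrite {1}(coord_vbasis (memvf v)); apply: eq_bigr => i _.
by rewrite /dcoord -lock lfunE.
Qed.

Lemma dcoord_basis (V : vectType k) (i j : 'I_(\dim {:V})) :
  dcoord i (vbasis {:V})`_j = (i == j)%:R.
Proof. by rewrite /dcoord -lock lfunE /= coord_free ?(basis_free (vbasisP _)) // eq_sym. Qed.

Lemma dcoord_eq0 (V : vectType k) (v : V) : (forall i, dcoord i v = 0 :> k) -> v = 0.
Proof. by move=> h; rewrite (dcoord_sum v) big1 // => i _; rewrite h scale0r. Qed.

Lemma functional_sum (V : vectType k) (W : lmodType k) (f : {linear V -> W}) v :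
  f v = \sum_i (dcoord i v : k) *: f (vbasis {:V})`_i.
Proof.
rewrite {1}(dcoord_sum v) linear_sum; apply: eq_bigr => i _.
by rewrite linearZ.
Qed.

(** The left factor is expanded in a basis; the right factor may be infinite dimensional. *)
Lemma tens_eq0l (U : vectType k) (V : lmodType k) (x : tens U V) :
  (forall f : 'Hom(U, k^o), tscall (tmap f idfun x) = 0) -> x = 0.
Proof.
move=> h; have -> : x = \sum_(i < \dim {:U}) (vbasis {:U})`_i ⊗ tscall (tmap (dcoord i) idfun x).
  elim/tens_ind: {h} x => [u v|x y {1}-> {1}->].
    rewrite {1}(dcoord_sum u) tpure_suml; apply: eq_bigr => i _.
    by rewrite tmapE tscallE tpureZr tpureZl.
  rewrite -big_split; apply: eq_bigr => i _ /=.
  by rewrite !linearD /= tpureDr.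
by rewrite big1 // => i _; rewrite h tpure0r.
Qed.

Lemma hom_extend (V U W : vectType k) (v : 'Hom(V, U)) (q : 'Hom(V, W)) :
  (forall x, v x = 0 -> q x = 0) -> exists r : 'Hom(U, W), forall x, r (v x) = q x.
Proof.
move=> vq; exists (q \o v^-1)%VF => x; rewrite comp_lfunE.
apply/eqP; rewrite -subr_eq0 -linearB; apply/eqP/vq.
by rewrite linearB /= limg_lfunVK ?memv_img ?memvf // subrr.
Qed.

End TensorLemmas.

Section TensorNat.
Variable k : fieldType.

Lemma tassoc_nat (U U' V V' W W' : lmodType k) (f : {linear U -> U'})
  (g : {linear V -> V'}) (h : {linear W -> W'}) x :
  tassoc (tmap (tmap f g) h x) = tmap f (tmap g h) (tassoc x).
Proof.
move: x; apply: (@tens_ext3l _ _ _ _ _ (@tassoc _ _ _ _ \o tmap (tmap f g) h)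
  (tmap f (tmap g h) \o @tassoc _ _ _ _)) => u v w /=.
by rewrite tmapE /= tmapE !tassocE tmapE /= tmapE.
Qed.

Lemma tscall_nat (V V' : lmodType k) (f : {linear V -> V'}) x :
  tscall (tmap idfun f x) = f (tscall x).
Proof.
elim/tens_ind: x => [c v|x y hx hy]; last by rewrite !linearD /= hx hy.
by rewrite tmapE !tscallE /= linearZ.
Qed.

Lemma tens_eq0r (U : lmodType k) (V : vectType k) (x : tens U V) :
  (forall f : 'Hom(V, k^o), tscalr (tmap idfun f x) = 0) -> x = 0.
Proof.
move=> h; have -> : x = \sum_(i < \dim {:V}) tscalr (tmap idfun (dcoord i) x) ⊗ (vbasis {:V})`_i.
  elim/tens_ind: {h} x => [u v|x y {1}-> {1}->].
    rewrite {1}(dcoord_sum v) tpure_sumr; apply: eq_bigr => i _.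
    by rewrite tmapE tscalrE tpureZr tpureZl.
  rewrite -big_split; apply: eq_bigr => i _ /=.
  by rewrite !linearD /= tpureDl.
by rewrite big1 // => i _; rewrite h tpure0l.
Qed.

End TensorNat.

(** * Colinear maps to H and functionals *)
Section Coefficients.
Variables (k : fieldType) (H : hopfAlg k).
Implicit Types (A B D Y : comod H).

(** H is in general infinite dimensional, hence not an object of H-comod; maps from a
    comodule to H are made linear and colinear by this predicate. *)
Definition Hcolinear D (v : D -> H) : Prop :=
  exists v' : {linear D -> H}, v =1 v' /\ forall d, comul (v d) = tmap idfun v' (rho D d).

(** H is cofree: v is recovered from eps v as d |-> d_(-1) (eps v)(d_(0)). *)
Lemma Hcolinear_counit D (v w : D -> H) : Hcolinear v -> Hcolinear w ->
  (forall d, counit (v d) = counit (w d)) -> v =1 w.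
Proof.
move=> [v' [v'E vc]] [w' [w'E wc]] vw d; rewrite -[LHS]counitr -[RHS]counitr vc wc !tmap_comp.
congr tscalr; apply: eq_tmap => // x /=.
by have := vw x; rewrite v'E w'E.
Qed.

(** The colinear map to H with counit mu; its values are the matrix elements of D. *)
Definition coef D (mu : 'Hom(D, k^o)) : {linear D -> H} :=
  @tscalr _ H \o (tmap idfun mu \o rho D).

(** Coassociativity of the coaction. *)
Lemma coef_Hcolinear D (mu : 'Hom(D, k^o)) : Hcolinear (coef mu).
Proof.
exists (coef mu); split=> // d.
have h p : comul (tscalr (tmap idfun mu p)) =
    tmap idfun (@tscalr _ H \o tmap idfun mu) (tassoc (tmap comul idfun p)).
  elim/tens_ind: p => [a v|p q hp hq]; last by rewrite !linearD /= hp hq.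
  rewrite !tmapE tscalrE linearZ /=.
  elim/tens_ind: (comul a) => [b c|p q hp hq].
    by rewrite tassocE tmapE /= tmapE tscalrE tpureZr.
  by rewrite tpureDl !linearD /= hp hq.
by rewrite /= h rhoA tmap_comp.
Qed.

Lemma counit_coef D (mu : 'Hom(D, k^o)) d : counit (coef mu d) = mu d.
Proof.
rewrite -[in RHS](rho1 d) /=; elim/tens_ind: (rho D d) => [a v|p q hp hq].
  by rewrite !tmapE tscalrE tscallE !linearZ; exact: mulrC.
by rewrite !linearD /= hp hq.
Qed.

Lemma Hcolinear_coef D (v : D -> H) (mu : 'Hom(D, k^o)) : Hcolinear v ->
  (forall d, counit (v d) = mu d) -> v =1 coef mu.
Proof.
move=> vc vmu; apply: Hcolinear_counit vc (coef_Hcolinear mu) _ => d.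
by rewrite vmu counit_coef.
Qed.

Lemma mat_elt_coef D d (mu : 'Hom(D, k^o)) : mat_elt (d ⊗ mu : matX D) = coef mu d.
Proof. by rewrite /mat_elt /= tmapE /contract tliftE. Qed.

Lemma coef_chom A B (f : comod_hom A B) (mu : 'Hom(A, k^o)) (nu : 'Hom(B, k^o)) :
  (forall a, nu (chom f a) = mu a) -> forall a, coef nu (chom f a) = coef mu a.
Proof.
move=> fmu a; rewrite /= rho_chom tmap_comp; congr tscalr.
by apply: eq_tmap => // x /=.
Qed.

Lemma Hcolinear_comp A B (v : B -> H) (f : comod_hom A B) : Hcolinear v ->
  Hcolinear (v \o chom f).
Proof.
move=> [v' [v'E vc]]; exists (v' \o chom f); split=> [a|a] /=; first exact: v'E.
by rewrite vc rho_chom tmap_comp.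
Qed.

End Coefficients.

(** * Kernels, quotients and exactness in the category of comodules *)
Section Exact.
Variables (k : fieldType) (H : hopfAlg k) (A B Z : comod H).
Variables (f : comod_hom A B) (g : comod_hom B Z).

Hypothesis f_inj : forall a, chom f a = 0 -> a = 0.
Hypothesis g_surj : forall z, exists b, chom g b = z.
Hypothesis fg : forall b, chom g b = 0 <-> exists a, chom f a = b.

(** The linear inverse of f on Ker g is colinear because H ⊗ - preserves injections; the
    factorization through g is colinear because g is surjective. *)
Lemma comod_short_exact : @short_exact _ (comodLin H) A B Z f g.
Proof.
have gf : chom_comp g f = 0.
  by apply: comod_homP => a; rewrite chom_compE [RHS]zero_lfunE; apply/fg; exists a.
have [f' fK] := linear_retract f_inj.
split; (split; first exact: gf).
- move=> E h gh0.
  have hE x : chom f (f' (chom (h : comod_hom E B) x)) = chom (h : comod_hom E B) x.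
    have /fg[a <-] : chom g (chom (h : comod_hom E B) x) = 0.
      by rewrite -chom_compE; have -> : chom_comp g h = 0 by []; rewrite zero_lfunE.
    by rewrite fK.
  have uc x : rho A ((f' \o chom (h : comod_hom E B)) x)
      = tmap idfun (f' \o chom (h : comod_hom E B)) (rho E x).
    apply: (@tmap_inj _ _ _ _ _ idfun (chom f)) => //.
    rewrite -rho_chom /= hE rho_chom tmap_comp.
    by apply: eq_tmap => // y /=; rewrite hE.
  exists (@mk_chom _ _ E A (f' \o chom (h : comod_hom E B)) uc); split.
    by apply: comod_homP => x; rewrite chom_compE mk_chomE /= hE.
  move=> v vh; apply: comod_homP => x; rewrite mk_chomE /= -vh.
  by rewrite chom_compE fK.
- move=> E h hf0.
  have [u uE] : exists u : 'Hom(Z, E), forall x, u (chom g x) = chom (h : comod_hom B E) x.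
    apply: hom_extend => x /fg[a <-].
    by rewrite -chom_compE; have -> : chom_comp h f = 0 by []; rewrite zero_lfunE.
  have uc x : rho E (u x) = tmap idfun u (rho Z x).
    have [b <-] := g_surj x; rewrite uE !rho_chom tmap_comp.
    by apply: eq_tmap => // y /=; rewrite uE.
  exists (@mk_chom _ _ Z E u uc); split.
    by apply: comod_homP => x; rewrite chom_compE mk_chomE; exact: uE.
  move=> v vh; apply: comod_homP => x; have [b <-] := g_surj x.
  rewrite mk_chomE; transitivity (chom (h : comod_hom B E) b); first exact: uE.
  by rewrite -vh chom_compE.
Qed.

End Exact.

Section Induced.
Variables (k : fieldType) (H : hopfAlg k) (B : comod H) (V : vectType k).
Variable r : {linear V -> tens H V}.

Lemma sub_comod (i : {linear V -> B}) : (forall v, i v = 0 -> v = 0) ->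
  (forall v, tmap idfun i (r v) = rho B (i v)) ->
  exists (A : comod H) (f : comod_hom A B) (e : {linear V -> A}),
    (forall a, exists v, e v = a) /\ forall v, chom f (e v) = i v.
Proof.
move=> i_inj ri.
have rA v : tassoc (tmap comul idfun (r v)) = tmap idfun r (r v).
  apply: (@tmap_inj _ _ _ _ _ idfun (tmap idfun i)) => // [x x0|].
    by apply: (@tmap_inj _ _ _ _ _ idfun i); rewrite // x0 linear0.
  rewrite tmap_comp -tassoc_nat tmap_comp.
  transitivity (tassoc (tmap comul idfun (tmap idfun i (r v)))).
    by rewrite tmap_comp; congr tassoc; apply: eq_tmap => // x; rewrite /= tmap_id.
  rewrite ri rhoA -ri tmap_comp.
  by apply: eq_tmap => // x /=; rewrite ri.
have r1 v : tscall (tmap counit idfun (r v)) = v.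
  apply/eqP; rewrite -subr_eq0; apply/eqP/i_inj; rewrite linearB /=; apply/eqP.
  rewrite subr_eq0; apply/eqP; rewrite -tscall_nat tmap_comp -[RHS]rho1 -ri tmap_comp.
  by congr tscall; apply: eq_tmap.
exists (Comod rA r1), (@mk_chom _ _ (Comod rA r1) B i (fun v => esym (ri v))), idfun.
by split=> [a|v]; [exists a|rewrite mk_chomE].
Qed.

Lemma quotient_comod (q : {linear B -> V}) : (forall v, exists b, q b = v) ->
  (forall b, r (q b) = tmap idfun q (rho B b)) ->
  exists (Z : comod H) (g : comod_hom B Z) (e : {linear Z -> V}),
    (forall z, e z = 0 -> z = 0) /\ forall b, e (chom g b) = q b.
Proof.
move=> q_surj rq.
have rA v : tassoc (tmap comul idfun (r v)) = tmap idfun r (r v).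
  have [b <-] := q_surj v; rewrite rq !tmap_comp.
  transitivity (tmap idfun (tmap idfun q) (tassoc (tmap comul idfun (rho B b)))).
    rewrite -tassoc_nat tmap_comp; congr tassoc.
    by apply: eq_tmap => // x; rewrite /= tmap_id.
  by rewrite rhoA tmap_comp; apply: eq_tmap => // x /=; rewrite rq.
have r1 v : tscall (tmap counit idfun (r v)) = v.
  have [b <-] := q_surj v; rewrite rq -[in RHS](rho1 b) -tscall_nat !tmap_comp.
  by congr tscall; apply: eq_tmap.
exists (Comod rA r1), (@mk_chom _ _ B (Comod rA r1) q rq), idfun.
by split=> [//|v]; rewrite mk_chomE.
Qed.

End Induced.

Lemma vsprojE (k : fieldType) (V : vectType k) (U : {vspace V}) x :
  vsval (vsproj U x) = projv U x.
Proof. by rewrite unlock. Qed.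

Section SubQuotient.
Variables (k : fieldType) (H : hopfAlg k) (B : comod H) (U : {vspace B}).

(** A subspace U underlies a subcomodule as soon as the matrix elements taken between U
    and the functionals vanishing on U are zero; this form of the condition is checked in
    the same way for kernels, for images and for kernels of maps to H. *)
Lemma sub_quotient :
  (forall u (q : 'Hom(B, k^o)), u \in U -> (forall v, v \in U -> q v = 0) -> coef q u = 0) ->
  exists (A Z : comod H) (f : comod_hom A B) (g : comod_hom B Z),
    [/\ forall a, chom f a = 0 -> a = 0, forall z, exists b, chom g b = z,
        forall b, b \in U <-> exists a, chom f a = b &
        forall b, b \in U <-> chom g b = 0].
Proof.
move=> Ust.
pose c : 'End(B) := (\1 - projv U)%VF.
have cE v : c v = v - projv U v by rewrite add_lfunE opp_lfunE id_lfunE.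
have cU v : v \in U -> c v = 0 by move=> vU; rewrite cE projv_id ?subrr.
have tc (p : tens H B) : tmap idfun c p = p - tmap idfun (projv U) p.
  elim/tens_ind: p => [a v|p q hp hq].
    by rewrite !tmapE /= cE -!tpurelE linearB.
  by rewrite !linearD /= hp hq addrACA.
have Urho u : u \in U -> tmap idfun c (rho B u) = 0.
  move=> uU; apply: tens_eq0r => q; rewrite tmap_comp.
  rewrite -[RHS](Ust u (q \o c)%VF uU) => [|v vU]; last first.
    by rewrite comp_lfunE cU // linear0.
  by congr tscalr; apply: eq_tmap => // x; rewrite /= comp_lfunE.
pose i : {linear subvs_of U -> B} := @vsval _ _ U.
have iU v : i v \in U by exact: subvsP.
have i_inj v : i v = 0 -> v = 0 by move=> h; apply: subvs_inj; rewrite h.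
pose r : {linear subvs_of U -> tens H (subvs_of U)} :=
  tmap idfun (@vsproj _ _ U) \o (rho B \o i).
have ri v : tmap idfun i (r v) = rho B (i v).
  rewrite /r /= tmap_comp; transitivity (tmap idfun (projv U) (rho B (i v))).
    by apply: eq_tmap => // x; exact: vsprojE.
  by apply/eqP; rewrite eq_sym -subr_eq0 -tc Urho ?eqxx // iU.
have [A [f [e [e_surj fe]]]] := sub_comod i_inj ri.
pose q : {linear B -> subvs_of (U^C)%VS} := @vsproj _ _ (U^C)%VS \o c.
have vq b : vsval (q b) = c b by rewrite /q /= vsprojK // cE memv_projC.
have q_surj v : exists b, q b = v.
  exists (vsval v); apply: subvs_inj; rewrite vq cE.
  suff : vsval v \in lker (projv U) by rewrite memv_ker => /eqP ->; rewrite subr0.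
  by rewrite lker_proj subvsP.
have qU b : b \in U <-> q b = 0.
  split=> [bU|qb]; first by apply: subvs_inj; rewrite vq cU.
  have : c b = 0 by rewrite -vq qb.
  by rewrite cE => /eqP; rewrite subr_eq0 => /eqP ->; exact: memv_proj.
pose s : {linear subvs_of (U^C)%VS -> tens H (subvs_of (U^C)%VS)} :=
  tmap idfun q \o (rho B \o @vsval _ _ (U^C)%VS).
have sq b : s (q b) = tmap idfun q (rho B b).
  transitivity (tmap idfun q (rho B (b - projv U b))); first by rewrite -cE -vq.
  rewrite linearB linearB /= -[RHS]subr0; congr (_ - _).
  transitivity (tmap idfun (@vsproj _ _ (U^C)%VS) (tmap idfun c (rho B (projv U b)))).
    by rewrite tmap_comp; apply: eq_tmap.
  by rewrite Urho ?memv_proj // linear0.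
have [Z [g [e' [e'_inj glue]]]] := quotient_comod q_surj sq.
exists A, Z, f, g; split=> [a|z|b|b].
- by have [v <-] := e_surj a; rewrite fe => /i_inj ->; rewrite linear0.
- have [b qb] := q_surj (e' z); exists b; apply/eqP; rewrite -subr_eq0; apply/eqP/e'_inj.
  by rewrite linearB /= glue qb subrr.
- split=> [bU|[a <-]]; last by have [v <-] := e_surj a; rewrite fe.
  by exists (e (vsproj U b)); rewrite fe /i /= vsprojK.
- rewrite qU -glue; split=> [/e'_inj//|->]; exact: linear0.
Qed.

End SubQuotient.

Section KernelImage.
Variables (k : fieldType) (H : hopfAlg k).

Lemma chom_kernel (B C : comod H) (h : comod_hom B C) :
  exists (A Z : comod H) (f : comod_hom A B) (g : comod_hom B Z),
    [/\ forall a, chom f a = 0 -> a = 0, forall z, exists b, chom g b = z,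
        forall b, chom h b = 0 <-> exists a, chom f a = b &
        forall b, chom h b = 0 <-> chom g b = 0].
Proof.
have [|A [Z [f [g [fi gs fU gU]]]]] := @sub_quotient _ _ B (lker (chom h)).
  move=> u q; rewrite memv_ker => /eqP hu qh.
  have [r rE] : exists r : 'Hom(C, k^o), forall x, r (chom h x) = q x.
    by apply: hom_extend => x hx; apply: qh; rewrite memv_ker hx.
  by rewrite -(coef_chom rE) hu linear0.
have kE b : b \in lker (chom h) <-> chom h b = 0 by rewrite memv_ker; split=> /eqP.
by exists A, Z, f, g; split=> // b; rewrite -kE.
Qed.

Lemma chom_cokernel (A B : comod H) (f : comod_hom A B) :
  exists (Z : comod H) (g : comod_hom B Z),
    (forall z, exists b, chom g b = z) /\
    (forall b, chom g b = 0 <-> exists a, chom f a = b).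
Proof.
have kE b : b \in limg (chom f) <-> exists a, chom f a = b.
  by split=> [/memv_imgP[a _ ->]|[a <-]]; [exists a|exact: memv_img (memvf a)].
have [|A' [Z [f' [g [fi gs fU gU]]]]] := @sub_quotient _ _ B (limg (chom f)).
  move=> _ q /memv_imgP[a _ ->] qf.
  rewrite (@coef_chom _ _ _ _ f 0 q).
    rewrite /=; apply: etrans (linear0 (@tscalr _ H)); congr tscalr.
    elim/tens_ind: (rho A a) => [h x|x y hx hy]; last by rewrite linearD /= hx hy addr0.
    by rewrite tmapE /= zero_lfunE tpure0r.
  by move=> x; rewrite zero_lfunE qf // memv_img ?memvf.
by exists Z, g; split=> // b; rewrite -gU kE.
Qed.

(** A colinear map to H has a finite dimensional comodule as image, which is a subcomodule
    of H. Its kernel is first found as a subspace, of maximal dimension among those on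
    which v vanishes. That it is a subcomodule uses functionals extended from the image of
    v to the whole of H, hence linear_factor. *)
Lemma Hcolinear_image (B : comod H) (v : B -> H) : Hcolinear v ->
  exists (C : comod H) (p : comod_hom B C) (c : {linear C -> H}),
    [/\ forall z, exists b, chom p b = z, forall z, c z = 0 -> z = 0, Hcolinear c
      & forall b, c (chom p b) = v b].
Proof.
move=> [w [vw wc]].
have [U UE] : exists U : {vspace B}, forall b, b \in U <-> w b = 0.
  have ex : exists n : nat,
      `[< exists U : {vspace B}, \dim U = n /\ forall b, b \in U -> w b = 0 >].
    exists 0%N; apply/asboolP; exists 0%VS; rewrite dimv0; split=> // b.
    by rewrite memv0 => /eqP ->; rewrite linear0.
  have ub (n : nat) : `[< exists U : {vspace B}, \dim U = n /\ forall b, b \in U -> w b = 0 >] ->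
      (n <= \dim {:B})%N.
    by move=> /asboolP[U [<- _]]; rewrite dimvS // subvf.
  have [n /asboolP[U [Un Uw]] nmax] := ex_maxnP ex ub.
  exists U => b; split=> [/Uw//|wb]; apply: contrapT => /negP bU.
  have : (\dim (U + <[b]>) <= n)%N.
    apply: nmax; apply/asboolP; exists (U + <[b]>)%VS; split=> // _ /memv_addP[u uU [x xb ->]].
    by have [a ->] := vlineP _ _ xb; rewrite linearD linearZ /= wb Uw // scaler0 addr0.
  rewrite leqNgt -Un; case/negP.
  have [le_dim eq_dim] := dimv_leqif_sup (addvSl U <[b]>).
  rewrite ltn_neqAle le_dim eq_dim andbT; apply/negP => /subvP h.
  by case/negP: bU; apply: h; rewrite -[X in X \in _]add0r memv_add ?mem0v ?memv_line.
have [|A [C [f [p [fi ps fU pU]]]]] := @sub_quotient _ _ B U.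
  move=> u q /UE wu qU.
  have [q' q'E] := @linear_factor _ _ _ _ w q (fun d wd => qU d ((UE d).2 wd)).
  have -> : coef q u = tscalr (tmap idfun q' (tmap idfun w (rho B u))).
    by rewrite tmap_comp; congr tscalr; apply: eq_tmap => // x /=; rewrite q'E.
  by rewrite -(wc u) vw wu !linear0.
pose c : {linear C -> H} := w \o (chom p)^-1%VF.
have cE b : c (chom p b) = w b.
  rewrite /c /=; apply/eqP; rewrite -subr_eq0 -linearB; apply/eqP/UE/pU.
  by rewrite linearB /= limg_lfunVK ?memv_img ?memvf // subrr.
exists C, p, c; split=> [//|z|| b]; last by rewrite cE vw.
  have [b <-] := ps z; rewrite cE => /UE/pU//.
exists c; split=> // z; have [b <-] := ps z.
by rewrite cE -vw wc rho_chom tmap_comp; apply: eq_tmap => // x; exact: esym (cE x).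
Qed.

End KernelImage.

(** * Direct sums, and tensoring with a vector space *)
Section DirectSum.
Variables (k : fieldType) (H : hopfAlg k) (A B : comod H).

Definition pinl (a : A) : (A * B)%type := (a, 0).
Definition pinr (b : B) : (A * B)%type := (0, b).
Fact pinl_linear : linear pinl.
Proof. by move=> a x y; congr pair; rewrite /= scaler0 addr0. Qed.
Fact pinr_linear : linear pinr.
Proof. by move=> a x y; congr pair; rewrite /= scaler0 addr0. Qed.
HB.instance Definition _ := GRing.isLinear.Build k A (A * B)%type _ pinl pinl_linear.
HB.instance Definition _ := GRing.isLinear.Build k B (A * B)%type _ pinr pinr_linear.

Definition sum_rho (x : (A * B)%type) : tens H (A * B)%type :=
  tmap idfun pinl (rho A x.1) + tmap idfun pinr (rho B x.2).
Fact sum_rho_linear : linear sum_rho.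
Proof. by move=> a x y; rewrite /sum_rho !linearP scalerDr addrACA. Qed.
HB.instance Definition _ :=
  GRing.isLinear.Build k (A * B)%type (tens H (A * B)%type) _ sum_rho sum_rho_linear.

Lemma sum_rho_inl a : sum_rho (pinl a) = tmap idfun pinl (rho A a).
Proof. by rewrite /sum_rho /= !linear0 addr0. Qed.
Lemma sum_rho_inr b : sum_rho (pinr b) = tmap idfun pinr (rho B b).
Proof. by rewrite /sum_rho /= !linear0 add0r. Qed.
Lemma pairE (x : (A * B)%type) : x = pinl x.1 + pinr x.2.
Proof. by case: x => a b; congr pair; rewrite /= ?addr0 ?add0r. Qed.

Fact sum_rhoA x : tassoc (tmap comul idfun (sum_rho x)) = tmap idfun sum_rho (sum_rho x).
Proof.
have h (C : comod H) (i : {linear C -> (A * B)%type}) c :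
    (forall c, sum_rho (i c) = tmap idfun i (rho C c)) ->
    tassoc (tmap comul idfun (tmap idfun i (rho C c))) =
    tmap idfun sum_rho (tmap idfun i (rho C c)).
  move=> ic; transitivity (tmap idfun (tmap idfun i) (tassoc (tmap comul idfun (rho C c)))).
    rewrite -tassoc_nat !tmap_comp; congr tassoc.
    by apply: eq_tmap => // x'; rewrite /= tmap_id.
  by rewrite rhoA !tmap_comp; apply: eq_tmap => // x' /=; rewrite ic.
rewrite {1 3}/sum_rho !linearD /= !h // => c; [exact: sum_rho_inr | exact: sum_rho_inl].
Qed.

Fact sum_rho1 x : tscall (tmap counit idfun (sum_rho x)) = x.
Proof.
rewrite [RHS]pairE /sum_rho !linearD /= -[in RHS](rho1 x.1) -[in RHS](rho1 x.2).
by rewrite -!tscall_nat !tmap_comp; congr (_ + _); congr tscall; apply: eq_tmap.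
Qed.

Definition comod_sum : comod H := Comod sum_rhoA sum_rho1.

Fact sum_inl_colinear a : rho comod_sum (pinl a) = tmap idfun pinl (rho A a).
Proof. exact: sum_rho_inl. Qed.
Fact sum_inr_colinear a : rho comod_sum (pinr a) = tmap idfun pinr (rho B a).
Proof. exact: sum_rho_inr. Qed.
Fact sum_fst_colinear (x : comod_sum) : rho A (fst x) = tmap idfun fst (rho comod_sum x).
Proof.
rewrite /= /sum_rho linearD /= !tmap_comp /=; rewrite [X in X + _]tmap_id //.
elim/tens_ind: (rho B x.2) => [h b|p q hp hq]; first by rewrite tmapE /= tpure0r addr0.
by rewrite linearD addrA -hp -hq.
Qed.
Fact sum_snd_colinear (x : comod_sum) : rho B (snd x) = tmap idfun snd (rho comod_sum x).
Proof.
rewrite /= /sum_rho linearD /= !tmap_comp /=; rewrite [X in _ + X]tmap_id //.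
elim/tens_ind: (rho A x.1) => [h b|p q hp hq]; first by rewrite tmapE /= tpure0r add0r.
by rewrite linearD -addrA -hq -hp.
Qed.
Definition sum_inl : comod_hom A comod_sum := @mk_chom _ _ A comod_sum pinl sum_inl_colinear.
Definition sum_inr : comod_hom B comod_sum := @mk_chom _ _ B comod_sum pinr sum_inr_colinear.
Definition sum_fst : comod_hom comod_sum A := @mk_chom _ _ comod_sum A fst sum_fst_colinear.
Definition sum_snd : comod_hom comod_sum B := @mk_chom _ _ comod_sum B snd sum_snd_colinear.
Lemma sum_inlE a : chom sum_inl a = (a, 0). Proof. exact: mk_chomE. Qed.
Lemma sum_inrE a : chom sum_inr a = (0, a). Proof. exact: mk_chomE. Qed.
Lemma sum_fstE a : chom sum_fst a = a.1. Proof. exact: mk_chomE. Qed.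
Lemma sum_sndE a : chom sum_snd a = a.2. Proof. exact: mk_chomE. Qed.

End DirectSum.

Section SpaceProjection.
Variables (k : fieldType) (H : hopfAlg k) (A : comod H) (S : vectType k).

Fact sp_pr_colinear (f : 'Hom(S, k^o)) (x : sp_comod A S) :
  rho A ((@tscalr _ A \o tmap idfun f) x) =
  tmap idfun (@tscalr _ A \o tmap idfun f) (rho (sp_comod A S) x).
Proof.
move: x; apply: (@tens_ext _ _ _ _ (rho A \o (@tscalr _ A \o tmap idfun f))
  (tmap idfun (@tscalr _ A \o tmap idfun f) \o @sp_rho _ _ A S)) => x s /=.
rewrite tmapE tscalrE sp_rhoE linearZ /=.
elim/tens_ind: (rho A x) => [h a|p q hp hq].
  by rewrite tassocE tmapE /= tmapE tscalrE tpureZr.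
by rewrite tpureDl !linearD /= hp hq.
Qed.
(** x ⊗ s |-> f(s) x: the projections of A ⊗ S, a sum of copies of A. *)
Definition sp_pr (f : 'Hom(S, k^o)) : comod_hom (sp_comod A S) A :=
  @mk_chom _ _ (sp_comod A S) A (@tscalr _ A \o tmap idfun f) (@sp_pr_colinear f).
Lemma sp_prE f x s : chom (sp_pr f) (x ⊗ s) = (f s : k) *: x.
Proof. by rewrite mk_chomE /= tmapE tscalrE. Qed.

Lemma sp_sum (x : sp_comod A S) :
  x = \sum_(i < \dim {:S}) chom (sp_in A (vbasis {:S})`_i) (chom (sp_pr (dcoord i)) x).
Proof.
elim/tens_ind: x => [a s|x y {1}-> {1}->].
  rewrite {1}(dcoord_sum s) tpure_sumr; apply: eq_bigr => i _.
  by rewrite sp_prE sp_inE tpureZr tpureZl.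
by rewrite -big_split; apply: eq_bigr => i _ /=; rewrite !linearD.
Qed.

End SpaceProjection.

(** * The tensor algebra is the direct sum of the tensor powers *)
Section Grading.
Variables (k : fieldType) (H : hopfAlg k) (X : comod H).
Local Notation W := (matX X).
Local Notation Wpow := (matXpow X).

(** The product of the functionals phi a, phi (a + 1), ..., phi (a + n - 1); the shift a
    is the row index in shift_mx_pow. *)
Fixpoint peval (phi : nat -> 'Hom(W, k^o)) (a n : nat) : {linear Wpow n -> k^o} :=
  match n with
  | 0 => idfun : {linear k^o -> k^o}
  | n'.+1 => (@tscall _ k^o \o tmap (phi a) (peval phi a.+1 n'))
      : {linear tens W (Wpow n') -> k^o}
  end.

Lemma peval_eq phi psi a n : (forall i, (a <= i)%N -> phi i = psi i) ->
  peval phi a n =1 peval psi a n.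
Proof.
elim: n a => [//|n IHn] a h x /=; congr tscall; apply: eq_tmap => [w|]; first by rewrite h.
by apply: IHn => i /ltnW; exact: h.
Qed.

Lemma peval_separates n a (x : Wpow n) : (forall phi, peval phi a n x = 0) -> x = 0.
Proof.
elim: n a x => [|n IHn] a x; first by move=> /(_ (fun=> 0)).
move=> h; apply: (@tens_eq0l _ W (Wpow n)) => f; apply: (IHn a.+1) => phi.
pose psi i := if i == a then f else phi i.
rewrite (@peval_eq phi psi) => [|i]; last first.
  by rewrite /psi; case: eqP => // ->; rewrite ltnn.
rewrite -[RHS](h psi) -tscall_nat tmap_comp /=; congr tscall.
by apply: eq_tmap => // w; rewrite /= /psi eqxx.
Qed.

Section Shift.
Variables (phi : nat -> 'Hom(W, k^o)) (N : nat).

(** The tensor algebra is only known through its maps to algebras. Sending w to the matrix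
    with entries phi i w just above the diagonal makes a word of length n act by entries
    at distance n from the diagonal, which reads off its degree and its value under the
    functionals phi. *)
Definition shift_mx (w : W) : 'M[k]_N.+1 :=
  \matrix_(i, j) ((i.+1 == j)%:R * (phi i w : k)).
Fact shift_mx_linear : linear shift_mx.
Proof.
by move=> a x y; apply/matrixP => i j; rewrite !mxE linearP mulrDr mulrCA.
Qed.
HB.instance Definition _ :=
  GRing.isLinear.Build k W 'M[k]_N.+1 _ shift_mx shift_mx_linear.

Lemma shift_mx_pow n (x : Wpow n) (a b : 'I_N.+1) :
  talg_lift shift_mx (matXpow_in X n x) a b = ((a + n)%N == b)%:R * (peval phi a n x : k).
Proof.
elim: n x a b => [|n IHn] x a b.
  by rewrite /= /talg_const linearZ rmorph1 /= !mxE addn0 mulrC -mulr_natr.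
elim/tens_ind: x => [w y|y z hy hz]; last first.
  by rewrite !linearD /= mxE mulrDr; congr (_ + _).
rewrite [matXpow_in _ _ _]/= tmapE tmuE rmorphM /= talg_liftE mxE tmapE tscallE.
have -> : peval phi a.+1 n y = peval phi a.+1 n y :> k by [].
have [aN|aN] := ltnP a.+1 N.+1.
  rewrite (bigD1 (Ordinal aN)) //= mxE eqxx mul1r IHn /= addSnnS big1 ?addr0.
    by rewrite mulrCA.
  move=> c ca; rewrite mxE; case: eqP => [e|_]; last by rewrite mul0r mul0r.
  by case/eqP: ca; apply: val_inj.
rewrite big1 => [|c _]; last first.
  rewrite mxE; case: eqP => [e|_]; last by rewrite mul0r mul0r.
  by have := ltn_ord c; rewrite -e ltnNge aN.
case: eqP => [e|_]; last by rewrite mul0r.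
by have := ltn_ord b; rewrite -e -addSnnS ltnNge (leq_trans aN) // leq_addr.
Qed.
End Shift.

(** Row 0 and column j of the matrices above select the degree j component. *)
Lemma matXpow_in_free N (x : forall j, Wpow j) :
  \sum_(j < N) matXpow_in X j (x j) = 0 -> forall j, (j < N)%N -> x j = 0.
Proof.
move=> x0 j jN; apply: (@peval_separates j 0) => phi.
have /(congr1 (fun y => talg_lift (shift_mx phi N) y ord0 (inord j))) := x0.
rewrite linear0 linear_sum summxE mxE (bigD1 (Ordinal jN)) //= shift_mx_pow.
rewrite add0n inordK ?(ltnW jN) //; last by rewrite ltnS ltnW.
rewrite eqxx mul1r big1 ?addr0 // => i ij.
rewrite shift_mx_pow add0n inordK; last by rewrite ltnS ltnW.
by case: eqP => [e|]; [case/eqP: ij; apply: val_inj | rewrite mul0r].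
Qed.

End Grading.

(** * Composition in linear categories *)
Section LinearCategory.
Variables (k : fieldType) (C : linCat k).
Implicit Types A B D : C.

Definition precomp A B D (f : hom A B) (g : hom B D) : hom A D := g ∘ f.
Definition postcomp A B D (g : hom B D) (f : hom A B) : hom A D := g ∘ f.
HB.instance Definition _ A B D (f : hom A B) :=
  GRing.isLinear.Build k (hom B D) (hom A D) _ (precomp f) ((@comp_bilin _ C A B D).1 f).
HB.instance Definition _ A B D (g : hom B D) :=
  GRing.isLinear.Build k (hom A B) (hom A D) _ (postcomp g) ((@comp_bilin _ C A B D).2 g).

Lemma comp0l A B D (f : hom A B) : (0 : hom B D) ∘ f = 0.
Proof. exact: (linear0 (precomp f)). Qed.
Lemma comp0r A B D (g : hom B D) : g ∘ (0 : hom A B) = 0.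
Proof. exact: (linear0 (postcomp g)). Qed.
Lemma compPl A B D (f : hom A B) a (g g' : hom B D) :
  (a *: g + g') ∘ f = a *: (g ∘ f) + g' ∘ f.
Proof. exact: (linearP (precomp f)). Qed.
Lemma compPr A B D (g : hom B D) a (f f' : hom A B) :
  g ∘ (a *: f + f') = a *: (g ∘ f) + g ∘ f'.
Proof. exact: (linearP (postcomp g)). Qed.
Lemma compZl A B D (f : hom A B) a (g : hom B D) : (a *: g) ∘ f = a *: (g ∘ f).
Proof. exact: (linearZ_LR (precomp f)). Qed.
Lemma compZr A B D (g : hom B D) a (f : hom A B) : g ∘ (a *: f) = a *: (g ∘ f).
Proof. exact: (linearZ_LR (postcomp g)). Qed.
Lemma comp_suml A B D (f : hom A B) I r (P : pred I) (g : I -> hom B D) :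
  (\sum_(i <- r | P i) g i) ∘ f = \sum_(i <- r | P i) g i ∘ f.
Proof. exact: (linear_sum (precomp f)). Qed.
Lemma comp_sumr A B D (g : hom B D) I r (P : pred I) (f : I -> hom A B) :
  g ∘ (\sum_(i <- r | P i) f i) = \sum_(i <- r | P i) g ∘ f i.
Proof. exact: (linear_sum (postcomp g)). Qed.

Lemma is_iso_epic A B (f : hom A B) : is_iso f -> epic f.
Proof.
by move=> [g [_ fg]] D h h' e; rewrite -[h]comp1r -[h']comp1r -fg !compA e.
Qed.

Lemma is_iso_comp A B D (g : hom B D) (f : hom A B) :
  is_iso g -> is_iso f -> is_iso (g ∘ f).
Proof.
move=> [g' [g'g gg']] [f' [f'f ff']]; exists (f' ∘ g'); split.
  by rewrite compA -(compA f') g'g comp1r.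
by rewrite compA -(compA g) ff' comp1r.
Qed.

Lemma is_iso_id A : is_iso (id1 A).
Proof. by exists (id1 A); rewrite comp1l. Qed.

End LinearCategory.

Lemma is_iso_tmor (k : fieldType) (C : monCat k) (A A' B B' : C) (f : hom A A')
  (g : hom B B') : is_iso f -> is_iso g -> is_iso (tmor f g).
Proof.
move=> [f' [f'f ff']] [g' [g'g gg']]; exists (tmor f' g').
by rewrite -!tmor_comp f'f ff' g'g gg' !tmor_id.
Qed.

Section MonicEpic.
Variables (k : fieldType) (H : hopfAlg k).

(** Categorical monomorphisms and epimorphisms of comodules are the injective and the
    surjective colinear maps, because kernels and cokernels exist. *)
Lemma comod_monic_inj (A B : comod H) (i : comod_hom A B) :
  @monic _ (comodLin H) A B i -> forall a, chom i a = 0 -> a = 0.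
Proof.
move=> im; have [K [_ [f [_ [fi _ fK _]]]]] := chom_kernel i.
have f0 : f = 0.
  apply: (im K f 0); rewrite comp0r; apply: comod_homP => x.
  by rewrite [RHS]zero_lfunE chom_compE; apply/fK; exists x.
by move=> z /fK[x <-]; rewrite f0 zero_lfunE.
Qed.

Lemma comod_epic_surj (A B : comod H) (p : comod_hom A B) :
  @epic _ (comodLin H) A B p -> forall b, exists a, chom p a = b.
Proof.
move=> pe; have [Q [q [qs pq]]] := chom_cokernel p.
have q0 : q = 0.
  apply: (pe Q q 0); rewrite comp0l; apply: comod_homP => x.
  by rewrite [RHS]zero_lfunE chom_compE; apply/pq; exists x.
by move=> y; apply/pq; rewrite q0 zero_lfunE.
Qed.

End MonicEpic.

Lemma chom_sum (k : fieldType) (H : hopfAlg k) (A B : comod H) I (r : seq I) (P : pred I)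
  (f : I -> comod_hom A B) x :
  chom (\sum_(i <- r | P i) f i) x = \sum_(i <- r | P i) chom (f i) x.
Proof.
apply: (big_morph (fun g : comod_hom A B => chom g x)) => [g h|]; first exact: chomD.
exact: zero_lfunE.
Qed.

(** * Relations between injections and projections *)
Section SumRelations.
Variables (k : fieldType) (H : hopfAlg k) (A B : comod H).

Lemma sum_fst_inl : chom_comp (sum_fst A B) (sum_inl A B) = chom_id A.
Proof. by apply: comod_homP => x; rewrite chom_compE sum_fstE sum_inlE chom_idE. Qed.
Lemma sum_snd_inr : chom_comp (sum_snd A B) (sum_inr A B) = chom_id B.
Proof. by apply: comod_homP => x; rewrite chom_compE sum_sndE sum_inrE chom_idE. Qed.
Lemma sum_fst_inr : chom_comp (sum_fst A B) (sum_inr A B) = 0.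
Proof. by apply: comod_homP => x; rewrite chom_compE sum_fstE sum_inrE [RHS]zero_lfunE. Qed.
Lemma sum_snd_inl : chom_comp (sum_snd A B) (sum_inl A B) = 0.
Proof. by apply: comod_homP => x; rewrite chom_compE sum_sndE sum_inlE [RHS]zero_lfunE. Qed.

Definition sum_homE := (sum_fst_inl, sum_snd_inr, sum_fst_inr, sum_snd_inl).

End SumRelations.

Section SpaceDecomposition.
Variables (k : fieldType) (H : hopfAlg k) (A : comod H) (S : vectType k).
Local Notation bas i := (vbasis {:S})`_i.

Lemma sp_pr_in (f : 'Hom(S, k^o)) s : chom_comp (sp_pr A f) (sp_in A s) = (f s : k) *: chom_id A.
Proof.
by apply: comod_homP => x; rewrite chom_compE sp_inE sp_prE chomZ chom_idE.
Qed.

Lemma sp_in_sum s : sp_in A s = \sum_(i < \dim {:S}) (dcoord i s : k) *: sp_in A (bas i).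
Proof.
pose g : {linear S -> comod_hom A (sp_comod A S)} :=
  HB.pack (@sp_in _ _ A S) (GRing.isLinear.Build _ _ _ _ _ (@sp_in_linear _ _ A S)).
exact: (functional_sum g).
Qed.

Lemma sp_pr_sum f : sp_pr A f = \sum_(i < \dim {:S}) (f (bas i) : k) *: sp_pr A (dcoord i).
Proof.
apply: comod_homP => x; rewrite chom_sum.
elim/tens_ind: x => [a s|x y hx hy].
  rewrite sp_prE (functional_sum f s) scaler_suml; apply: eq_bigr => i _.
  by rewrite chomZ sp_prE scalerA mulrC.
by rewrite linearD /= hx hy -big_split; apply: eq_bigr => i _ /=; rewrite linearD.
Qed.

Lemma sp_id_sum : chom_id (sp_comod A S) =
  \sum_(i < \dim {:S}) chom_comp (sp_in A (bas i)) (sp_pr A (dcoord i)).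
Proof.
apply: comod_homP => x; rewrite chom_idE chom_sum {1}[x]sp_sum.
by apply: eq_bigr => i _; rewrite chom_compE.
Qed.

End SpaceDecomposition.

(** * Exact functors on comodules *)
Section Functor.
Variables (k : fieldType) (H : hopfAlg k) (E : monCat k).
Variable F : tensorFunctor (comodCat H) E.
Implicit Types A B D : comod H.

(** fmor with the categories fixed, so that F can be applied to colinear maps as they
    stand. *)
Definition Fm A B (f : comod_hom A B) : hom (F A) (F B) :=
  @fmor k (comodCat H) E F A B f.

Fact Fm_linear A B : linear (@Fm A B).
Proof. exact (@fmor_linear k (comodCat H) E F A B). Qed.
HB.instance Definition _ A B :=
  GRing.isLinear.Build k (comod_hom A B) (hom (F A) (F B)) _ (@Fm A B) (@Fm_linear A B).

Lemma Fm_id A : Fm (chom_id A) = id1 (F A).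
Proof. exact: fmor_id. Qed.
Lemma Fm_comp A B D (g : comod_hom B D) (f : comod_hom A B) :
  Fm (chom_comp g f) = Fm g ∘ Fm f.
Proof. exact: fmor_comp. Qed.

Lemma Fm_exact A B D (f : comod_hom A B) (g : comod_hom B D) :
  (forall a, chom f a = 0 -> a = 0) -> (forall z, exists b, chom g b = z) ->
  (forall b, chom g b = 0 <-> exists a, chom f a = b) -> short_exact (Fm f) (Fm g).
Proof. by move=> fi gs fg; apply: fexact; exact: comod_short_exact. Qed.

Lemma Fm_monic A B (f : comod_hom A B) : (forall a, chom f a = 0 -> a = 0) -> monic (Fm f).
Proof.
move=> fi; have [Z [g [gs fg]]] := chom_cokernel f.
have [[gf0 ker] _] := Fm_exact fi gs fg.
move=> D u v uv.
have [|w [_ wu]] := ker D (Fm f ∘ u); first by rewrite compA gf0 comp0l.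
by rewrite -(wu u) // -(wu v).
Qed.

Lemma Fm_epic A B (f : comod_hom A B) : (forall b, exists a, chom f a = b) -> epic (Fm f).
Proof.
move=> fs; have [K [_ [i [_ [ii _ fi _]]]]] := chom_kernel f.
have [_ [fi0 cok]] := Fm_exact ii fs fi.
move=> D u v uv.
have [|w [_ wu]] := cok D (u ∘ Fm f); first by rewrite -compA fi0 comp0r.
by rewrite -(wu u) // -(wu v).
Qed.

End Functor.

(** * Glued objects *)
Section GluedObjects.
Variables (k : fieldType) (H : hopfAlg k) (E : monCat k).
Variables F G : tensorFunctor (comodCat H) E.

(** The morphism is an arbitrary one: invertibility is only obtained at the end, from the
    transformations in the two directions. *)
Structure gobj := GObj { gcomod :> comod H; glue : hom (F gcomod) (G gcomod) }.
Implicit Types A B D P Q : gobj.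

Definition gmor A B (f : comod_hom A B) : Prop := glue B ∘ Fm F f = Fm G f ∘ glue A.

Lemma gmor_id A : @gmor A A (chom_id A).
Proof. by rewrite /gmor !Fm_id comp1l comp1r. Qed.

Lemma gmor_comp A B D (g : comod_hom B D) (f : comod_hom A B) :
  gmor g -> gmor f -> @gmor A D (chom_comp g f).
Proof. by rewrite /gmor !Fm_comp => hg hf; rewrite compA hg -compA hf compA. Qed.

Lemma gmor0 A B : @gmor A B 0.
Proof. by rewrite /gmor !linear0 comp0l comp0r. Qed.

Lemma gmorP A B a (f g : comod_hom A B) : gmor f -> gmor g -> gmor (a *: f + g).
Proof. by rewrite /gmor !linearP compPl compPr => -> ->. Qed.

Lemma gmorZ A B a (f : comod_hom A B) : gmor f -> gmor (a *: f).
Proof. by move=> hf; rewrite -[a *: f]addr0; apply: gmorP => //; exact: gmor0. Qed.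

Lemma gmorD A B (f g : comod_hom A B) : gmor f -> gmor g -> gmor (f + g).
Proof. by move=> hf hg; rewrite -[f]scale1r; exact: gmorP. Qed.

Lemma gmor_sum A B I (r : seq I) (f : I -> comod_hom A B) :
  (forall i, gmor (f i)) -> gmor (\sum_(i <- r) f i).
Proof. by move=> hf; apply: big_ind => //; [exact: gmor0 | exact: gmorD]. Qed.

Lemma gmor_cancel_inj A B D (j : comod_hom B D) (f : comod_hom A B) :
  (forall b, chom j b = 0 -> b = 0) -> gmor j -> @gmor A D (chom_comp j f) -> gmor f.
Proof.
move=> ji; rewrite /gmor !Fm_comp => hj hjf; apply: (@Fm_monic _ _ _ G _ _ j ji).
by rewrite !compA -hj -!compA hjf compA.
Qed.

Lemma gmor_cancel_surj A B D (p : comod_hom A B) (f : comod_hom B D) :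
  (forall b, exists a, chom p a = b) -> gmor p -> @gmor A D (chom_comp f p) -> gmor f.
Proof.
move=> ps; rewrite /gmor !Fm_comp => hp hfp; apply: (@Fm_epic _ _ _ F _ _ p ps).
by rewrite -!compA hp hfp compA.
Qed.

Lemma gmor_inv A B (f : comod_hom A B) (g : comod_hom B A) :
  chom_comp g f = chom_id A -> chom_comp f g = chom_id B -> gmor f -> gmor g.
Proof.
rewrite /gmor => gf fg hf; rewrite -[LHS]comp1l -Fm_id -gf Fm_comp -compA.
by rewrite (compA (Fm G f)) -hf -compA -Fm_comp fg Fm_id comp1r.
Qed.

(** The gluing of A maps F(K) into G(K) = Ker G(A -> A/K): the map A/K -> B induced by f is
    injective, so it suffices to compare in G(B), where f being glued gives zero. *)
Lemma gobj_kernel A B (f : comod_hom A B) (K : comod H) (i : comod_hom K A) :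
  gmor f -> (forall x, chom i x = 0 -> x = 0) ->
  (forall a, chom f a = 0 <-> exists x, chom i x = a) ->
  exists e, @gmor (@GObj K e) A i.
Proof.
move=> hf ii fi.
have [Z [q [qs iq]]] := chom_cokernel i.
have [[_ ker] _] := @Fm_exact _ _ _ G _ _ _ i q ii qs iq.
have [r rE] : exists r : comod_hom Z B, chom_comp r q = f.
  have [_ [_ cok]] := comod_short_exact ii qs iq.
  have [|r [rE _]] := cok B f; last by exists r.
  apply: comod_homP => x; rewrite [RHS]zero_lfunE chom_compE; apply/fi.
  by exists x.
have ri z : chom r z = 0 -> z = 0.
  by have [a <-] := qs z; rewrite -chom_compE rE => /fi/iq.
have [|e [eE _]] := ker (F K) (glue A ∘ Fm F i); last by exists e; rewrite /gmor /= eE.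
apply: (Fm_monic (F := G) ri); rewrite comp0r compA -Fm_comp rE compA -hf -compA.
rewrite -Fm_comp; have -> : chom_comp f i = 0; last by rewrite linear0 comp0r.
by apply: comod_homP => x; rewrite [RHS]zero_lfunE chom_compE; apply/fi; exists x.
Qed.

(** Dually, the gluing of D induces one on the quotient C as soon as Ker p is the image of
    a glued morphism i, since F(P) -> F(Ker p) is epic. *)
Lemma gobj_cokernel P D (i : comod_hom P D) (C : comod H) (p : comod_hom D C) :
  gmor i -> (forall z, exists d, chom p d = z) ->
  (forall d, chom p d = 0 <-> exists x, chom i x = d) ->
  exists e, @gmor D (@GObj C e) p.
Proof.
move=> hi ps ip.
have [K [_ [j [_ [ji _ pj _]]]]] := chom_kernel p.
have [_ [_ cok]] := @Fm_exact _ _ _ F _ _ _ j p ji ps pj.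
have [r rE] : exists r : comod_hom P K, chom_comp j r = i.
  have [[_ ker] _] := comod_short_exact ji ps pj.
  have [|r [rE _]] := ker P i; last by exists r.
  apply: comod_homP => x; rewrite [RHS]zero_lfunE chom_compE; apply/ip.
  by exists x.
have rs z : exists x, chom r x = z.
  have /ip[x xz] : chom p (chom j z) = 0 by apply/pj; exists z.
  exists x; apply/eqP; rewrite -subr_eq0; apply/eqP/ji.
  by rewrite linearB /= -chom_compE rE xz subrr.
have [|e [eE _]] := cok (G C) (Fm G p ∘ glue D); last by exists e; rewrite /gmor /= eE.
apply: (Fm_epic (F := F) rs); rewrite comp0l -!compA -Fm_comp rE hi compA.
rewrite -Fm_comp; have -> : chom_comp p i = 0; last by rewrite linear0 comp0l.
by apply: comod_homP => x; rewrite [RHS]zero_lfunE chom_compE; apply/ip; exists x.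
Qed.

Lemma tens_glue_exists A B : {e : hom (F (comod_tens A B)) (G (comod_tens A B)) |
  e ∘ fJ F A B = fJ G A B ∘ tmor (glue A) (glue B)}.
Proof.
have [J [JK _]] := cid (fJ_iso F A B).
exists (fJ G A B ∘ tmor (glue A) (glue B) ∘ J).
by rewrite -[RHS]comp1r -[in RHS]JK compA.
Qed.

(** The gluing is hidden behind an opaque existence proof, for it must not be unfolded when
    rewriting with associativity. *)
Definition gtens A B : gobj := @GObj (comod_tens A B) (sval (tens_glue_exists A B)).
Lemma glue_tensE A B : glue (gtens A B) ∘ fJ F A B = fJ G A B ∘ tmor (glue A) (glue B).
Proof. exact: (svalP (tens_glue_exists A B)). Qed.

Lemma fJ_epic (F' : tensorFunctor (comodCat H) E) (A B : comod H) : epic (fJ F' A B).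
Proof. exact: is_iso_epic (fJ_iso _ _ _). Qed.

Lemma Fm_tmor (F' : tensorFunctor (comodCat H) E) (A A' B B' : comod H)
  (f : comod_hom A A') (g : comod_hom B B') :
  Fm F' (comod_tmor f g) ∘ fJ F' A B = fJ F' A' B' ∘ tmor (Fm F' f) (Fm F' g).
Proof. exact: esym (fJ_nat F' f g). Qed.

Lemma gmor_tens A A' B B' (f : comod_hom A A') (g : comod_hom B B') :
  gmor f -> gmor g -> @gmor (gtens A B) (gtens A' B') (comod_tmor f g).
Proof.
move=> hf hg; apply: (@fJ_epic F).
rewrite -compA Fm_tmor compA glue_tensE -compA -tmor_comp hf hg tmor_comp.
by rewrite -!compA glue_tensE !compA Fm_tmor.
Qed.

(** Compatibility of the tensor structures of F and G with associativity constraints. *)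
Lemma gmor_assoc A B D :
  @gmor (gtens (gtens A B) D) (gtens A (gtens B D)) (comod_assoc A B D).
Proof.
have epi : epic (fJ F (comod_tens A B) D ∘ tmor (fJ F A B) (id1 (F D))).
  apply: is_iso_epic; apply: is_iso_comp; first exact: fJ_iso.
  by apply: is_iso_tmor; [exact: fJ_iso | exact: is_iso_id].
apply: epi.
have l : glue (gtens A (gtens B D)) ∘ (fJ F A (comod_tens B D) ∘ tmor (id1 (F A)) (fJ F B D))
    = fJ G A (comod_tens B D) ∘ tmor (id1 (G A)) (fJ G B D)
      ∘ tmor (glue A) (tmor (glue B) (glue D)).
  rewrite compA (glue_tensE A (gtens B D)) -!compA -!tmor_comp comp1l comp1r.
  by rewrite (glue_tensE B D).
have r : glue (gtens (gtens A B) D) ∘ (fJ F (comod_tens A B) D ∘ tmor (fJ F A B) (id1 (F D)))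
    = fJ G (comod_tens A B) D ∘ tmor (fJ G A B) (id1 (G D))
      ∘ tmor (tmor (glue A) (glue B)) (glue D).
  rewrite compA (glue_tensE (gtens A B) D) -!compA -!tmor_comp comp1l comp1r.
  by rewrite (glue_tensE A B).
have aF := @fJ_assoc _ _ _ F A B D; have aG := @fJ_assoc _ _ _ G A B D.
rewrite -[LHS]compA -[RHS]compA r.
transitivity (glue (gtens A (gtens B D)) ∘ (fJ F A (comod_tens B D) ∘
    tmor (id1 (F A)) (fJ F B D) ∘ assoc (F A) (F B) (F D))).
  congr (_ ∘ _); rewrite compA; exact: aF.
rewrite compA l -[LHS]compA -assoc_nat [LHS]compA [RHS]compA; congr (_ ∘ _).
by rewrite [RHS]compA; exact: esym aG.
Qed.

Lemma unit_glue_exists : {e : hom (F (comod_unit H)) (G (comod_unit H)) | e ∘ fJ0 F = fJ0 G}.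
Proof.
have [J [JK _]] := cid (fJ0_iso F).
exists (fJ0 G ∘ J).
by rewrite -[RHS]comp1r -[in RHS]JK compA.
Qed.

Definition gunit : gobj := @GObj (comod_unit H) (sval unit_glue_exists).
Lemma glue_unitE : glue gunit ∘ fJ0 F = fJ0 G.
Proof. exact: (svalP unit_glue_exists). Qed.

Lemma gmor_lunit A : @gmor (gtens gunit A) A (comod_lunit A).
Proof.
have epi : epic (fJ F (comod_unit H) A ∘ tmor (fJ0 F) (id1 (F A))).
  apply: is_iso_epic; apply: is_iso_comp; first exact: fJ_iso.
  by apply: is_iso_tmor; [exact: fJ0_iso | exact: is_iso_id].
apply: epi.
have r : glue (gtens gunit A) ∘ (fJ F (comod_unit H) A ∘ tmor (fJ0 F) (id1 (F A)))
    = fJ G (comod_unit H) A ∘ tmor (fJ0 G) (id1 (G A)) ∘ tmor (id1 unit1) (glue A).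
  rewrite compA (glue_tensE gunit A) -!compA -!tmor_comp comp1l !comp1r.
  by rewrite glue_unitE.
transitivity (glue A ∘ lunit (F A)).
  rewrite -[LHS]compA; congr (_ ∘ _); rewrite compA; exact: fJ_lunit.
rewrite -lunit_nat -[RHS]compA r [RHS]compA; congr (_ ∘ _).
by rewrite compA; apply: esym; exact: fJ_lunit.
Qed.

Lemma gmor_runit A : @gmor (gtens A gunit) A (comod_runit A).
Proof.
have epi : epic (fJ F A (comod_unit H) ∘ tmor (id1 (F A)) (fJ0 F)).
  apply: is_iso_epic; apply: is_iso_comp; first exact: fJ_iso.
  by apply: is_iso_tmor; [exact: is_iso_id | exact: fJ0_iso].
apply: epi.
have r : glue (gtens A gunit) ∘ (fJ F A (comod_unit H) ∘ tmor (id1 (F A)) (fJ0 F))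
    = fJ G A (comod_unit H) ∘ tmor (id1 (G A)) (fJ0 G) ∘ tmor (glue A) (id1 unit1).
  rewrite compA (glue_tensE A gunit) -!compA -!tmor_comp comp1l !comp1r.
  by rewrite glue_unitE.
transitivity (glue A ∘ runit (F A)).
  rewrite -[LHS]compA; congr (_ ∘ _); rewrite compA; exact: fJ_runit.
rewrite -runit_nat -[RHS]compA r [RHS]compA; congr (_ ∘ _).
by rewrite compA; apply: esym; exact: fJ_runit.
Qed.

Lemma gmor_runitV A : @gmor A (gtens A gunit) (comod_runitV A).
Proof.
apply: (@gmor_inv (gtens A gunit) A (comod_runit A)) (gmor_runit A).
  exact: comod_runitK.
exact: comod_runitVK.
Qed.

(** Locked for the same reason as the gluing of a tensor product is opaque. *)
Definition glue_sum A B : hom (F (comod_sum A B)) (G (comod_sum A B)) := locked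
  (Fm G (sum_inl A B) ∘ (glue A ∘ Fm F (sum_fst A B))
   + Fm G (sum_inr A B) ∘ (glue B ∘ Fm F (sum_snd A B))).
Definition gsum A B : gobj := @GObj (comod_sum A B) (glue_sum A B).

Section GSum.
Variables A B : gobj.
Lemma gmor_inl : @gmor A (gsum A B) (sum_inl A B).
Proof.
rewrite /gmor /= /glue_sum -lock -[X in X + _]scale1r compPl scale1r -!compA -!Fm_comp !sum_homE.
by rewrite Fm_id !linear0 !comp0r comp1r addr0.
Qed.
Lemma gmor_inr : @gmor B (gsum A B) (sum_inr A B).
Proof.
rewrite /gmor /= /glue_sum -lock -[X in X + _]scale1r compPl scale1r -!compA -!Fm_comp !sum_homE.
by rewrite Fm_id !linear0 !comp0r comp1r add0r.
Qed.
Lemma gmor_fst : @gmor (gsum A B) A (sum_fst A B).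
Proof.
rewrite /gmor /= /glue_sum -lock -[X in X + _]scale1r compPr scale1r.
rewrite !(compA (Fm G _)) -!Fm_comp !sum_homE.
by rewrite Fm_id !linear0 !comp0l comp1l addr0.
Qed.
Lemma gmor_snd : @gmor (gsum A B) B (sum_snd A B).
Proof.
rewrite /gmor /= /glue_sum -lock -[X in X + _]scale1r compPr scale1r.
rewrite !(compA (Fm G _)) -!Fm_comp !sum_homE.
by rewrite Fm_id !linear0 !comp0l comp1l add0r.
Qed.
End GSum.

Section GSpace.
Variables (A : gobj) (S : vectType k).
Local Notation bas i := (vbasis {:S})`_i.

Definition glue_sp : hom (F (sp_comod A S)) (G (sp_comod A S)) := locked
  (\sum_(i < \dim {:S}) Fm G (sp_in A (bas i)) ∘ (glue A ∘ Fm F (sp_pr A (dcoord i)))).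
Definition gsp : gobj := @GObj (sp_comod A S) glue_sp.

Lemma gmor_sp_in s : @gmor A gsp (sp_in A s).
Proof.
rewrite /gmor [glue gsp]/= /glue_sp -lock comp_suml {2}sp_in_sum linear_sum comp_suml.
apply: eq_bigr => i _.
by rewrite -!compA -Fm_comp sp_pr_in !linearZ /= Fm_id compZr comp1r compZr compZl.
Qed.

Lemma gmor_sp_pr f : @gmor gsp A (sp_pr A f).
Proof.
rewrite /gmor [glue gsp]/= /glue_sp -lock comp_sumr {1}sp_pr_sum linear_sum comp_sumr.
apply: eq_bigr => i _.
by rewrite !compA -Fm_comp sp_pr_in !linearZ /= Fm_id compZl comp1l compZr compZl.
Qed.

(** The identity of A ⊗ S is the sum of the projections to A followed by the injections, so
    a map from (or to) A ⊗ S is glued when its components are. *)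
Lemma gmor_from_sp B (f : comod_hom gsp B) :
  (forall s, @gmor A B (chom_comp f (sp_in A s))) -> gmor f.
Proof.
move=> hf; have -> : f = \sum_(i < \dim {:S})
    chom_comp (chom_comp f (sp_in A (bas i))) (sp_pr A (dcoord i)).
  rewrite -[LHS]chom_comp1r sp_id_sum.
  rewrite [LHS](@comp_sumr _ (comodLin H)); apply: eq_bigr => i _; exact: chom_compA.
by apply: gmor_sum => i; apply: gmor_comp (hf _) _; exact: gmor_sp_pr.
Qed.

Lemma gmor_to_sp B (f : comod_hom B gsp) :
  (forall i, @gmor B A (chom_comp (sp_pr A (dcoord i)) f)) -> gmor f.
Proof.
move=> hf; have -> : f = \sum_(i < \dim {:S})
    chom_comp (sp_in A (bas i)) (chom_comp (sp_pr A (dcoord i)) f).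
  rewrite -[LHS]chom_comp1l sp_id_sum.
  rewrite [LHS](@comp_suml _ (comodLin H)); apply: eq_bigr => i _; exact: esym (chom_compA _ _ _).
by apply: gmor_sum => i; apply: gmor_comp (hf _); exact: gmor_sp_in.
Qed.

End GSpace.

End GluedObjects.

(** * Colinearity of theta, and multiplication of tensor powers *)
Section ThetaColinear.
Variables (k : fieldType) (H : hopfAlg k) (X : comod H).
Local Notation T := (talg (matX X)).
Local Notation W := (matX X).
Local Notation Wpow := (matXpow X).

Lemma Hcolinear_linear (D : comod H) (v : {linear D -> H}) :
  (forall d, comul (v d) = tmap idfun v (rho D d)) -> Hcolinear v.
Proof. by move=> h; exists v. Qed.

Lemma Hcolinear_add (D : comod H) (v w u : D -> H) : Hcolinear v -> Hcolinear w ->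
  (forall d, u d = v d + w d) -> Hcolinear u.
Proof.
move=> [v' [v'E vc]] [w' [w'E wc]] uE.
exists (v' \+ w'); split=> d; first by rewrite uE v'E w'E.
rewrite uE linearD vc wc; elim/tens_ind: (rho D d) => [h x|p q hp hq].
  by rewrite !tmapE -tpureDr.
by rewrite !linearD /= -hp -hq addrACA.
Qed.

Lemma mat_elt_Hcolinear w : comul (mat_elt (w : W)) = tmap idfun (@mat_elt _ _ X) (rho W w).
Proof.
elim/tens_ind: w => [x f|y z hy hz]; last by rewrite !linearD /= hy hz.
rewrite mat_elt_coef rho_spE.
have [v [vE ->]] := coef_Hcolinear f.
elim/tens_ind: (rho X x) => [h y|p q hp hq]; last by rewrite !(tpureDl, linearD) /= hp hq.
by rewrite tassocE !tmapE /= mat_elt_coef vE.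
Qed.

Lemma thetaM (x y : T) : theta (x * y) = theta x * theta y.
Proof. exact: (rmorphM (talg_lift (@mat_elt _ _ X))). Qed.
Lemma theta1 : theta (1 : T) = 1.
Proof. exact: (rmorph1 (talg_lift (@mat_elt _ _ X))). Qed.
(** Gives theta its linear structure, needed to apply it inside tensor products and sums. *)
Definition theta_lin : {linear T -> H} := talg_lift (@mat_elt _ _ X).
Lemma theta_linE x : theta_lin x = theta x. Proof. by []. Qed.

Lemma theta_pow_Hcolinear j (x : Wpow j) :
  comul (theta (matXpow_in X j x)) = tmap idfun (theta_lin \o matXpow_in X j) (rho (Wpow j) x).
Proof.
elim: j x => [|j IHj] x.
  have -> : rho (Wpow 0) x = (1 : H) ⊗ (x : k^o) by [].
  rewrite tmapE /= /talg_const -!theta_linE !linearZ /= !theta_linE theta1 comul1.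
  by rewrite tpureZr.
elim/tens_ind: x => [w y|y z hy hz]; last first.
  by rewrite -!theta_linE in hy hz *; rewrite !linearD /= hy hz.
rewrite [matXpow_in _ _ _]/= tmapE tmuE thetaM comulM IHj.
have -> : theta (talg_in w) = mat_elt w by exact: talg_liftE.
rewrite mat_elt_Hcolinear.
have -> : rho (Wpow j.+1) (w ⊗ y) = tpairl (rho W w ⊗ rho (Wpow j) y).
  exact: (@rho_tensE _ _ W (Wpow j)).
elim/tens_ind: (rho W w) => [h v|p q hp hq]; last first.
  by rewrite !(tpureDl, linearD) /= hp hq.
elim/tens_ind: (rho (Wpow j) y) => [g z|p q hp hq]; last first.
  by rewrite !(tpureDr, tpureDl, linearD) /= hp hq.
rewrite tpairlE !tmapE tmulE; congr (_ ⊗ _).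
transitivity (theta (talg_in v * matXpow_in X j z)).
  by rewrite thetaM; congr (_ * _); apply: esym; exact: talg_liftE.
by rewrite [RHS]/= tmapE tmuE.
Qed.

(** Multiplication of T(W) in degrees a and b, as a composite of structure morphisms of
    the monoidal category, hence a glued one. *)
Fixpoint juxt a b : comod_hom (comod_tens (Wpow a) (Wpow b)) (Wpow (a + b)) :=
  match a with
  | 0 => comod_lunit (Wpow b)
  | a'.+1 => chom_comp (comod_tmor (chom_id W) (juxt a' b)) (comod_assoc W (Wpow a') (Wpow b))
  end.

Lemma juxtE a b (x : Wpow a) (y : Wpow b) :
  matXpow_in X (a + b) (chom (juxt a b) (x ⊗ y)) = matXpow_in X a x * matXpow_in X b y.
Proof.
elim: a x => [|a IHa] x.
  rewrite [juxt _ _]/= comod_lunitE tscallE linearZ [matXpow_in X 0 x]/= /talg_const.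
  by rewrite -scalerAl mul1r.
pose f := matXpow_in X (a.+1 + b); pose g := matXpow_in X a.+1; pose J := juxt a.+1 b.
rewrite -/f -/g -/J; elim/tens_ind: x => [w x|x x' hx hx']; last first.
  by rewrite tpureDl !linearD /= mulrDl -hx -hx'.
rewrite /f /g /J => {f g J}.
have -> : chom (juxt a.+1 b) (w ⊗ x ⊗ y) = w ⊗ chom (juxt a b) (x ⊗ y).
  rewrite [juxt _ _]/= chom_compE comod_assocE tassocE comod_tmorE tmapE.
  by congr (_ ⊗ _); exact: chom_idE.
by rewrite [LHS]/= tmapE tmuE /= IHa tmapE tmuE mulrA.
Qed.

End ThetaColinear.

(** * Maps from glued objects to the tensor algebra *)
Section GluedMaps.
Variables (k : fieldType) (H : hopfAlg k) (E : monCat k).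
Variables F G : tensorFunctor (comodCat H) E.
Local Notation gobj := (gobj F G).
Variables (X : comod H) (eX : hom (F X) (G X)).
Local Notation T := (talg (matX X)).

Definition gX : gobj := GObj eX.
Definition gW : gobj := gsp gX (dualsp X).
Fixpoint glue_pow n : hom (F (matXpow X n)) (G (matXpow X n)) :=
  match n with
  | 0 => glue (gunit F G)
  | n'.+1 => glue (gtens gW (@GObj _ _ _ F G (matXpow X n') (glue_pow n')))
  end.
Definition gpow n : gobj := @GObj _ _ _ F G (matXpow X n) (glue_pow n).

Lemma gmor_juxt a b : @gmor _ _ _ _ _ (gtens (gpow a) (gpow b)) (gpow (a + b)) (juxt X a b).
Proof.
elim: a => [|a IHa]; first exact: (@gmor_lunit _ _ _ F G (gpow b)).
apply: (@gmor_comp _ _ _ F G (gtens (gtens gW (gpow a)) (gpow b))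
  (gtens gW (gtens (gpow a) (gpow b))) (gtens gW (gpow (a + b)))).
  by apply: gmor_tens IHa; exact: gmor_id.
exact: (@gmor_assoc _ _ _ F G gW (gpow a) (gpow b)).
Qed.

(** T(W) is not finite dimensional either; gmap says when a linear map to it should be
    considered as glued. *)
Inductive gmap (Q : gobj) : {linear Q -> T} -> Prop :=
| gmap_pow j (b : comod_hom Q (matXpow X j)) of @gmor _ _ _ _ _ Q (gpow j) b :
    gmap (matXpow_in X j \o chom b)
| gmap_add (s t : {linear Q -> T}) of gmap s & gmap t : gmap (s \+ t)
| gmap_ext (s t : {linear Q -> T}) of s =1 t & gmap s : gmap t.

Lemma gmap_comp (P Q : gobj) (f : comod_hom P Q) (s : {linear Q -> T}) :
  gmor f -> gmap s -> gmap (s \o chom f).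
Proof.
move=> hf; elim=> [j b hb|{}s t _ hs _ ht|{}s t st _ hs].
- apply: (gmap_ext (s := matXpow_in X j \o chom (chom_comp b f))).
    by move=> x /=; rewrite chom_compE.
  exact/gmap_pow/gmor_comp.
- by apply: (gmap_ext _ (gmap_add hs ht)).
- by apply: (gmap_ext _ hs) => x /=; exact: st.
Qed.

Lemma gmap0 (Q : gobj) (s : {linear Q -> T}) : (forall q, s q = 0) -> gmap s.
Proof.
move=> s0; apply: (gmap_ext (s := matXpow_in X 0 \o chom (0 : comod_hom Q (matXpow X 0)))).
  by move=> x; rewrite s0 /= zero_lfunE linear0.
exact/gmap_pow/gmor0.
Qed.

Lemma gmap_mul (P Q : gobj) (s : {linear P -> T}) (t : {linear Q -> T}) :
  gmap s -> gmap t -> @gmap (gtens P Q) (@tmu _ T \o tmap s t).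
Proof.
move=> hs ht; elim: hs => [j b hb|{}s s' _ hs _ hs'|{}s s' ss' _ hs].
- elim: ht => [i c hc|{}t t' _ ht _ ht'|{}t t' tt' _ ht].
  + apply: (gmap_ext (Q := gtens P Q) 
        (s := matXpow_in X (j + i) \o chom (chom_comp (juxt X j i) (comod_tmor b c)))).
      apply: (@tens_ext _ P Q) => x y.
      change (matXpow_in X (j + i) (chom (chom_comp (juxt X j i) (comod_tmor b c)) (x ⊗ y)) =
        @tmu _ T (tmap (matXpow_in X j \o chom b) (matXpow_in X i \o chom c) (x ⊗ y))).
      by rewrite chom_compE comod_tmorE !tmapE juxtE tmuE.
    apply: (@gmap_pow (gtens P Q)).
    apply: (@gmor_comp _ _ _ F G (gtens P Q) (gtens (gpow j) (gpow i)) (gpow (j + i))).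
      exact: gmor_juxt.
    exact: gmor_tens.
  + apply: (gmap_ext _ (gmap_add ht ht')).
    apply: (@tens_ext _ P Q) => x y.
    by rewrite [LHS]/= ![in LHS]tmapE !tmuE [RHS]/= tmapE tmuE -mulrDr.
  + apply: (gmap_ext _ ht) => x /=; congr tmu; exact: eq_tmap.
- apply: (gmap_ext _ (gmap_add hs hs')).
  apply: (@tens_ext _ P Q) => x y.
  by rewrite [LHS]/= ![in LHS]tmapE !tmuE [RHS]/= tmapE tmuE -mulrDl.
- apply: (gmap_ext _ hs) => x /=; congr tmu; exact: eq_tmap.
Qed.

(** The number N of components can be enlarged at will, which allows adding two maps. *)
Lemma gmap_normal (Q : gobj) (s : {linear Q -> T}) : gmap s ->
  exists (N : nat) (b : forall j, comod_hom Q (matXpow X j)),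
    (forall j, @gmor _ _ _ _ _ Q (gpow j) (b j)) /\
    forall M, (N <= M)%N -> forall q, s q = \sum_(j < M) matXpow_in X j (chom (b j) q).
Proof.
elim=> [j b hb|{}s t _ [N [b [hb sE]]] _ [N' [b' [hb' tE]]]|{}s t st _ [N [b [hb sE]]]].
(* b is concentrated in degree j; other degrees are filled with zeros. *)
- pose c i : comod_hom Q (matXpow X i) :=
    match j =P i with
    | ReflectT e => ecast z (comod_hom Q (matXpow X z)) e b
    | ReflectF _ => 0
    end.
  have cj : c j = b by rewrite /c; case: eqP => // e; rewrite (eq_axiomK e).
  have ci i : j != i -> c i = 0 by rewrite /c; case: eqP.
  exists j.+1, c; split=> [i|M jM q].
    by have [<-|/ci ->] := eqVneq j i; [rewrite cj | exact: gmor0].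
  rewrite (bigD1 (Ordinal jM)) //= cj big1 ?addr0 // => i ij.
  by rewrite ci ?zero_lfunE ?linear0 // eq_sym.
- exists (maxn N N'), (fun j => b j + b' j); split=> [j|M]; first exact: gmorD.
  rewrite geq_max => /andP[NM N'M] q /=; rewrite (sE _ NM) (tE _ N'M) -big_split.
  by apply: eq_bigr => j _; rewrite /= chomD linearD.
- by exists N, b; split=> // M NM q; rewrite -st; exact: sE.
Qed.

(** The kernel is that of all the components in the powers of W, by matXpow_in_free; it is
    obtained by taking glued kernels one component after the other. *)
Lemma gmap_kernel (Q : gobj) (s : {linear Q -> T}) : gmap s ->
  exists (P : gobj) (i : comod_hom P Q), gmor i /\
    forall q, s q = 0 <-> exists x, chom i x = q.
Proof.
move=> /gmap_normal[N [b [hb sE]]].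
have [P [i [hi [ii iP]]]] : exists (P : gobj) (i : comod_hom P Q), gmor i /\
    (forall x, chom i x = 0 -> x = 0) /\
    forall q, (forall j, (j < N)%N -> chom (b j) q = 0) <-> exists x, chom i x = q.
  elim: {sE} N => [|N [P [i [hi [ii iP]]]]].
    exists Q, (chom_id Q); split; first exact: gmor_id.
    split=> [x|q]; first by rewrite chom_idE.
    by split=> // _; exists q; rewrite chom_idE.
  have hbi : @gmor _ _ _ _ _ P (gpow N) (chom_comp (b N) i) by apply: gmor_comp.
  have [K [_ [f [_ [fi _ fK _]]]]] := chom_kernel (chom_comp (b N) i).
  have [e he] := gobj_kernel hbi fi fK.
  exists (GObj e), (chom_comp i f); split; first exact: gmor_comp hi he.
  split=> [x|q]; first by rewrite chom_compE => /ii/fi.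
  split=> [h|[x <-] j].
    have [|x xq] := (iP q).1; first by move=> j jN; apply: h; exact: ltnW.
    have [|y yx] := (fK x).1; first by rewrite chom_compE xq h.
    by exists y; rewrite chom_compE yx.
  rewrite ltnS leq_eqVlt => /orP[/eqP ->|jN].
    by rewrite chom_compE -chom_compE; apply/fK; exists x.
  by move: j jN; apply/iP; exists (chom f x); rewrite chom_compE.
exists P, i; split=> // q; rewrite -iP (sE N) //; split=> [h j jN|h].
  exact: (@matXpow_in_free _ _ X N (fun j => chom (b j) q)).
by rewrite big1 // => j _; rewrite h ?linear0.
Qed.

Lemma gmap_Hcolinear (Q : gobj) (s : {linear Q -> T}) : gmap s ->
  Hcolinear (fun q : gcomod Q => theta (s q)).
Proof.
elim=> [j b hb|{}s t _ hs _ ht|{}s t st _ hs].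
- apply: (@Hcolinear_comp _ _ Q (matXpow X j) (@theta_lin _ _ X \o matXpow_in X j)).
  by apply: Hcolinear_linear => x; exact: theta_pow_Hcolinear.
- by apply: Hcolinear_add hs ht _ => q; rewrite -!theta_linE -linearD.
- by congr Hcolinear: hs; apply: funext => q; rewrite st.
Qed.

(** Words in W are reached by tensor products of copies of W, sums by direct sums. *)
Lemma gmap_reaches (x : T) : exists (Q : gobj) (s : {linear Q -> T}),
  gmap s /\ exists q, s q = x.
Proof.
have sumP (y z : T) :
    (exists (Q : gobj) (s : {linear Q -> T}), gmap s /\ exists q, s q = y) ->
    (exists (Q : gobj) (s : {linear Q -> T}), gmap s /\ exists q, s q = z) ->
    exists (Q : gobj) (s : {linear Q -> T}), gmap s /\ exists q, s q = y + z.
  move=> [Q [s [hs [q <-]]]] [P [t [ht [p <-]]]]; exists (gsum Q P).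
  exists ((s \o chom (sum_fst Q P)) \+ (t \o chom (sum_snd Q P))); split.
    by apply: gmap_add; apply: gmap_comp => //; [exact: gmor_fst|exact: gmor_snd].
  by exists ((q, p) : comod_sum Q P); rewrite /= sum_fstE sum_sndE.
have constP a : exists (Q : gobj) (s : {linear Q -> T}), gmap s /\ exists q, s q = a *: 1.
  exists (gpow 0), (matXpow_in X 0 \o chom (chom_id (gpow 0))); split.
    by apply: gmap_pow; exact: gmor_id.
  by exists (a : k^o); exact: (congr1 (matXpow_in X 0) (@chom_idE _ _ (gpow 0) (a : k^o))).
rewrite (talg_sum x); elim: (repr x) => [|[a w] r IHr].
  by rewrite big_nil -(scale0r 1); exact: constP.
rewrite big_cons; apply: sumP IHr => /=; elim: w => [|w ws [Q [s [hs [q qE]]]]].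
  by rewrite big_nil.
pose t : {linear gW -> T} := matXpow_in X 1 \o chom (comod_runitV (matX X)).
exists (gtens gW Q), (@tmu _ T \o tmap t s); split.
  apply: gmap_mul hs; apply: (@gmap_pow gW 1 (comod_runitV (matX X))).
  exact: (@gmor_runitV _ _ _ F G gW).
have tw : t w = talg_in w.
  transitivity (matXpow_in X 1 (w ⊗ (1 : k^o))).
    exact: (congr1 (matXpow_in X 1) (@comod_runitVE _ _ (matX X) w)).
  by rewrite /= tmapE tmuE /= /talg_const scale1r mulr1.
exists (w ⊗ q); transitivity (t w * s q); last by rewrite tw qE big_cons -scalerAr.
by rewrite [LHS]/= tmapE tmuE.
Qed.

End GluedMaps.

(** * Gluing the images in H *)
Section Reconstruction.
Variables (k : fieldType) (H : hopfAlg k) (E : monCat k).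
Variables F G : tensorFunctor (comodCat H) E.
Local Notation gobj := (gobj F G).
Variables (X : comod H) (eX : hom (F X) (G X)).
Local Notation T := (talg (matX X)).
Local Notation gpow := (gpow eX).
Local Notation gmap := (@gmap _ _ _ F G X eX).

Variables (R : comod H) (eR : hom (F R) (G R)) (m : nat).
Variable xi : forall j : 'I_m.+1, comod_hom R (matXpow X j).
Let relator (r : R) : T := \sum_(j < m.+1) matXpow_in X j (chom (xi j) r).
Hypothesis xi_gmor : forall j : 'I_m.+1, @gmor _ _ _ _ _ (@GObj _ _ _ F G R eR) (gpow j) (xi j).
Hypothesis relator0 : forall r, theta (relator r) = 0.
Hypothesis relatorP : forall x, theta x = 0 -> gen_ideal (fun y => exists r, y = relator r) x.

Lemma gmap_sum (Q : gobj) n (s : 'I_n -> {linear Q -> T}) : (forall i, gmap (s i)) ->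
  exists u : {linear Q -> T}, gmap u /\ forall q, u q = \sum_i s i q.
Proof.
elim: n s => [|n IHn] s hs.
  by exists \0; split=> [|q]; [exact: gmap0|rewrite big_ord0].
have [u [hu uE]] := IHn (fun i => s (lift ord0 i)) (fun i => hs (lift ord0 i)).
exists (s ord0 \+ u); split=> [|q]; first exact: gmap_add.
by rewrite big_ord_recl -uE.
Qed.

Lemma gmap_copair (P Q : gobj) (s : {linear P -> T}) (t : {linear Q -> T}) :
  gmap s -> gmap t -> exists u : {linear gsum P Q -> T}, gmap u /\
    forall x : comod_sum P Q, u x = s x.1 + t x.2.
Proof.
move=> hs ht; exists ((s \o chom (sum_fst P Q)) \+ (t \o chom (sum_snd P Q))); split.
  by apply: gmap_add; apply: gmap_comp => //; [exact: gmor_fst|exact: gmor_snd].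
by move=> x; congr (s _ + t _); [exact: sum_fstE | exact: sum_sndE].
Qed.

Definition glued_relation (x : T) : Prop := exists (Q : gobj) (s : {linear Q -> T}),
  [/\ gmap s, forall q, theta (s q) = 0 & exists q, s q = x].

(** The glued relations form a two-sided ideal: to multiply s(q) by an arbitrary element t(p) on
    either side, take the product of s and t on the tensor product of the two sources. It
    contains the relators because the xi_j are glued. *)
Lemma relation_lift x : theta x = 0 -> glued_relation x.
Proof.
move=> /relatorP/(_ glued_relation); apply => [|_ [r ->]]; last first.
  have [u [hu uE]] := @gmap_sum (@GObj _ _ _ F G R eR) _
    (fun j => matXpow_in X j \o chom (xi j)) (fun j => gmap_pow (xi_gmor j)).
  by exists (GObj eR), u; split=> // [q|]; [rewrite uE; exact: relator0 | exists r; rewrite uE].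
have theta_mul0 (P Q : gobj) (s : {linear P -> T}) (t : {linear Q -> T}) :
    (forall p, theta (s p) = 0) \/ (forall q, theta (t q) = 0) ->
    forall x : tens P Q, theta (@tmu _ T (tmap s t x)) = 0.
  move=> st0; elim/tens_ind => [p q|y z hy hz]; last first.
    by rewrite -!theta_linE in hy hz *; rewrite !linearD /= hy hz addr0.
  by rewrite tmapE tmuE thetaM; case: st0 => ->; rewrite (mul0r, mulr0).
split.
- exists (gunit F G), \0; split=> [|q|]; [exact: gmap0 | exact: (linear0 (@theta_lin _ _ X)) |].
  by exists 0.
- move=> _ _ [Q [s [hs s0 [q <-]]]] [P [t [ht t0 [p <-]]]].
  have [u [hu uE]] := gmap_copair hs ht.
  exists (gsum Q P), u; split=> // [z|]; last by exists ((q, p) : comod_sum Q P); rewrite uE.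
  by rewrite uE -theta_linE linearD !theta_linE s0 t0 addr0.
- move=> a _ [Q [s [hs s0 [q <-]]]].
  have [P [t [ht [p <-]]]] := @gmap_reaches _ _ _ F G X eX a.
  split.
    exists (gtens P Q), (@tmu _ T \o tmap t s); split; first exact: gmap_mul.
      by move=> z; apply: theta_mul0; right.
    by exists (p ⊗ q); rewrite /= tmapE tmuE.
  exists (gtens Q P), (@tmu _ T \o tmap s t); split; first exact: gmap_mul.
    by move=> z; apply: theta_mul0; left.
  by exists (q ⊗ p); rewrite /= tmapE tmuE.
Qed.

(** By gobj_cokernel it is enough to exhaust Ker p by a glued morphism i. Take i with
    p i = 0 and image of maximal dimension. If d is in Ker p, then t(d) is in Ker theta, so
    t(d) = s(q) for a glued s annihilated by theta. The kernel of t - s on D ⊕ Q is glued;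
    its projection to D is annihilated by p and reaches d, so adding it to i would enlarge
    the image unless d was already there. *)
Lemma glue_quotient (D : gobj) (t : {linear D -> T}) (C : comod H) (p : comod_hom D C)
  (c : C -> H) : gmap t -> (forall z, exists d, chom p d = z) ->
  c 0 = 0 -> (forall z, c z = 0 -> z = 0) -> (forall d, c (chom p d) = theta (t d)) ->
  exists e, @gmor _ _ _ F G D (GObj e) p.
Proof.
move=> ht ps c0 ci cp.
pose Pr n := `[< exists (P : gobj) (i : comod_hom P D), [/\ gmor i,
  forall x, chom p (chom i x) = 0 & \dim (limg (chom i)) = n] >].
have ex : exists n : nat, Pr n.
  exists (\dim (limg (chom (0 : comod_hom D D)))); apply/asboolP; exists D, 0.
  by split=> // [|x]; [exact: gmor0 | rewrite zero_lfunE linear0].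
have ub (n : nat) : Pr n -> (n <= \dim {:D})%N.
  by move=> /asboolP[P [i [_ _ <-]]]; rewrite dimvS // subvf.
have [n /asboolP[P [i [hi pi din]]] nmax] := ex_maxnP ex ub.
suff ip d : chom p d = 0 -> d \in limg (chom i).
  apply: (gobj_cokernel hi ps) => d; split=> [/ip/memv_imgP[x _ ->]|[x <-]]; last exact: pi.
  by exists x.
move=> pd; have [|Q [s [hs s0 [q sq]]]] := @relation_lift (t d); first by rewrite -cp pd.
have hs' : gmap (s \o chom (-1 *: chom_id Q)).
  by apply: gmap_comp hs; apply: gmorZ; exact: gmor_id.
have s'E x : s (chom (-1 *: chom_id Q) x) = - s x.
  by rewrite chomZ chom_idE scaleN1r linearN.
have [u [hu uE]] := gmap_copair ht hs'.
have [K [f [hf fK]]] := gmap_kernel hu.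
pose g : comod_hom K D := chom_comp (sum_fst D Q) f.
have hg : gmor g by apply: gmor_comp hf; exact: gmor_fst.
have gE x : chom g x = (chom f x : comod_sum D Q).1 by rewrite chom_compE sum_fstE.
have pg x : chom p (chom g x) = 0.
  apply: ci; rewrite cp gE.
  have : u (chom f x) = 0 by apply/fK; exists x.
  by rewrite uE /= s'E => /eqP; rewrite subr_eq0 => /eqP ->; exact: s0.
have [y yd] : exists y, chom g y = d.
  have [|y yE] := (fK ((d, q) : comod_sum D Q)).1; first by rewrite uE /= s'E sq subrr.
  by exists y; rewrite gE yE.
pose h : comod_hom (gsum P K) D := chom_comp i (sum_fst P K) + chom_comp g (sum_snd P K).
have hE x : chom h x = chom i (x : comod_sum P K).1 + chom g (x : comod_sum P K).2.
  by rewrite chomD chom_compE sum_fstE; congr (_ + _); rewrite chom_compE sum_sndE.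
have hh : @gmor _ _ _ _ _ (gsum P K) D h.
  by apply: gmorD; apply: gmor_comp => //; [exact: gmor_fst | exact: gmor_snd].
have hn : (\dim (limg (chom h)) <= n)%N.
  apply: nmax; apply/asboolP; exists (gsum P K), h; split=> // x.
  by rewrite hE linearD /= pi pg addr0.
have ih : (limg (chom i) <= limg (chom h))%VS.
  apply/subvP => _ /memv_imgP[x _ ->].
  have -> : chom i x = chom h ((x, 0) : comod_sum P K) by rewrite hE linear0 addr0.
  by rewrite memv_img ?memvf.
have [_] := dimv_leqif_sup ih; rewrite eqn_leq (dimvS ih) din hn => /esym/subvP; apply.
have -> : d = chom h ((0, y) : comod_sum P K) by rewrite hE linear0 add0r.
by rewrite memv_img ?memvf.
Qed.

(** Since colinear maps to H amount to functionals, this says that all colinear maps from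
    D to H lift to glued maps to T(W). *)
Definition liftable (D : gobj) : Prop := forall mu : 'Hom(D, k^o),
  exists t : {linear D -> T}, gmap t /\ forall d, counit (theta (t d)) = mu d.

(** The finite dimensional subcomodules of H, with the gluing that comes from T(W). *)
Structure test := Test {
  test_obj :> gobj;
  test_in : {linear test_obj -> H};
  test_in_Hcolinear : Hcolinear test_in;
  test_in_inj : forall z, test_in z = 0 -> z = 0;
  test_presented : exists (D : gobj) (p : comod_hom D test_obj),
    [/\ liftable D, gmor p & forall z, exists d, chom p d = z]
}.

Lemma lift_to_test (D : gobj) (C : test) (f : comod_hom D C) : liftable D ->
  exists t, gmap t /\ forall d, test_in C (chom f d) = theta (t d).
Proof.
move=> hD; have [t [ht tE]] := hD (linfun (@counit _ H \o (test_in C \o chom f))).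
exists t; split=> //; apply: Hcolinear_counit => [||d].
- exact: Hcolinear_comp (test_in_Hcolinear C).
- exact: gmap_Hcolinear ht.
- by rewrite tE lfunE.
Qed.

Lemma test_image (D : gobj) (t : {linear D -> T}) : liftable D -> gmap t ->
  exists (C : test) (p : comod_hom D C), gmor p /\ forall d, test_in C (chom p d) = theta (t d).
Proof.
move=> hD ht; have [C [p [c [ps ci cH cp]]]] := Hcolinear_image (gmap_Hcolinear ht).
have [e he] := glue_quotient ht ps (linear0 c) ci cp.
have ex : exists (D : gobj) (p : comod_hom D (GObj e)),
    [/\ liftable D, gmor p & forall z, exists d, chom p d = z] by exists D, p.
by exists (@Test (GObj e) c cH ci ex), p.
Qed.

(** Applied to D0 ⊕ D, where D0 -> C is the presentation of C, glue_quotient produces a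
    gluing of C for which the maps from both D0 and D are glued. The first property forces
    it to be the given one. *)
Lemma gmor_to_test (D : gobj) (C : test) (f : comod_hom D C) : liftable D -> gmor f.
Proof.
move=> hD; have [t [ht tE]] := lift_to_test f hD.
have [D0 [p0 [hD0 hp0 p0s]]] := test_presented C.
have [t0 [ht0 t0E]] := lift_to_test p0 hD0.
have [u [hu uE]] := gmap_copair ht0 ht.
pose p : comod_hom (gsum D0 D) C :=
  chom_comp p0 (sum_fst D0 D) + chom_comp f (sum_snd D0 D).
have pE x : chom p x = chom p0 (x : comod_sum D0 D).1 + chom f (x : comod_sum D0 D).2.
  by rewrite chomD !chom_compE sum_fstE sum_sndE.
have [|d|e he] := @glue_quotient (gsum D0 D) u C p (test_in C) hu _ (linear0 _) (@test_in_inj C).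
- move=> z; have [d <-] := p0s z; exists ((d, 0) : comod_sum D0 D).
  by rewrite pE linear0 addr0.
- by rewrite pE uE linearD t0E tE -!theta_linE linearD.
have hp0' : @gmor _ _ _ _ _ D0 (GObj e) p0.
  have -> : p0 = chom_comp p (sum_inl D0 D).
    by apply: comod_homP => x; rewrite chom_compE sum_inlE pE linear0 addr0.
  by apply: (gmor_comp he); exact: gmor_inl.
have ee : e = glue C.
  by apply: (Fm_epic (F := F) p0s); rewrite [RHS]hp0; exact: hp0'.
have -> : f = chom_comp p (sum_inr D0 D).
  by apply: comod_homP => x; rewrite chom_compE sum_inrE pE linear0 add0r.
have := gmor_comp he (gmor_inr D0 D).
by rewrite /gmor /= ee.
Qed.

Lemma gmor_between_tests (C C' : test) (f : comod_hom C C') : gmor f.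
Proof.
have [D [p [hD hp ps]]] := test_presented C.
by apply: (gmor_cancel_surj ps hp); exact: gmor_to_test.
Qed.

Lemma counit_theta_sum n (f : 'I_n -> T) :
  counit (theta (\sum_i f i)) = \sum_i counit (theta (f i)) :> k^o.
Proof. exact: (linear_sum (@counit _ H \o @theta_lin _ _ X : {linear T -> k^o})). Qed.

Lemma liftable_unit : liftable (gunit F G).
Proof.
move=> mu; pose b : comod_hom (gunit F G) (matXpow X 0) :=
  (mu (1 : k^o) : k) *: chom_id (comod_unit H).
exists (matXpow_in X 0 \o chom b); split.
  by apply: gmap_pow; apply: (gmorZ (A := gunit F G) (B := gpow 0)); exact: gmor_id.
move=> d; have -> : mu d = (d : k) * (mu (1 : k^o) : k).
  by rewrite -[d in LHS]mulr1; exact: (linearZ_LR mu d 1).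
have bd : chom b d = (mu (1 : k^o) : k) * (d : k) by rewrite chomZ chom_idE.
transitivity (counit (theta (((mu (1 : k^o) : k) * (d : k)) *: (1 : T)))).
  by congr (counit (theta _)); exact: (congr1 (matXpow_in X 0) bd).
by rewrite -theta_linE !linearZ /= theta_linE theta1 counit1 mulrC; exact: mulr1.
Qed.

Lemma liftable_X : liftable (gX eX).
Proof.
move=> mu; pose b : comod_hom X (matXpow X 1) :=
  chom_comp (comod_runitV (matX X)) (sp_in X (mu : dualsp X)).
exists (matXpow_in X 1 \o chom b); split.
  apply: (@gmap_pow _ _ _ F G X eX (gX eX) 1).
  apply: (@gmor_comp _ _ _ F G (gX eX) (gW eX) (gpow 1)); last exact: gmor_sp_in.
  exact: (@gmor_runitV _ _ _ F G (gW eX)).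
move=> x; rewrite -(counit_coef mu x); apply: (congr1 counit).
transitivity (theta (matXpow_in X 1 (chom b x))) => //.
have -> : chom b x = (x ⊗ (mu : dualsp X)) ⊗ (1 : k^o).
  by rewrite chom_compE comod_runitVE sp_inE.
transitivity (theta (talg_in (x ⊗ (mu : dualsp X) : matX X))); last first.
  by rewrite -mat_elt_coef; exact: talg_liftE.
by congr theta; rewrite [LHS]/= tmapE tmuE /= /talg_const scale1r mulr1.
Qed.

(** A functional on A ⊗ B is a sum of products of functionals, and eps theta is
    multiplicative. *)
Lemma liftable_tens (A B : gobj) : liftable A -> liftable B -> liftable (gtens A B).
Proof.
move=> hA hB mu.
have s_ i := cid (hA (dcoord i)).
pose mu_ i : 'Hom(B, k^o) := linfun (mu \o tpurel (vbasis {:A})`_i : B -> k^o).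
have t_ (i : 'I_(\dim {:A})) := cid (hB (mu_ i)).
have [i|u [hu uE]] := @gmap_sum (gtens A B) _
  (fun i => @tmu _ T \o tmap (sval (s_ i)) (sval (t_ i))).
  by apply: gmap_mul; [case: (s_ i) => ? [] | case: (t_ i) => ? []].
exists u; split=> // x; elim/tens_ind: x => [a b|x y hx hy]; last first.
  by rewrite -!theta_linE in hx hy *; rewrite !linearD /= hx hy.
rewrite uE counit_theta_sum.
transitivity (\sum_(i < \dim {:A}) (dcoord i a : k) * (mu_ i b : k)).
  apply: eq_bigr => i _; rewrite [X in theta X]/= tmapE tmuE thetaM counitM.
  by have [_ sE] := svalP (s_ i); have [_ tE] := svalP (t_ i); rewrite sE tE.
rewrite [in RHS](dcoord_sum a) tpure_suml linear_sum; apply: eq_bigr => i _ /=.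
by rewrite /mu_ [linfun _ b]lfunE tpureZl linearZ.
Qed.

Lemma liftable_sp (A : gobj) (S : vectType k) : liftable A -> liftable (gsp A S).
Proof.
move=> hA mu.
pose mu_ i : 'Hom(A, k^o) := linfun (mu \o tpurer (vbasis {:S})`_i : A -> k^o).
have t_ (i : 'I_(\dim {:S})) := cid (hA (mu_ i)).
have [i|u [hu uE]] := @gmap_sum (gsp A S) _ (fun i => sval (t_ i) \o chom (sp_pr A (dcoord i))).
  by apply: gmap_comp; [exact: gmor_sp_pr | case: (t_ i) => ? []].
exists u; split=> // x; rewrite uE counit_theta_sum.
rewrite {2}(sp_sum x) linear_sum; apply: eq_bigr => i _; case: (t_ i) => t [_ tE] /=.
by rewrite tE lfunE /= sp_inE.
Qed.

Lemma liftable_dsum r (A : 'I_r -> gobj) (S : comod H)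
  (inj : forall i, comod_hom (A i) S) (prj : forall i, comod_hom S (A i)) :
  (forall i, chom_comp (prj i) (inj i) = chom_id (A i)) ->
  (forall i j, i != j -> chom_comp (prj i) (inj j) = 0) ->
  \sum_i chom_comp (inj i) (prj i) = chom_id S ->
  (forall i, liftable (A i)) -> exists e, liftable (@GObj _ _ _ F G S e).
Proof.
move=> pi1 pi0 ip hA.
pose e := \sum_i Fm G (inj i) ∘ (glue (A i) ∘ Fm F (prj i)).
have hp i : @gmor _ _ _ _ _ (GObj e) (A i) (prj i).
  rewrite /gmor /= /e comp_sumr (bigD1 i) //= big1 => [|j ji].
    by rewrite addr0 !compA -Fm_comp pi1 Fm_id comp1l.
  by rewrite !compA -Fm_comp pi0 1?eq_sym // linear0 !comp0l.
exists e => mu; have t_ i := cid (hA i (mu \o chom (inj i))%VF).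
have [i|u [hu uE]] := @gmap_sum (GObj e) _ (fun i => sval (t_ i) \o chom (prj i)).
  by apply: gmap_comp; [exact: hp | case: (t_ i) => ? []].
exists u; split=> // x; rewrite uE counit_theta_sum.
have {2}-> : x = \sum_i chom (inj i) (chom (prj i) x).
  rewrite -[LHS](@chom_idE _ _ S x) -ip chom_sum.
  by apply: eq_bigr => i _; rewrite chom_compE.
rewrite linear_sum; apply: eq_bigr => i _; case: (t_ i) => t [_ tE] /=.
by rewrite tE comp_lfunE.
Qed.

Lemma liftable_tpow n : exists e, liftable (@GObj _ _ _ F G (@tpow _ (comodCat H) X n) e).
Proof.
elim: n => [|n [e he]]; first by exists (glue (gunit F G)); exact: liftable_unit.
exists (glue (gtens (gX eX) (GObj e))); exact: liftable_tens liftable_X he.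
Qed.

Lemma gmor_test_tens (C1 C2 C3 : test) (f : comod_hom (comod_tens C1 C2) C3) :
  @gmor _ _ _ _ _ (gtens C1 C2) C3 f.
Proof.
have [D1 [p1 [hD1 hp1 p1s]]] := test_presented C1.
have [D2 [p2 [hD2 hp2 p2s]]] := test_presented C2.
apply: (@gmor_cancel_surj _ _ _ F G (gtens D1 D2) (gtens C1 C2) C3 (comod_tmor p1 p2)).
- elim/tens_ind => [x y|x y [a <-] [b <-]]; last by exists (a + b); rewrite linearD.
  have [a <-] := p1s x; have [b <-] := p2s y.
  by exists (a ⊗ b); rewrite comod_tmorE tmapE.
- exact: gmor_tens.
- by apply: gmor_to_test; exact: liftable_tens.
Qed.

(** C, as a subcomodule of H, contains the matrix elements of Y. *)
Definition covers (C : test) (Y : comod H) : Prop := forall mu : 'Hom(Y, k^o),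
  exists u : comod_hom Y C, forall y, counit (test_in C (chom u y)) = mu y.

Lemma to_test_eq (C : test) (Y : comod H) (u v : comod_hom Y C) :
  (forall y, counit (test_in C (chom u y)) = counit (test_in C (chom v y))) -> u = v.
Proof.
move=> uv; apply: comod_homP => y; apply/eqP; rewrite -subr_eq0.
apply/eqP/(@test_in_inj C); rewrite linearB /=; apply/eqP; rewrite subr_eq0; apply/eqP.
exact: (Hcolinear_counit (Hcolinear_comp u (test_in_Hcolinear C))
                         (Hcolinear_comp v (test_in_Hcolinear C)) uv).
Qed.

Lemma covers_sub (C : test) (Y Z : comod H) (i : comod_hom Y Z) :
  (forall y, chom i y = 0 -> y = 0) -> covers C Z -> covers C Y.
Proof.
move=> ii CZ mu; have [nu nuE] : exists nu : 'Hom(Z, k^o), forall y, nu (chom i y) = mu y.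
  by apply: hom_extend => y /ii ->; rewrite linear0.
have [u uE] := CZ nu.
by exists (chom_comp u i) => y; rewrite chom_compE uE nuE.
Qed.

Lemma covers_quotient (C : test) (Y Z : comod H) (p : comod_hom Z Y) :
  (forall y, exists z, chom p z = y) -> covers C Z -> covers C Y.
Proof.
move=> ps CZ mu; have [u uE] := CZ (mu \o chom p)%VF.
have [K [_ [i [_ [ii _ ip _]]]]] := chom_kernel p.
have [_ [_ cok]] := comod_short_exact ii ps ip.
have cu z : test_in C (chom u z) = coef mu (chom p z).
  have h := Hcolinear_coef (Hcolinear_comp u (test_in_Hcolinear C)) uE.
  rewrite [LHS]h; apply: esym; apply: coef_chom => x.
  by rewrite comp_lfunE.
have [|v [vE _]] := cok C u.
  apply: comod_homP => x; rewrite [RHS]zero_lfunE chom_compE; apply: (@test_in_inj C).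
  by rewrite cu (ip _).2 ?linear0 //; exists x.
exists v => y; have [z <-] := ps y.
by rewrite -(chom_compE v p) [chom_comp v p]vE uE comp_lfunE.
Qed.

(** The image of D ⊗ *D under (d, f) |-> d_(-1) f(d_(0)) consists of the matrix elements
    of D; it is a test object because this map corresponds to the evaluation functional. *)
Lemma covers_liftable (D : gobj) : liftable D -> exists C : test, covers C D.
Proof.
move=> hD; pose S : vectType k := dualsp D.
have bev : bilin (fun (d : D) (f : S) => (f : 'Hom(D, k^o)) d).
  by split=> [f|d] a x y; rewrite ?linearP // !lfunE /= lfunE.
have hDS := @liftable_sp D S hD.
have [t [ht tE]] := hDS (linfun (tlift bev)).
have [C [p [hp pE]]] := test_image hDS ht.
exists C => mu; exists (chom_comp p (sp_in D (mu : S))) => d.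
by rewrite chom_compE sp_inE pE tE lfunE /= tliftE.
Qed.

Hypothesis X_gen : tensor_generates (X : comodCat H).

(** Y is a subquotient of a sum of tensor powers of X, which is liftable, and matrix
    elements of a subquotient are matrix elements of the whole. *)
Lemma covers_exists (Y : comod H) : exists C : test, covers C Y.
Proof.
have [r [n [S [[inj [prj [pi1 pi0 ip]]] [Z [i [p [im pe]]]]]]]] := X_gen Y.
pose A i : gobj := GObj (projT1 (cid (liftable_tpow (n i)))).
have hA i' : liftable (A i') := projT2 (cid (liftable_tpow (n i'))).
have [e he] := @liftable_dsum r A S inj prj pi1 pi0 ip hA.
have [C CS] := covers_liftable he; exists C.
apply: (covers_quotient (comod_epic_surj pe)).
exact: (covers_sub (comod_monic_inj im)) CS.
Qed.

Lemma covers_joint (A B : comod H) : exists C : test, covers C A /\ covers C B.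
Proof.
have [C CAB] := covers_exists (comod_sum A B); exists C; split.
  apply: (covers_sub (i := sum_inl A B)) CAB => x; rewrite sum_inlE.
  by move=> /(congr1 fst).
apply: (covers_sub (i := sum_inr A B)) CAB => x; rewrite sum_inrE.
by move=> /(congr1 snd).
Qed.

Lemma test_embed (C C' : test) : covers C' C -> exists j : comod_hom C C',
  (forall z, chom j z = 0 -> z = 0) /\ forall z, test_in C' (chom j z) = test_in C z.
Proof.
move=> /(_ (linfun (@counit _ H \o test_in C)))[j jE]; exists j.
have jC z : test_in C' (chom j z) = test_in C z.
  apply: (Hcolinear_counit (Hcolinear_comp j (test_in_Hcolinear C')) (test_in_Hcolinear C)) => y.
  by rewrite [LHS]jE lfunE.
by split=> // z jz; apply: (@test_in_inj C); rewrite -jC jz linear0.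
Qed.

(** The property that characterizes the gluing to be constructed on a comodule. *)
Definition test_compatible (Y : gobj) : Prop :=
  forall (C : test) (u : comod_hom Y C), gmor u.

Lemma test_compatible_sp (A : gobj) (S : vectType k) :
  test_compatible A -> test_compatible (gsp A S).
Proof. by move=> hA C u; apply: gmor_from_sp => s; exact: hA. Qed.

(** The coaction y |-> y_(-1) ⊗ y_(0), with values in C ⊗ Y_space. *)
Lemma covers_embed (C : test) (Y : comod H) : covers C Y ->
  exists e : comod_hom Y (sp_comod C Y), (forall y, chom e y = 0 -> y = 0) /\
    forall (Z : gobj) (f : comod_hom Z Y),
      (forall u : comod_hom Y C, @gmor _ _ _ _ _ Z C (chom_comp u f)) ->
      @gmor _ _ _ _ _ Z (gsp C Y) (chom_comp e f).
Proof.
move=> CY; pose u i := projT1 (cid (CY (dcoord i))).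
have uE i y : counit (test_in C (chom (u i) y)) = dcoord i y by rewrite /u; case: cid.
pose e := \sum_(i < \dim {:Y}) chom_comp (sp_in C (vbasis {:Y})`_i) (u i).
have pe i : chom_comp (sp_pr C (dcoord i)) e = u i.
  rewrite /e [LHS](@comp_sumr _ (comodLin H)) (bigD1 i) //= big1 => [|j ji].
    rewrite addr0; apply: comod_homP => y.
    by rewrite [LHS]chom_compE chom_compE sp_inE sp_prE dcoord_basis eqxx scale1r.
  apply: comod_homP => y.
  rewrite [LHS]chom_compE chom_compE sp_inE sp_prE dcoord_basis eq_sym (negbTE ji).
  by rewrite scale0r zero_lfunE.
exists e; split=> [y ey|Z f hf].
  by apply: dcoord_eq0 => i; rewrite -uE -pe chom_compE ey !linear0.
apply: gmor_to_sp => i.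
have -> : chom_comp (sp_pr C (dcoord i)) (chom_comp e f) = chom_comp (u i) f.
  by rewrite chom_compA pe.
exact: hf.
Qed.

(** Maps to a test object covering Z separate the points of Z. *)
Lemma gmor_test_compatible (Y Z : gobj) (f : comod_hom Y Z) :
  test_compatible Y -> test_compatible Z -> gmor f.
Proof.
move=> hY hZ; have [C CZ] := covers_exists Z; have [e [ei eP]] := covers_embed CZ.
apply: (@gmor_cancel_inj _ _ _ F G Y Z (gsp C Z) e f ei); last by apply: eP => u; exact: hY.
by rewrite -[e]chom_comp1r; apply: eP => u; rewrite chom_comp1r; exact: hZ.
Qed.

(** This allows enlarging the test object C before testing u. *)
Lemma gmor_through_test (Y : gobj) (C C' : test) (u : comod_hom Y C) (j : comod_hom C C') :
  (forall z, chom j z = 0 -> z = 0) -> @gmor _ _ _ _ _ Y C' (chom_comp j u) -> gmor u.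
Proof. by move=> ji; apply: gmor_cancel_inj => //; exact: gmor_between_tests. Qed.

(** H is an injective comodule: a colinear map from Y to a test object extends to M once
    the test object is enlarged, by extending a functional. *)
Lemma test_compatible_sub (Y M : gobj) (i : comod_hom Y M) : gmor i ->
  (forall y, chom i y = 0 -> y = 0) -> test_compatible M -> test_compatible Y.
Proof.
move=> hi ii hM C u; have [C' [C'M C'C]] := covers_joint M C.
have [j [ji jE]] := test_embed C'C.
apply: (gmor_through_test ji).
have [nu nuE] : exists nu : 'Hom(M, k^o), forall y, nu (chom i y) =
    linfun (@counit _ H \o (test_in C \o chom u)) y.
  by apply: hom_extend => y /ii ->; rewrite linear0.
have [v vE] := C'M nu.
have -> : chom_comp j u = chom_comp v i.
  by apply: to_test_eq => y; rewrite !chom_compE jE vE nuE lfunE.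
by apply: gmor_comp hi; exact: hM.
Qed.

(** Y is the kernel of C ⊗ Y_space -> Z -> C' ⊗ Z_space, where Z is the cokernel of the
    embedding of Y; the composite is glued since its components are maps from C to C'. *)
Lemma test_compatible_exists (Y : comod H) : exists e, test_compatible (@GObj _ _ _ F G Y e).
Proof.
have [C CY] := covers_exists Y; have [i [ii _]] := covers_embed CY.
have [Z [q [qs iq]]] := chom_cokernel i.
have [C' C'Z] := covers_exists Z; have [i' [i'i i'P]] := covers_embed C'Z.
have hM : test_compatible (gsp C Y) by apply: test_compatible_sp => D u; exact: gmor_between_tests.
have hf : @gmor _ _ _ _ _ (gsp C Y) (gsp C' Z) (chom_comp i' q).
  by apply: i'P => u; exact: hM.
have [a|e he] := gobj_kernel hf ii.
  by rewrite chom_compE; split=> [/i'i/iq//|/iq ->]; exact: linear0.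
by exists e; exact: (test_compatible_sub he ii hM).
Qed.

(** In a test object C' that contains C and the products of elements of C1 and C2, the map
    u becomes a sum of maps y ⊗ z |-> v_i(y) w_i(z). *)
Lemma test_compatible_tens (A B : gobj) : test_compatible A -> test_compatible B ->
  test_compatible (gtens A B).
Proof.
move=> hA hB C u.
have [C1 C1A] := covers_exists A; have [C2 C2B] := covers_exists B.
have [C' [C'T C'C]] := covers_joint (comod_tens C1 C2) C.
have [j [ji jE]] := test_embed C'C.
apply: (@gmor_through_test (gtens A B) _ _ u j ji).
pose mu : 'Hom(comod_tens A B, k^o) := linfun (@counit _ H \o (test_in C \o chom u)).
pose mu_ i : 'Hom(B, k^o) := linfun (mu \o tpurel (vbasis {:A})`_i : B -> k^o).
pose v i := projT1 (cid (C1A (dcoord i))).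
have vE i a : counit (test_in C1 (chom (v i) a)) = dcoord i a by rewrite /v; case: cid.
pose w i := projT1 (cid (C2B (mu_ i))).
have wE i b : counit (test_in C2 (chom (w i) b)) = mu_ i b by rewrite /w; case: cid.
have [n nE] := C'T (linfun (@tscall _ k^o \o
  tmap (@counit _ H \o test_in C1) (@counit _ H \o test_in C2))).
have -> : chom_comp j u = \sum_(i < \dim {:A}) chom_comp n (comod_tmor (v i) (w i)).
  apply: to_test_eq => x; rewrite chom_compE jE chom_sum.
  rewrite [RHS](linear_sum (@counit _ H \o test_in C' : {linear C' -> k^o})).
  transitivity (mu x); first by rewrite /mu lfunE.
  elim/tens_ind: x => [a b|x y hx hy]; last first.
    by rewrite linearD /= hx hy -big_split; apply: eq_bigr => i _; rewrite !linearD.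
  rewrite [in LHS](dcoord_sum a) tpure_suml linear_sum; apply: eq_bigr => i _.
  transitivity (counit (test_in C' (chom (chom_comp n (comod_tmor (v i) (w i))) (a ⊗ b)))) => //.
  rewrite chom_compE nE comod_tmorE lfunE /= !tmapE tscallE /= vE wE /mu_.
  by rewrite [linfun _ b]lfunE tpureZl linearZ.
apply: gmor_sum => i; apply: (@gmor_comp _ _ _ F G (gtens A B) (gtens C1 C2) C').
  exact: gmor_test_tens.
by apply: gmor_tens; [exact: hA | exact: hB].
Qed.

Lemma test_compatible_liftable (D : gobj) : liftable D -> test_compatible D.
Proof. by move=> hD C u; exact: gmor_to_test. Qed.

Theorem glue_transformation : exists eta : forall A : comod H, hom (F A) (G A),
  [/\ forall A B (f : comod_hom A B), eta B ∘ Fm F f = Fm G f ∘ eta A,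
      forall A B, eta (comod_tens A B) ∘ fJ F A B = fJ G A B ∘ tmor (eta A) (eta B),
      eta (comod_unit H) ∘ fJ0 F = fJ0 G & eta X = eX].
Proof.
pose eta A := projT1 (cid (test_compatible_exists A)).
have heta A : test_compatible (GObj (eta A)) := projT2 (cid (test_compatible_exists A)).
have uniq (A : gobj) : test_compatible A -> eta A = glue A.
  move=> hA; have := @gmor_test_compatible (GObj (eta A)) A (chom_id A) (heta A) hA.
  by rewrite /gmor /= !Fm_id comp1l comp1r.
exists eta; split=> [A B f|A B||].
- exact: (@gmor_test_compatible (GObj (eta A)) (GObj (eta B)) f (heta A) (heta B)).
- rewrite (uniq (gtens (GObj (eta A)) (GObj (eta B)))); last exact: test_compatible_tens.
  exact: (@glue_tensE _ _ _ F G (GObj (eta A)) (GObj (eta B))).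
- rewrite (uniq (gunit F G)); first exact: glue_unitE.
  exact/test_compatible_liftable/liftable_unit.
- exact: (uniq (gX eX) (test_compatible_liftable liftable_X)).
Qed.

End Reconstruction.

(** * Monoidal endomorphisms trivial on a generator *)
Section Uniqueness.
Variables (k : fieldType) (H : hopfAlg k) (E : monCat k).
Variable F : tensorFunctor (comodCat H) E.
Variable zeta : forall A : comod H, hom (F A) (F A).
Hypothesis zeta_nat : forall A B (f : comod_hom A B), zeta B ∘ Fm F f = Fm F f ∘ zeta A.
Hypothesis zeta_tens : forall A B,
  zeta (comod_tens A B) ∘ fJ F A B = fJ F A B ∘ tmor (zeta A) (zeta B).
Hypothesis zeta_unit : zeta (comod_unit H) ∘ fJ0 F = fJ0 F.

Lemma monoidal_endo_id (X : comod H) : tensor_generates (X : comodCat H) ->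
  zeta X = id1 (F X) -> forall A, zeta A = id1 (F A).
Proof.
move=> X_gen zX A.
have zpow n : zeta (@tpow _ (comodCat H) X n) = id1 _.
  elim: n => [|n IHn].
    by apply: (is_iso_epic (fJ0_iso F)); rewrite comp1l; exact: zeta_unit.
  apply: (@fJ_epic _ _ _ F X (@tpow _ (comodCat H) X n)).
  by rewrite comp1l [LHS]zeta_tens zX IHn tmor_id comp1r.
have [r [n [S [[inj [prj [pi1 pi0 ip]]] [Z [i [p [im pe]]]]]]]] := X_gen A.
have idS : id1 (F S) = \sum_j Fm F (inj j : comod_hom _ S) ∘ Fm F (prj j : comod_hom S _).
  rewrite -[LHS](@Fm_id _ _ _ F S) -[chom_id S]ip [LHS]linear_sum.
  by apply: eq_bigr => j _; exact: (@Fm_comp _ _ _ F).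
have zS : zeta S = id1 (F S).
  rewrite -[LHS]comp1r [X in _ ∘ X]idS comp_sumr [RHS]idS; apply: eq_bigr => j _.
  by rewrite compA zeta_nat zpow comp1r.
have zZ : zeta Z = id1 (F Z).
  apply: (Fm_monic (F := F) (comod_monic_inj im)).
  by rewrite -zeta_nat zS comp1l comp1r.
apply: (Fm_epic (F := F) (comod_epic_surj pe)).
by rewrite zeta_nat zZ comp1l comp1r.
Qed.

End Uniqueness.

(** * Reading the data of a domination *)
Section MidGlued.
Variables (k : fieldType) (H : hopfAlg k) (E : monCat k).
Variables F G : tensorFunctor (comodCat H) E.

(** Expressing the interchange map through injections and projections shows that it is
    glued. *)
Lemma mid_hom_sum (A B : comod H) (S T : vectType k) : mid_hom A B S T =
  \sum_(i < \dim {:S}) \sum_(l < \dim {:T})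
    chom_comp (sp_in (comod_tens A B) ((vbasis {:S})`_i ⊗ (vbasis {:T})`_l : tens S T))
      (comod_tmor (sp_pr A (dcoord i)) (sp_pr B (dcoord l))).
Proof.
apply: comod_homP => x; rewrite mk_chomE chom_sum; move: x.
have h a s b t : @tmid _ A S B T (a ⊗ s ⊗ (b ⊗ t)) = \sum_(i < \dim {:S}) chom
    (\sum_(l < \dim {:T})
      chom_comp (sp_in (comod_tens A B) ((vbasis {:S})`_i ⊗ (vbasis {:T})`_l : tens S T))
      (comod_tmor (sp_pr A (dcoord i)) (sp_pr B (dcoord l)))) (a ⊗ s ⊗ (b ⊗ t)).
  rewrite tmidE {1}(dcoord_sum s) tpure_suml tpure_sumr; apply: eq_bigr => i _.
  rewrite {1}(dcoord_sum t) tpure_sumr tpure_sumr chom_sum; apply: eq_bigr => l _.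
  rewrite chom_compE sp_inE comod_tmorE.
  have -> : tmap (chom (sp_pr A (dcoord i))) (chom (sp_pr B (dcoord l))) (a ⊗ s ⊗ (b ⊗ t))
      = ((dcoord i s : k) *: a) ⊗ ((dcoord l t : k) *: b).
    by rewrite tmapE; congr (_ ⊗ _); exact: sp_prE.
  by rewrite !(tpureZl, tpureZr).
elim/tens_ind => [y z|x y hx hy]; last first.
  by rewrite linearD /= hx hy -big_split; apply: eq_bigr => i _; rewrite /= linearD.
elim/tens_ind: y => [a s|y y' hy hy']; last first.
  by rewrite tpureDl linearD /= hy hy' -big_split; apply: eq_bigr => i _; rewrite /= linearD.
elim/tens_ind: z => [b t|z z' hz hz']; last first.
  by rewrite tpureDr linearD /= hz hz' -big_split; apply: eq_bigr => i _; rewrite /= linearD.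
exact: h.
Qed.

Lemma gmor_mid (A B : gobj F G) (S T : vectType k) :
  @gmor _ _ _ _ _ (gtens (gsp A S) (gsp B T)) (gsp (gtens A B) (tens S T)) (mid_hom A B S T).
Proof.
rewrite mid_hom_sum; apply: gmor_sum => i; apply: gmor_sum => l.
apply: (@gmor_comp _ _ _ F G (gtens (gsp A S) (gsp B T)) (gtens A B)).
  exact: gmor_sp_in.
by apply: gmor_tens; exact: gmor_sp_pr.
Qed.

Lemma mid_hom_inj (A B : comod H) (S T : vectType k) x :
  chom (mid_hom A B S T) x = 0 -> x = 0.
Proof.
rewrite mk_chomE => x0.
have -> : x = @tmid _ A B S T (@tmid _ A S B T x).
  apply: (@tens_ext2 _ _ _ _ _ _ idfun (@tmid _ A B S T \o @tmid _ A S B T)) => a s b t /=.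
  by rewrite !tmidE.
by rewrite x0 linear0.
Qed.

End MidGlued.

Lemma shuffle_inj (k : fieldType) (H : hopfAlg k) (I : Type) (V : I -> comodCat H) (i : I)
  (S : vectType k) n x : chom (shuffle V i S n) x = 0 -> x = 0.
Proof.
elim: n x => [|n IHn] x.
  rewrite [shuffle _ _ _ _]/= sp_inE => x0.
  by rewrite -[x]mulr1 mulrC -[LHS](tscalrE (V := k^o)) x0 linear0.
rewrite [shuffle _ _ _ _]/= chom_compE => /mid_hom_inj.
rewrite comod_tmorE -(linear0 (tmap (chom (chom_id (sp_comod (V i) S))) (chom (shuffle V i S n)))).
apply: tmap_inj => [y y0|]; last exact: IHn.
exact: (etrans (esym (@chom_idE _ _ (sp_comod (V i) S) y)) y0).
Qed.

Section Data.
Variables (k : fieldType) (H : hopfAlg k) (E : monCat k).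
Variables F G : tensorFunctor (comodCat H) E.
Variables (I : Type) (V : I -> comodCat H) (phi : forall i, hom (F (V i)) (G (V i))).

Fixpoint glue_word (w : tword I) : hom (F (tw_obj V w)) (G (tw_obj V w)) :=
  match w with
  | TWone => glue (gunit F G)
  | TWvar i => phi i
  | TWmul a b => glue (gtens (@GObj _ _ _ F G (tw_obj V a) (glue_word a))
                           (@GObj _ _ _ F G (tw_obj V b) (glue_word b)))
  end.
Definition gword w : gobj F G := @GObj _ _ _ F G (tw_obj V w) (glue_word w).

Lemma glue_wordE w : glue_word w ∘ tw_fun F V w = tw_fun G V w ∘ tw_mor phi w.
Proof.
elim: w => [|i|a IHa b IHb] /=; first by rewrite comp1r; exact: glue_unitE.
  by rewrite comp1l comp1r.
rewrite compA [_ ∘ fJ F _ _](@glue_tensE _ _ _ F G (gword a) (gword b)).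
by rewrite -!compA -!tmor_comp -IHa -IHb.
Qed.

Lemma tw_fun_iso (F' : tensorFunctor (comodCat H) E) w : is_iso (tw_fun F' V w).
Proof.
elim: w => [|i|a IHa b IHb] /=; [exact: fJ0_iso | exact: is_iso_id |].
by apply: is_iso_comp; [exact: fJ_iso | exact: is_iso_tmor].
Qed.

(** A morphism induced by phi is the gluing of the tensor product of the word with S,
    because the maps x |-> x ⊗ s are jointly epic. *)
Lemma induced_sp w (S : vectType k) (psi : hom (F (sp_comod (tw_obj V w) S)) _) :
  induced phi (Z := sp_tensor (tw_obj V w) S) psi -> psi = glue (gsp (gword w) S).
Proof.
move=> h; pose P : gobj F G := GObj psi.
have : @gmor _ _ _ _ _ (gsp (gword w) S) P (chom_id _).
  apply: gmor_from_sp => s; rewrite chom_comp1l.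
  apply: (is_iso_epic (tw_fun_iso F w)); rewrite -compA [LHS](h s).
  by rewrite -compA -glue_wordE compA.
by rewrite /gmor !Fm_id comp1l comp1r => PE; exact: PE.
Qed.

Section Shuffle.
Variables (i : I) (S : vectType k).
Local Notation spow n := (@tpow _ (comodCat H) (sp_comod (V i) S) n).
Variable P : forall n, hom (F (spow n)) (G (spow n)).
Local Notation gspow n := (@GObj _ _ _ F G (spow n) (P n)).

(** P is kept abstract: in the application it is the gluing of the powers of W, which is
    defined by the same recursion. *)
Lemma gmor_shuffle n : P 0 = glue (gunit F G) ->
  (forall n, P n.+1 = glue (gtens (gsp (gword (TWvar i)) S) (gspow n))) ->
  @gmor _ _ _ _ _ (gspow n) (gsp (gword (tw_pow i n)) (vtpow S n)) (shuffle V i S n).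
Proof.
move=> P0 PS; elim: n => [|n IHn].
  by rewrite P0; exact: (@gmor_sp_in _ _ _ F G (gunit F G)).
rewrite PS; apply: (@gmor_comp _ _ _ F G (gtens (gsp (gword (TWvar i)) S) (gspow n))
  (gtens (gsp (gword (TWvar i)) S) (gsp (gword (tw_pow i n)) (vtpow S n)))).
  exact: (@gmor_mid _ _ _ F G (gword (TWvar i)) (gword (tw_pow i n))).
by apply: gmor_tens IHn; exact: gmor_id.
Qed.

End Shuffle.

End Data.

(** * Inverse gluings *)
Section Inverse.
Variables (k : fieldType) (H : hopfAlg k) (E : monCat k).
Variables F G : tensorFunctor (comodCat H) E.

Definition left_inv (A : comod H) (e : hom (F A) (G A)) (e' : hom (G A) (F A)) : Prop :=
  e' ∘ e = id1 (F A).

Lemma left_inv_unit : left_inv (glue (gunit F G)) (glue (gunit G F)).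
Proof.
by apply: (is_iso_epic (fJ0_iso F)); rewrite comp1l -compA (glue_unitE F G) (glue_unitE G F).
Qed.

Lemma left_inv_tens (A B : comod H) eA eA' eB eB' :
  @left_inv A eA eA' -> @left_inv B eB eB' ->
  left_inv (glue (gtens (GObj eA) (GObj eB))) (glue (gtens (GObj eA') (GObj eB'))).
Proof.
move=> hA hB; apply: (@fJ_epic _ _ _ F A B).
rewrite comp1l -compA [_ ∘ fJ F _ _](@glue_tensE _ _ _ F G (GObj eA) (GObj eB)).
rewrite compA [_ ∘ fJ G _ _](@glue_tensE _ _ _ G F (GObj eA') (GObj eB')).
by rewrite -compA -tmor_comp hA hB tmor_id comp1r.
Qed.

Lemma left_inv_sp (A : comod H) (S : vectType k) e e' : @left_inv A e e' ->
  left_inv (glue (gsp (GObj e) S)) (glue (gsp (GObj e') S)).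
Proof.
move=> he; set g := glue _; set g' := glue _.
have gE s : g ∘ Fm F (sp_in A s) = Fm G (sp_in A s) ∘ e.
  exact: (@gmor_sp_in _ _ _ F G (GObj e) S).
have g'E s : g' ∘ Fm G (sp_in A s) = Fm F (sp_in A s) ∘ e'.
  exact: (@gmor_sp_in _ _ _ G F (GObj e') S).
have id_sp : id1 (F (sp_comod A S)) = \sum_(i < \dim {:S})
    Fm F (sp_in A (vbasis {:S})`_i) ∘ Fm F (sp_pr A (dcoord i)).
  rewrite -[LHS](@Fm_id _ _ _ F (sp_comod A S)) sp_id_sum [LHS]linear_sum.
  by apply: eq_bigr => i _; exact: (@Fm_comp _ _ _ F).
rewrite /left_inv -[LHS]comp1r [X in _ ∘ X]id_sp comp_sumr [RHS]id_sp.
apply: eq_bigr => i _; rewrite compA -[X in X ∘ _]compA gE [X in X ∘ _]compA g'E.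
by rewrite -[X in X ∘ _]compA he comp1r.
Qed.

Lemma left_inv_pow (X : comod H) e e' n : @left_inv X e e' ->
  left_inv (glue (gpow e n)) (glue (gpow e' n)).
Proof.
move=> he; elim: n => [|n IHn]; first exact: left_inv_unit.
by apply: left_inv_tens IHn; exact: left_inv_sp.
Qed.

End Inverse.

(** * The domination theorem *)
Section Domination.
Variables (k : fieldType) (H : hopfAlg k) (X : comod H).
Hypothesis X_gen : tensor_generates (X : comodCat H).
Variables (R : bicomod H) (m : nat) (xi : forall j : 'I_m.+1, comod_hom R (matXpow X j)).
Hypothesis R_rel : generates_relations xi.

Lemma gen_mors_dominate : dominated (gen_mors xi).
Proof.
move=> E F G [phi [phi_iso phi_xi]].
pose eX : hom (F X) (G X) := phi true; pose eR : hom (F R) (G R) := phi false.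
(* The intertwining condition is stated after rearranging the factors by shuffle; as
   shuffle is glued and injective it can be cancelled. *)
have xiF (j : 'I_m.+1) : @gmor _ _ _ _ _ (@GObj _ _ _ F G R eR) (gpow eX j) (xi j).
  have [psi [psi' [hpsi hpsi' e]]] := phi_xi j.
  have psiE : psi = eR.
    have := hpsi 1; rewrite /= scale1r.
    by rewrite [fmor F _](@fmor_id _ _ _ F) [fmor G _](@fmor_id _ _ _ G) !comp1l comp1r.
  have psi'E := @induced_sp _ _ _ F G _ (gen_objs X R) phi (tw_pow true j) _ psi' hpsi'.
  apply: (@gmor_cancel_inj _ _ _ F G (@GObj _ _ _ F G R eR) (gpow eX j)
    (gsp (gword phi (tw_pow true j)) (vtpow (dualsp X) j)) 
    (shuffle (gen_objs X R) true (dualsp X) j)).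
  - exact: shuffle_inj.
  - exact: (@gmor_shuffle _ _ _ F G _ (gen_objs X R) phi true (dualsp X) (glue_pow eX) j).
  - by rewrite /gmor -psi'E -psiE; exact: e.
have [[eX' [eX'K eXK']] [eR' [_ eRK']]] : is_iso eX /\ is_iso eR.
  by split; [exact: (phi_iso true) | exact: (phi_iso false)].
(* The inverse gluings satisfy the same condition with F and G exchanged. *)
have xiG (j : 'I_m.+1) : @gmor _ _ _ _ _ (@GObj _ _ _ G F R eR') (gpow eX' j) (xi j).
  rewrite /gmor -[LHS]comp1r -[id1 _]eRK' compA -[X in X ∘ _]compA.
  rewrite -[Fm G _ ∘ eR](xiF j) [X in X ∘ _]compA.
  by rewrite [X in X ∘ Fm F _](@left_inv_pow _ _ _ F G X _ _ j eX'K) comp1l.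
have [_ _ ideal] := R_rel.
have rel0 r : theta (\sum_(j < m.+1) matXpow_in X j (chom (xi j) r)) = 0.
  by apply/ideal => J _; apply; exists r.
have relP x := (ideal x).1.
have [eta [eta_nat eta_tens eta1 etaX]] := glue_transformation xiF rel0 relP X_gen.
have [eta' [eta'_nat eta'_tens eta'1 eta'X]] := glue_transformation xiG rel0 relP X_gen.
have K A : eta' A ∘ eta A = id1 (F A).
  apply: (@monoidal_endo_id _ _ _ F (fun A => eta' A ∘ eta A) _ _ _ X X_gen).
  - by move=> B C f; rewrite -compA eta_nat compA eta'_nat compA.
  - by move=> B C; rewrite -compA eta_tens compA eta'_tens -compA -tmor_comp.
  - by rewrite -compA eta1 eta'1.
  - by rewrite etaX eta'X.
have K' A : eta A ∘ eta' A = id1 (G A).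
  apply: (@monoidal_endo_id _ _ _ G (fun A => eta A ∘ eta' A) _ _ _ X X_gen).
  - by move=> B C f; rewrite -compA eta'_nat compA eta_nat compA.
  - by move=> B C; rewrite -compA eta'_tens compA eta_tens -compA -tmor_comp.
  - by rewrite -compA eta'1 eta1.
  - by rewrite etaX eta'X.
exists eta; split=> //; first by move=> A; exists (eta' A).
Qed.

End Domination.

Theorem proposition3p12 (k : closedFieldType) (H : hopfAlg k)
    (H_fp : finitely_presented H)
    (X : comod H) (X_gen : tensor_generates (X : comodCat H))
    (R : bicomod H) (m : nat) (xi : forall j : 'I_m.+1, comod_hom R (matXpow X j))
    (R_rel : generates_relations xi) :
  dominated (gen_mors xi) /\ finitely_dominated (comodCat H).
Proof.
have xi_dom := gen_mors_dominate X_gen R_rel.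
by split=> //; exists bool, 'I_m.+1, (gen_objs X R), (gen_mors xi).
Qed.
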